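(* Let $N\ge 1$, $\frac{2N}{N+1}<p<2$ and $0<q<\frac p2$. Let $u_0\in L^1(\mathbb{R}^N)\cap W^{1,\infty}(\mathbb{R}^N)$ with $u_0\ge 0$ and $u_0\not\equiv 0$, and let $u$ be the solution of the Cauchy problem $$\partial_t u-\Delta_p u+|\nabla u|^q=0 \ \text{ in } (0,\infty)\times\mathbb{R}^N,\qquad u(0)=u_0 \ \text{ in } \mathbb{R}^N.$$ (a) If there is $C_0>0$ such that $u_0(x)\le C_0(1+|x|)^{-q/(1-q)}$ for all $x\in\mathbb{R}^N$, then the extinction time $T_e$ of $u$ is positive and finite. (b) If $\lim_{|x|\to\infty}|x|^{q/(1-q)}u_0(x)=\infty$ and $u_0(x)>0$ for every $x\in\mathbb{R}^N$, then $T_e=\infty$ and $\mathcal{P}(t)=\mathbb{R}^N$ for every $t>0$.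
   Context: $\Delta_p u=\mathrm{div}(|\nabla u|^{p-2}\nabla u)$. For such $p,q,u_0$ the Cauchy problem has a unique non-negative viscosity solution $u$ (viscosity solutions being understood in the sense adapted to the singular $p$-Laplacian, with test functions restricted to the admissible class $\mathcal{A}$ described below), which is also a weak solution; ''the solution'' refers to it. The admissible class: $\mathcal{F}_p$ is the set of $\xi\in C^2([0,\infty))$ with $\xi(0)=\xi'(0)=\xi''(0)=0$, $\xi''(r)>0$ for $r>0$, and $\lim_{r\to0}|\xi'(r)|^{p-2}\xi''(r)=0$; $\mathcal{A}$ is the set of $\psi\in C^2((0,\infty)\times\mathbb{R}^N)$ such that for every $(t_0,x_0)$ with $\nabla\psi(t_0,x_0)=0$ there exist $\delta>0$, $\xi\in\mathcal{F}_p$ and a continuous $\omega\ge0$ on $[0,\infty)$ with $\omega(t)/t\to0$ as $t\to0$ such that $|\psi(t,x)-\psi(t_0,x_0)-\partial_t\psi(t_0,x_0)(t-t_0)|\le\xi(|x-x_0|)+\omega(|t-t_0|)$ for $(t,x)\in(t_0-\delta,t_0+\delta)\times B_\delta(x_0)$. An upper semicontinuous $u$ is a viscosity subsolution on $(0,T)\times\mathbb{R}^N$ if whenever $\psi\in\mathcal{A}$ and $u-\psi$ has a local maximum at $(t_0,x_0)$, one has $\partial_t\psi\le\Delta_p\psi-|\nabla\psi|^q$ at $(t_0,x_0)$ if $\nabla\psi(t_0,x_0)\ne0$, and $\partial_t\psi(t_0,x_0)\le0$ if $\nabla\psi(t_0,x_0)=0$; a lower semicontinuous $u$ is a viscosity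 supersolution if $-u$ is a viscosity subsolution (equivalently, reversed inequalities at local minima of $u-\psi$); a viscosity solution is a continuous function that is both. Extinction time: $T_e=\sup\{t\ge0: u(t)\not\equiv0\}$. Positivity set: $\mathcal{P}(t)=\{x\in\mathbb{R}^N: u(t,x)>0\}$. *)

(* Defs.v *)
From Stdlib Require Import Reals Lra.
From Stdlib Require Vectors.Fin.
Open Scope R_scope.

Definition RN (N : nat) : Type := Fin.t N -> R.

Fixpoint sumFin (n : nat) : (Fin.t n -> R) -> R :=
  match n with
  | O => fun _ => 0
  | S m => fun f => f Fin.F1 + sumFin m (fun i => f (Fin.FS i))
  end.

Definition normN {N : nat} (x : RN N) : R := sqrt (sumFin N (fun i => x i ^ 2)).
Definition vminus {N : nat} (x y : RN N) : RN N := fun i => x i - y i.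

Definition upd {N : nat} (x : RN N) (i : Fin.t N) (h : R) : RN N :=
  fun j => if Fin.eq_dec j i then h else x j.

Definition dt_at {N : nat} (F : R -> RN N -> R) (t : R) (x : RN N) (l : R) : Prop :=
  derivable_pt_lim (fun s => F s x) t l.
Definition dx_at {N : nat} (i : Fin.t N) (F : R -> RN N -> R) (t : R) (x : RN N) (l : R) : Prop :=
  derivable_pt_lim (fun h => F t (upd x i h)) (x i) l.

Definition cont_pos_at {N : nat} (F : R -> RN N -> R) (t : R) (x : RN N) : Prop :=
  forall eps, 0 < eps -> exists delta, 0 < delta /\
    forall s y, 0 < s -> Rabs (s - t) < delta -> normN (vminus y x) < delta ->
      Rabs (F s y - F t x) < eps.

Definition cont_closed {N : nat} (F : R -> RN N -> R) : Prop :=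
  forall t x, 0 <= t -> forall eps, 0 < eps -> exists delta, 0 < delta /\
    forall s y, 0 <= s -> Rabs (s - t) < delta -> normN (vminus y x) < delta ->
      Rabs (F s y - F t x) < eps.

Definition is_C2 {N : nat} (psi Dt : R -> RN N -> R) (Dx : Fin.t N -> R -> RN N -> R) : Prop :=
  exists (Dtt : R -> RN N -> R) (Dtx Dxt : Fin.t N -> R -> RN N -> R)
         (Dxx : Fin.t N -> Fin.t N -> R -> RN N -> R),
  forall t x, 0 < t ->
    dt_at psi t x (Dt t x) /\
    (forall i, dx_at i psi t x (Dx i t x)) /\
    dt_at Dt t x (Dtt t x) /\
    (forall i, dx_at i Dt t x (Dtx i t x)) /\
    (forall i, dt_at (Dx i) t x (Dxt i t x)) /\
    (forall i j, dx_at j (Dx i) t x (Dxx i j t x)) /\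
    cont_pos_at psi t x /\ cont_pos_at Dt t x /\ (forall i, cont_pos_at (Dx i) t x) /\
    cont_pos_at Dtt t x /\ (forall i, cont_pos_at (Dtx i) t x) /\
    (forall i, cont_pos_at (Dxt i) t x) /\ (forall i j, cont_pos_at (Dxx i j) t x).

Definition rderiv0 (f : R -> R) (l : R) : Prop :=
  forall eps, 0 < eps -> exists delta, 0 < delta /\
    forall h, 0 < h < delta -> Rabs ((f h - f 0) / h - l) < eps.

Definition in_Fp (p : R) (xi : R -> R) : Prop :=
  exists xi1 xi2 : R -> R,
    (forall r, 0 < r -> derivable_pt_lim xi r (xi1 r)) /\
    (forall r, 0 < r -> derivable_pt_lim xi1 r (xi2 r)) /\
    rderiv0 xi (xi1 0) /\ rderiv0 xi1 (xi2 0) /\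
    (forall r, 0 <= r -> forall eps, 0 < eps -> exists delta, 0 < delta /\
        forall s, 0 <= s -> Rabs (s - r) < delta -> Rabs (xi2 s - xi2 r) < eps) /\
    xi 0 = 0 /\ xi1 0 = 0 /\ xi2 0 = 0 /\
    (forall r, 0 < r -> 0 < xi2 r) /\
    (forall eps, 0 < eps -> exists delta, 0 < delta /\
        forall r, 0 < r < delta -> Rabs (Rpower (Rabs (xi1 r)) (p - 2) * xi2 r) < eps).

Definition omega_ok (om : R -> R) : Prop :=
  (forall t, 0 <= t -> forall eps, 0 < eps -> exists delta, 0 < delta /\
      forall s, 0 <= s -> Rabs (s - t) < delta -> Rabs (om s - om t) < eps) /\
  (forall t, 0 <= t -> 0 <= om t) /\
  (forall eps, 0 < eps -> exists delta, 0 < delta /\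
      forall t, 0 < t < delta -> Rabs (om t / t) < eps).

Definition admissible {N : nat} (p : R) (psi Dt : R -> RN N -> R)
    (Dx : Fin.t N -> R -> RN N -> R) : Prop :=
  is_C2 psi Dt Dx /\
  forall t0 x0, 0 < t0 -> (forall i, Dx i t0 x0 = 0) ->
    exists delta, 0 < delta /\ exists xi om, in_Fp p xi /\ omega_ok om /\
      forall t x, 0 < t -> Rabs (t - t0) < delta -> normN (vminus x x0) < delta ->
        Rabs (psi t x - psi t0 x0 - Dt t0 x0 * (t - t0))
          <= xi (normN (vminus x x0)) + om (Rabs (t - t0)).

Definition grad {N : nat} (Dx : Fin.t N -> R -> RN N -> R) (t : R) (x : RN N) : RN N :=
  fun i => Dx i t x.

Definition plap_at {N : nat} (p : R) (Dx : Fin.t N -> R -> RN N -> R)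
    (t : R) (x : RN N) (L : R) : Prop :=
  exists d : Fin.t N -> R,
    (forall i, derivable_pt_lim
       (fun h => Rpower (normN (grad Dx t (upd x i h))) (p - 2) * Dx i t (upd x i h))
       (x i) (d i)) /\
    L = sumFin N d.

Definition loc_max {N : nat} (f : R -> RN N -> R) (t0 : R) (x0 : RN N) : Prop :=
  exists r, 0 < r /\ forall t x, 0 < t -> Rabs (t - t0) < r -> normN (vminus x x0) < r ->
    f t x <= f t0 x0.
Definition loc_min {N : nat} (f : R -> RN N -> R) (t0 : R) (x0 : RN N) : Prop :=
  exists r, 0 < r /\ forall t x, 0 < t -> Rabs (t - t0) < r -> normN (vminus x x0) < r ->
    f t0 x0 <= f t x.

Definition visc_sub {N : nat} (p q : R) (u : R -> RN N -> R) : Prop :=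
  forall psi Dt Dx, admissible p psi Dt Dx ->
  forall t0 x0, 0 < t0 -> loc_max (fun t x => u t x - psi t x) t0 x0 ->
    (normN (grad Dx t0 x0) <> 0 ->
       forall L, plap_at p Dx t0 x0 L ->
         Dt t0 x0 <= L - Rpower (normN (grad Dx t0 x0)) q) /\
    (normN (grad Dx t0 x0) = 0 -> Dt t0 x0 <= 0).

Definition visc_super {N : nat} (p q : R) (u : R -> RN N -> R) : Prop :=
  forall psi Dt Dx, admissible p psi Dt Dx ->
  forall t0 x0, 0 < t0 -> loc_min (fun t x => u t x - psi t x) t0 x0 ->
    (normN (grad Dx t0 x0) <> 0 ->
       forall L, plap_at p Dx t0 x0 L ->
         L - Rpower (normN (grad Dx t0 x0)) q <= Dt t0 x0) /\
    (normN (grad Dx t0 x0) = 0 -> 0 <= Dt t0 x0).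

Definition visc_solution {N : nat} (p q : R) (u : R -> RN N -> R) : Prop :=
  (forall t x, 0 < t -> cont_pos_at u t x) /\ visc_sub p q u /\ visc_super p q u.

Definition vnil : RN 0 := fun i => Fin.case0 (fun _ => R) i.
Definition fcons {n : nat} (a : R) (y : RN n) : RN (S n) :=
  fun i => Fin.caseS' i (fun _ => R) a y.

Fixpoint IntCube (N : nat) (Rr : R) : (RN N -> R) -> R -> Prop :=
  match N with
  | O => fun f I => I = f vnil
  | S n => fun f I => exists g : R -> R,
      (forall a, -Rr <= a <= Rr -> IntCube n Rr (fun y => f (fcons a y)) (g a)) /\
      exists pr : Riemann_integrable g (- Rr) Rr, RiemannInt pr = I
  end.

(** u0 in L^1(R^N) (for continuous u0): integrals of |u0| over cubes exist and are bounded. *)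
Definition L1 {N : nat} (u0 : RN N -> R) : Prop :=
  exists M, forall Rr, 0 < Rr -> exists I, IntCube N Rr (fun x => Rabs (u0 x)) I /\ I <= M.

(** u0 in W^{1,oo}(R^N): bounded and Lipschitz (continuous representative). *)
Definition W1inf {N : nat} (u0 : RN N -> R) : Prop :=
  (exists M, forall x, Rabs (u0 x) <= M) /\
  (exists K, forall x y, Rabs (u0 x - u0 y) <= K * normN (vminus x y)).

(** The set {t >= 0 : u(t) is not identically 0}; T_e is its supremum. *)
Definition nonext_set {N : nat} (u : R -> RN N -> R) (t : R) : Prop :=
  0 <= t /\ exists x, u t x <> 0.

(* Main.v *)
(* Idea.  Smooth strict super- and subsolutions are compared with [u] at a contact point, which
   requires no doubling of variables.  Put [k = q / (1 - q)].

   Since [p < 2], there are barriers on a ball that are infinite on its boundary, so that [u (t, x)]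
   is controlled by the supremum of [u0] on a large ball around [x], whatever [u] does far away.
   In case (a) [u] therefore stays small at infinity, and it can be compared with
     [(b (T - t)^(-nu) + kappa (T - t)^(-1/q) |x|)^(-k)],
   a self-similar supersolution which vanishes as [t] tends to [T]; its cusp at the origin is
   harmless because it is a minimum of smooth supersolutions.  In case (b) the functions
   [A exp (-t) (b + |x|^n)^(-k/n)], with [A] large, then [b] large, are positive subsolutions below [u0].

   A test function must be so flat at its critical points that the singular operator vanishes there;
   this is why radial barriers are built from [|x - c|^(2 j)] with [j] large. *)
Require Import Defs.
From Stdlib Require Import Reals Lra Lia Psatz.
From Stdlib Require Import FunctionalExtensionality ClassicalEpsilon.
Open Scope R_scope.

(** * Finite sums and the Euclidean norm *)

(** A test function must touch [u] at times on both sides of the contact point, so a comparison on a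
    time interval also has to be closed at its final time, where nothing better than a crude bound
    on [u] is known. Every barrier therefore carries a corrector proportional to [exp (L t)]:
    negligible up to the time of interest, larger than the crude bound at the final time, and with a
    time derivative of the favourable sign. The exponents come from a balance. For a profile
    [Y^(-k)] with [Y] growing like [|x|], the gradient term scales like [Y^(-(k+1) q)], and
    [(k+1) q = k] exactly when [k = q / (1 - q)]. The diffusion then scales like [Y^(-k) Y^(-s)]
    with [s = (p - 2 q) / (1 - q)], and [s > 0] is the condition [q < p / 2]: diffusion is of lower
    order where [Y] is large, so large constants control it. Test functions live on the whole space,
    whereas the profiles are singular powers; hence these powers are extended smoothly past a
    threshold that no contact point crosses. *)

Lemma sumFin_ext n (f g : Fin.t n -> R) :
  (forall i, f i = g i) -> sumFin n f = sumFin n g.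
Proof. intros H; f_equal; extensionality i; apply H. Qed.

Lemma sumFin_plus n (f g : Fin.t n -> R) :
  sumFin n (fun i => f i + g i) = sumFin n f + sumFin n g.
Proof. induction n as [|n IH]; simpl; [lra|]. rewrite IH; lra. Qed.

Lemma sumFin_scal n c (f : Fin.t n -> R) :
  sumFin n (fun i => c * f i) = c * sumFin n f.
Proof. induction n as [|n IH]; simpl; [lra|]. rewrite IH; lra. Qed.

Lemma sumFin_const n c : sumFin n (fun _ => c) = INR n * c.
Proof. induction n as [|n IH]; [simpl; lra|]. rewrite S_INR; simpl; rewrite IH; lra. Qed.

Lemma sumFin_le n (f g : Fin.t n -> R) :
  (forall i, f i <= g i) -> sumFin n f <= sumFin n g.
Proof.
  induction n as [|n IH]; simpl; intros H; [lra|].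
  apply Rplus_le_compat; [apply H|apply IH; intros; apply H].
Qed.

Lemma sumFin_nonneg n (f : Fin.t n -> R) : (forall i, 0 <= f i) -> 0 <= sumFin n f.
Proof.
  intros H. replace 0 with (sumFin n (fun _ => 0)) by (rewrite sumFin_const; ring).
  now apply sumFin_le.
Qed.

Lemma sumFin_delta n (i : Fin.t n) (c : Fin.t n -> R) :
  sumFin n (fun j => if Fin.eq_dec j i then c j else 0) = c i.
Proof.
  induction i as [n|n i IH]; cbn [sumFin].
  - rewrite (sumFin_ext n _ (fun _ => 0)); [rewrite sumFin_const; destruct (Fin.eq_dec Fin.F1 Fin.F1); [ring|congruence]|].
    intros j. destruct (Fin.eq_dec (Fin.FS j) Fin.F1) as [e|]; [discriminate e|reflexivity].
  - destruct (Fin.eq_dec Fin.F1 (Fin.FS i)) as [e|]; [discriminate e|].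
    rewrite Rplus_0_l, <- (IH (fun j => c (Fin.FS j))).
    apply sumFin_ext; intros j.
    destruct (Fin.eq_dec (Fin.FS j) (Fin.FS i)) as [e|ne];
      destruct (Fin.eq_dec j i) as [e'|ne']; try reflexivity.
    + apply Fin.FS_inj in e; contradiction.
    + subst; contradiction.
Qed.

Lemma sumFin_term_le n (f : Fin.t n -> R) i : (forall j, 0 <= f j) -> f i <= sumFin n f.
Proof.
  intros H. rewrite <- (sumFin_delta n i f). apply sumFin_le; intros j.
  destruct (Fin.eq_dec j i); [lra|apply H].
Qed.

(** Unlike [normN], the squared distance is smooth at [c]; barriers are built from its powers. *)
Definition sqd {N} (c x : RN N) : R := sumFin N (fun i => (x i - c i) ^ 2).

Lemma sqd_nonneg N (c x : RN N) : 0 <= sqd c x.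
Proof. apply sumFin_nonneg; intros; apply pow2_ge_0. Qed.

Lemma normN_nonneg N (x : RN N) : 0 <= normN x.
Proof. apply sqrt_pos. Qed.

Lemma normN_sqr N (x : RN N) : normN x ^ 2 = sumFin N (fun i => x i ^ 2).
Proof. unfold normN; rewrite pow2_sqrt; auto. apply sumFin_nonneg; intros; apply pow2_ge_0. Qed.

Lemma normN_sqd N (c x : RN N) : normN (vminus x c) ^ 2 = sqd c x.
Proof. apply normN_sqr. Qed.

Lemma normN_pow_even N (c x : RN N) j : normN (vminus x c) ^ (2 * j) = sqd c x ^ j.
Proof. now rewrite pow_mult, normN_sqd. Qed.

Lemma normN_coord N (x : RN N) i : Rabs (x i) <= normN x.
Proof.
  unfold normN. rewrite <- sqrt_Rsqr_abs. apply sqrt_le_1_alt. rewrite Rsqr_pow2.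
  apply (sumFin_term_le N (fun i => x i ^ 2)); intros; apply pow2_ge_0.
Qed.

Lemma normN_le_sum N (x : RN N) e :
  0 <= e -> (forall i, Rabs (x i) <= e) -> normN x <= INR N * e.
Proof.
  intros He H. apply Rsqr_incr_0_var; [|apply Rmult_le_pos; auto using pos_INR].
  rewrite !Rsqr_pow2, normN_sqr.
  apply Rle_trans with (sumFin N (fun _ => e ^ 2)).
  - apply sumFin_le; intros i. rewrite <- (pow2_abs (x i)). apply pow_incr. split; auto using Rabs_pos.
  - rewrite sumFin_const, Rpow_mult_distr. apply Rmult_le_compat_r; [apply pow2_ge_0|].
    destruct N as [|N]; [simpl; lra|]. pose proof (pos_INR N). rewrite S_INR; nra.
Qed.

Lemma normN_eq0 N (x : RN N) i : normN x = 0 -> x i = 0.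
Proof.
  intros H. pose proof (normN_coord N x i) as H1. rewrite H in H1.
  pose proof (Rabs_pos (x i)). destruct (Req_dec (x i) 0) as [|n]; auto.
  apply Rabs_pos_lt in n; lra.
Qed.

Lemma normN_zero N (x : RN N) : (forall i, x i = 0) -> normN x = 0.
Proof.
  intros H. unfold normN. rewrite (sumFin_ext _ _ (fun _ => 0)).
  - rewrite sumFin_const, Rmult_0_r; apply sqrt_0.
  - intros i; rewrite H; ring.
Qed.

Lemma normN_scal N c (x : RN N) : normN (fun i => c * x i) = Rabs c * normN x.
Proof.
  unfold normN. rewrite (sumFin_ext _ _ (fun i => c ^ 2 * x i ^ 2)) by (intros; ring).
  rewrite sumFin_scal, sqrt_mult_alt by apply pow2_ge_0.
  now rewrite <- Rsqr_pow2, sqrt_Rsqr_abs.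
Qed.

(** Expanding [|Y x - X y|^2 >= 0] with [X = |x|], [Y = |y|] gives [2 X Y (X Y - x.y) >= 0]; the
    case [X Y = 0] is separate. *)
Lemma cauchy_schwarz N (x y : RN N) : sumFin N (fun i => x i * y i) <= normN x * normN y.
Proof.
  set (X := normN x). set (Y := normN y).
  assert (H : 0 <= sumFin N (fun i => (Y * x i - X * y i) ^ 2))
    by (apply sumFin_nonneg; intros; apply pow2_ge_0).
  rewrite (sumFin_ext _ _ (fun i => Y ^ 2 * x i ^ 2 + (X ^ 2 * y i ^ 2 + (- 2 * X * Y) * (x i * y i)))) in H
    by (intros; ring).
  rewrite !sumFin_plus, !sumFin_scal, <- !normN_sqr in H. fold X Y in H.
  pose proof (normN_nonneg N x) as HX. pose proof (normN_nonneg N y) as HY. fold X in HX. fold Y in HY.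
  destruct (Req_dec X 0) as [e|n].
  - rewrite (sumFin_ext _ _ (fun _ => 0)); [rewrite sumFin_const, e; lra|].
    intros i; rewrite (normN_eq0 N x i e); ring.
  - destruct (Req_dec Y 0) as [e|n'].
    + rewrite (sumFin_ext _ _ (fun _ => 0)); [rewrite sumFin_const, e; lra|].
      intros i; rewrite (normN_eq0 N y i e); ring.
    + assert (0 < X * Y) by (apply Rmult_lt_0_compat; lra). nra.
Qed.

Lemma normN_plus N (x y : RN N) : normN (fun i => x i + y i) <= normN x + normN y.
Proof.
  apply Rsqr_incr_0_var; [|pose proof (normN_nonneg N x); pose proof (normN_nonneg N y); lra].
  rewrite !Rsqr_pow2, normN_sqr.
  rewrite (sumFin_ext _ _ (fun i => x i ^ 2 + (y i ^ 2 + 2 * (x i * y i)))) by (intros; ring).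
  rewrite !sumFin_plus, sumFin_scal, <- !normN_sqr.
  pose proof (cauchy_schwarz N x y). nra.
Qed.

Lemma normN_triangle N (x y z : RN N) :
  normN (vminus x z) <= normN (vminus x y) + normN (vminus y z).
Proof.
  replace (vminus x z) with (fun i => vminus x y i + vminus y z i); [apply normN_plus|].
  extensionality i; unfold vminus; ring.
Qed.

Lemma normN_sym N (x y : RN N) : normN (vminus x y) = normN (vminus y x).
Proof. unfold normN, vminus. f_equal. apply sumFin_ext; intros; ring. Qed.

Lemma normN_refl N (x : RN N) : normN (vminus x x) = 0.
Proof. apply normN_zero; intros; unfold vminus; ring. Qed.

Lemma normN_vminus0 N (x : RN N) : normN (vminus x (fun _ => 0)) = normN x.
Proof. f_equal; extensionality i; unfold vminus; ring. Qed.

Lemma normN_lip N (x y c : RN N) :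
  Rabs (normN (vminus x c) - normN (vminus y c)) <= normN (vminus x y).
Proof.
  pose proof (normN_triangle N x y c). pose proof (normN_triangle N y x c).
  rewrite (normN_sym N y x) in *. apply Rabs_le; lra.
Qed.

(** Supplies the direction opposite to which the centre of a shifted test function is placed. At the
    origin any unit vector will do, which requires positive dimension. *)
Lemma polar_decomposition N (x : RN (S N)) :
  exists v : RN (S N), normN v = 1 /\ forall i, x i = normN x * v i.
Proof.
  destruct (Req_dec (normN x) 0) as [e|n].
  - exists (fun j => if Fin.eq_dec j Fin.F1 then 1 else 0). split.
    + unfold normN. rewrite (sumFin_ext _ _ (fun j => if Fin.eq_dec j Fin.F1 then 1 else 0)).
      * rewrite (sumFin_delta _ Fin.F1 (fun _ => 1)). apply sqrt_1.
      * intros j. destruct (Fin.eq_dec j Fin.F1); ring.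
    + intros i. rewrite (normN_eq0 _ _ i e), e; ring.
  - exists (fun i => / normN x * x i). split.
    + rewrite normN_scal, Rabs_pos_eq; [now field|].
      pose proof (normN_nonneg _ x). left; apply Rinv_0_lt_compat; lra.
    + intros i; now field.
Qed.

Lemma upd_same N (x : RN N) i : upd x i (x i) = x.
Proof. extensionality j. unfold upd. destruct (Fin.eq_dec j i); congruence. Qed.

Lemma upd_eq N (x : RN N) i h : upd x i h i = h.
Proof. unfold upd. destruct (Fin.eq_dec i i); congruence. Qed.

Lemma normN_upd N (x : RN N) i h : normN (vminus (upd x i h) x) = Rabs (h - x i).
Proof.
  unfold normN, vminus, upd.
  rewrite (sumFin_ext _ _ (fun j => if Fin.eq_dec j i then (h - x j) ^ 2 else 0)).
  - rewrite sumFin_delta, <- Rsqr_pow2. apply sqrt_Rsqr_abs.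
  - intros j. destruct (Fin.eq_dec j i); ring.
Qed.

(** * Derivatives and continuity *)

Lemma dl_eq f x l l' : derivable_pt_lim f x l -> l = l' -> derivable_pt_lim f x l'.
Proof. now intros H <-. Qed.

Lemma dl_plus f g x a b : derivable_pt_lim f x a -> derivable_pt_lim g x b ->
  derivable_pt_lim (fun y => f y + g y) x (a + b).
Proof. apply derivable_pt_lim_plus. Qed.

Lemma dl_minus f g x a b : derivable_pt_lim f x a -> derivable_pt_lim g x b ->
  derivable_pt_lim (fun y => f y - g y) x (a - b).
Proof. apply derivable_pt_lim_minus. Qed.

Lemma dl_mult f g x a b : derivable_pt_lim f x a -> derivable_pt_lim g x b ->
  derivable_pt_lim (fun y => f y * g y) x (a * g x + f x * b).
Proof. apply derivable_pt_lim_mult. Qed.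

Lemma dl_comp f g x a b : derivable_pt_lim f x a -> derivable_pt_lim g (f x) b ->
  derivable_pt_lim (fun y => g (f y)) x (b * a).
Proof. apply derivable_pt_lim_comp. Qed.

Lemma dl_const c x : derivable_pt_lim (fun _ => c) x 0.
Proof. apply derivable_pt_lim_const. Qed.

Lemma dl_id x : derivable_pt_lim (fun y => y) x 1.
Proof. apply derivable_pt_lim_id. Qed.

Lemma dl_scal c f x a : derivable_pt_lim f x a -> derivable_pt_lim (fun y => c * f y) x (c * a).
Proof. apply derivable_pt_lim_scal. Qed.

Lemma dl_pow n x : derivable_pt_lim (fun y => y ^ n) x (INR n * x ^ pred n).
Proof. apply derivable_pt_lim_pow. Qed.

Lemma dl_local f g x l d : 0 < d -> (forall y, Rabs (y - x) < d -> f y = g y) ->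
  derivable_pt_lim f x l -> derivable_pt_lim g x l.
Proof.
  intros Hd H. apply derivable_pt_lim_locally_ext with (x - d) (x + d); [lra|].
  intros z Hz; apply H. apply Rabs_def1; lra.
Qed.

Lemma dl_continuity f x l : derivable_pt_lim f x l -> continuity_pt f x.
Proof. intros H. apply derivable_continuous_pt. now exists l. Qed.

Lemma dl_sumFin n (F : Fin.t n -> R -> R) (d : Fin.t n -> R) x :
  (forall i, derivable_pt_lim (F i) x (d i)) ->
  derivable_pt_lim (fun h => sumFin n (fun i => F i h)) x (sumFin n d).
Proof.
  induction n as [|n IH]; simpl; intros H; [apply dl_const|].
  apply dl_plus; [apply H|]. apply (IH (fun i => F (Fin.FS i)) (fun i => d (Fin.FS i))).
  intros; apply H.
Qed.

Lemma dl_sqd N (c x : RN N) i :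
  derivable_pt_lim (fun h => sqd c (upd x i h)) (x i) (2 * (x i - c i)).
Proof.
  unfold sqd. eapply dl_eq.
  - apply (dl_sumFin N (fun j h => (upd x i h j - c j) ^ 2)
      (fun j => if Fin.eq_dec j i then 2 * (x j - c j) else 0)).
    intros j. unfold upd. destruct (Fin.eq_dec j i) as [->|ne]; [|apply dl_const].
    eapply dl_eq.
    + apply (dl_comp (fun h => h - c i) (fun y => y ^ 2)).
      * apply (dl_minus (fun h => h) (fun _ => c i)); [apply dl_id|apply dl_const].
      * apply dl_pow.
    + simpl; ring.
  - apply sumFin_delta.
Qed.

(** The predicate [P] selects the admissible times: [0 < s] for the regularity of test functions,
    [0 <= s] for comparison on cylinders starting at time 0. *)
Definition contAt {N} (P : R -> Prop) (F : R -> RN N -> R) (t : R) (x : RN N) : Prop :=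
  forall eps, 0 < eps -> exists delta, 0 < delta /\
    forall s y, P s -> Rabs (s - t) < delta -> normN (vminus y x) < delta ->
      Rabs (F s y - F t x) < eps.

Lemma contAt_const N P c t (x : RN N) : contAt P (fun _ _ => c) t x.
Proof.
  intros e He; exists 1; split; [lra|]. intros; rewrite Rminus_diag, Rabs_R0; lra.
Qed.

Lemma continuity_pt_eps f x : continuity_pt f x -> forall eps, 0 < eps ->
  exists d, 0 < d /\ forall y, Rabs (y - x) < d -> Rabs (f y - f x) < eps.
Proof.
  intros H eps He. destruct (H eps He) as [d [Hd H']]. exists d; split; [exact Hd|].
  intros y Hy. destruct (Req_dec x y) as [->|ne]; [rewrite Rminus_diag, Rabs_R0; lra|].
  apply H'. split; [split; [exact I|exact ne]|exact Hy].
Qed.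

Lemma contAt_comp N P g F t (x : RN N) :
  contAt P F t x -> continuity_pt g (F t x) -> contAt P (fun s y => g (F s y)) t x.
Proof.
  intros HF Hg e He. destruct (continuity_pt_eps _ _ Hg e He) as [d [Hd H]].
  destruct (HF d Hd) as [d' [Hd' H']]. exists d'; split; auto.
Qed.

Lemma contAt_time N P t (x : RN N) : contAt P (fun s _ => s) t x.
Proof. intros e He; exists e; split; auto. Qed.

Lemma contAt_plus N P F G t (x : RN N) :
  contAt P F t x -> contAt P G t x -> contAt P (fun s y => F s y + G s y) t x.
Proof.
  intros HF HG e He.
  destruct (HF (e / 2)) as [d [Hd H]]; [lra|]. destruct (HG (e / 2)) as [d' [Hd' H']]; [lra|].
  exists (Rmin d d'); split; [now apply Rmin_glb_lt|]. intros s y Ps Hs Hy.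
  pose proof (Rmin_l d d'). pose proof (Rmin_r d d').
  specialize (H s y Ps ltac:(lra) ltac:(lra)). specialize (H' s y Ps ltac:(lra) ltac:(lra)).
  replace (F s y + G s y - (F t x + G t x)) with ((F s y - F t x) + (G s y - G t x)) by ring.
  eapply Rle_lt_trans; [apply Rabs_triang|lra].
Qed.

Lemma contAt_ext N P F G t (x : RN N) :
  (forall s y, F s y = G s y) -> contAt P F t x -> contAt P G t x.
Proof.
  intros H HF e He. destruct (HF e He) as [d [Hd H']]. exists d; split; auto.
  intros s y. rewrite <- !H. apply H'.
Qed.

(** Polarization, [4 F G = (F + G)^2 - (F - G)^2], reduces products to sums and to composition with
    a square. *)
Lemma contAt_mult N P F G t (x : RN N) :
  contAt P F t x -> contAt P G t x -> contAt P (fun s y => F s y * G s y) t x.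
Proof.
  intros HF HG.
  apply contAt_ext with (fun s y => / 4 * (F s y + G s y) ^ 2 + - / 4 * (F s y + - 1 * G s y) ^ 2).
  { intros; field. }
  assert (Hc : forall c y, continuity_pt (fun z => c * z ^ 2) y).
  { intros c y. eapply dl_continuity. apply dl_scal, dl_pow. }
  assert (Hc' : forall c y, continuity_pt (fun z => c * z) y).
  { intros c y. eapply dl_continuity. apply dl_scal, dl_id. }
  apply contAt_plus.
  - apply (contAt_comp N P (fun z => / 4 * z ^ 2)); [now apply contAt_plus|apply Hc].
  - apply (contAt_comp N P (fun z => - / 4 * z ^ 2)); [|apply Hc].
    apply contAt_plus; [assumption|]. now apply (contAt_comp N P (fun z => - 1 * z)).
Qed.

Lemma contAt_coord N P i t (x : RN N) : contAt P (fun _ y => y i) t x.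
Proof.
  intros e He; exists e; split; auto. intros s y _ _ H.
  eapply Rle_lt_trans; [|exact H]. apply (normN_coord N (vminus y x) i).
Qed.

Lemma contAt_norm N P c t (x : RN N) : contAt P (fun _ y => normN (vminus y c)) t x.
Proof.
  intros e He; exists e; split; auto. intros s y _ _ H.
  eapply Rle_lt_trans; [|exact H]. apply normN_lip.
Qed.

Lemma contAt_sqd N P c t (x : RN N) : contAt P (fun _ y => sqd c y) t x.
Proof.
  apply contAt_ext with (fun _ y => normN (vminus y c) ^ 2); [intros; apply normN_sqd|].
  apply (contAt_comp N P (fun z => z ^ 2)); [apply contAt_norm|].
  eapply dl_continuity, dl_pow.
Qed.

(** * Functions of class C^1 and C^2 in time and space *)

Definition cpos {N} := @contAt N (fun s => 0 < s).

Definition C1 {N} (F : R -> RN N -> R) : Prop :=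
  exists Ft Fx, forall t x, 0 < t ->
    dt_at F t x (Ft t x) /\ (forall i, dx_at i F t x (Fx i t x)) /\
    cpos F t x /\ cpos Ft t x /\ (forall i, cpos (Fx i) t x).

(** Second derivatives stay hidden in [C1] of the first ones, so that stability under sums, products
    and compositions reduces to the [C1] case. *)
Definition C2 {N} (F : R -> RN N -> R) : Prop :=
  exists Ft Fx, (forall t x, 0 < t ->
    dt_at F t x (Ft t x) /\ (forall i, dx_at i F t x (Fx i t x)) /\ cpos F t x) /\
    C1 Ft /\ (forall i, C1 (Fx i)).

Definition C1R (g : R -> R) : Prop :=
  exists g1, (forall y, derivable_pt_lim g y (g1 y)) /\ forall y, continuity_pt g1 y.

Definition C2R (g : R -> R) : Prop :=
  exists g1, (forall y, derivable_pt_lim g y (g1 y)) /\ C1R g1.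

Lemma C1_cont N (F : R -> RN N -> R) t x : C1 F -> 0 < t -> cpos F t x.
Proof. intros (? & ? & H) Ht. now destruct (H t x Ht) as (_ & _ & ? & _). Qed.

Lemma C2_C1 N (F : R -> RN N -> R) : C2 F -> C1 F.
Proof.
  intros (Ft & Fx & H & H1 & H2). exists Ft, Fx; intros t x Ht.
  destruct (H t x Ht) as (a & b & c). split; [exact a|]. split; [exact b|]. split; [exact c|].
  split; [|intros i]; auto using C1_cont.
Qed.

Lemma C2_is_C2 N (F : R -> RN N -> R) : C2 F -> exists Dt Dx, is_C2 F Dt Dx.
Proof.
  intros (Ft & Fx & H & (Ftt & Ftx & H1) & H2). exists Ft, Fx.
  (* The derivatives of each [Fx i] are known to exist separately; choice gathers them into families
     indexed by [i], as [is_C2] requires. *)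
  pose (c := fun i => constructive_indefinite_description _ (H2 i)).
  assert (H3 : exists Dxt Dxx, forall i t x, 0 < t ->
    dt_at (Fx i) t x (Dxt i t x) /\ (forall j, dx_at j (Fx i) t x (Dxx i j t x)) /\
    cpos (Fx i) t x /\ cpos (Dxt i) t x /\ (forall j, cpos (Dxx i j) t x)).
  { exists (fun i => proj1_sig (c i)).
    exists (fun i => proj1_sig (constructive_indefinite_description _ (proj2_sig (c i)))).
    intros i. exact (proj2_sig (constructive_indefinite_description _ (proj2_sig (c i)))). }
  destruct H3 as (Dxt & Dxx & H3).
  exists Ftt, Ftx, Dxt, Dxx. intros t x Ht.
  destruct (H t x Ht) as (a & b & d). destruct (H1 t x Ht) as (a1 & b1 & c1 & d1 & e1).
  split; [exact a|]. split; [exact b|]. split; [exact a1|]. split; [exact b1|].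
  split; [intros i; now apply H3|]. split; [intros i; now apply H3|].
  split; [exact d|]. split; [exact c1|]. split; [intros i; now apply H3|].
  split; [exact d1|]. split; [exact e1|]. split; intros i; now apply H3.
Qed.

Lemma dx_plus N i (F G : R -> RN N -> R) t x a b : dx_at i F t x a -> dx_at i G t x b ->
  dx_at i (fun s y => F s y + G s y) t x (a + b).
Proof. apply dl_plus. Qed.

Lemma dx_mult N i (F G : R -> RN N -> R) t x a b : dx_at i F t x a -> dx_at i G t x b ->
  dx_at i (fun s y => F s y * G s y) t x (a * G t x + F t x * b).
Proof.
  intros HF HG. eapply dl_eq; [exact (dl_mult _ _ _ _ _ HF HG)|]. cbv beta; now rewrite upd_same.
Qed.

Lemma dx_comp N i (F : R -> RN N -> R) g t x a b : dx_at i F t x a ->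
  derivable_pt_lim g (F t x) b -> dx_at i (fun s y => g (F s y)) t x (b * a).
Proof.
  intros HF Hg. apply (dl_comp (fun h => F t (upd x i h))); [exact HF|]. cbv beta; now rewrite upd_same.
Qed.

Lemma C1_plus N (F G : R -> RN N -> R) : C1 F -> C1 G -> C1 (fun t x => F t x + G t x).
Proof.
  intros (Ft & Fx & HF) (Gt & Gx & HG).
  exists (fun t x => Ft t x + Gt t x), (fun i t x => Fx i t x + Gx i t x). intros t x Ht.
  destruct (HF t x Ht) as (a & b & c & d & e). destruct (HG t x Ht) as (a' & b' & c' & d' & e').
  split; [exact (dl_plus _ _ _ _ _ a a')|]. split; [intros i; now apply dx_plus|].
  split; [now apply contAt_plus|]. split; [now apply contAt_plus|].
  intros i; apply contAt_plus; [apply e|apply e'].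
Qed.

Lemma C1_mult N (F G : R -> RN N -> R) : C1 F -> C1 G -> C1 (fun t x => F t x * G t x).
Proof.
  intros (Ft & Fx & HF) (Gt & Gx & HG).
  exists (fun t x => Ft t x * G t x + F t x * Gt t x),
    (fun i t x => Fx i t x * G t x + F t x * Gx i t x). intros t x Ht.
  destruct (HF t x Ht) as (a & b & c & d & e). destruct (HG t x Ht) as (a' & b' & c' & d' & e').
  split; [exact (dl_mult _ _ _ _ _ a a')|]. split; [intros i; now apply dx_mult|].
  split; [now apply contAt_mult|]. split; [now apply contAt_plus; apply contAt_mult|].
  intros i. apply contAt_plus; apply contAt_mult; auto; [apply e|apply e'].
Qed.

Lemma C1_comp N (F : R -> RN N -> R) g : C1 F -> C1R g -> C1 (fun t x => g (F t x)).
Proof.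
  intros (Ft & Fx & HF) (g1 & Hg & Hg1).
  exists (fun t x => g1 (F t x) * Ft t x), (fun i t x => g1 (F t x) * Fx i t x). intros t x Ht.
  destruct (HF t x Ht) as (a & b & c & d & e).
  split; [apply (dl_comp (fun s => F s x) g _ _ _ a (Hg _))|].
  split; [intros i; now apply dx_comp|].
  split; [apply contAt_comp; auto; eapply dl_continuity, Hg|].
  split; [|intros i]; apply contAt_mult; auto; try apply e; apply contAt_comp; auto.
Qed.

Lemma C1_const N c : C1 (fun (_ : R) (_ : RN N) => c).
Proof.
  exists (fun _ _ => 0), (fun _ _ _ => 0). intros t x Ht.
  split; [exact (dl_const _ _)|]. split; [intros; exact (dl_const _ _)|].
  split; [apply contAt_const|]. split; intros; apply contAt_const.
Qed.

Lemma C2_time N : C2 (fun t (_ : RN N) => t).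
Proof.
  exists (fun _ _ => 1), (fun _ _ _ => 0). split; [|split; intros; apply C1_const].
  intros t x Ht. split; [exact (dl_id _)|]. split; [intros; exact (dl_const _ _)|apply contAt_time].
Qed.

Lemma C2_plus N (F G : R -> RN N -> R) : C2 F -> C2 G -> C2 (fun t x => F t x + G t x).
Proof.
  intros (Ft & Fx & HF & HFt & HFx) (Gt & Gx & HG & HGt & HGx).
  exists (fun t x => Ft t x + Gt t x), (fun i t x => Fx i t x + Gx i t x).
  split; [|split; [now apply C1_plus|intros i; apply C1_plus; [apply HFx|apply HGx]]].
  intros t x Ht.
  destruct (HF t x Ht) as (a & b & c). destruct (HG t x Ht) as (a' & b' & c').
  split; [exact (dl_plus _ _ _ _ _ a a')|]. split; [intros i; now apply dx_plus|].
  now apply contAt_plus.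
Qed.

Lemma C2_mult N (F G : R -> RN N -> R) : C2 F -> C2 G -> C2 (fun t x => F t x * G t x).
Proof.
  intros CF CG. pose proof (C2_C1 _ _ CF). pose proof (C2_C1 _ _ CG).
  destruct CF as (Ft & Fx & HF & HFt & HFx), CG as (Gt & Gx & HG & HGt & HGx).
  exists (fun t x => Ft t x * G t x + F t x * Gt t x),
    (fun i t x => Fx i t x * G t x + F t x * Gx i t x).
  split; [|split; [|intros i]; apply C1_plus; apply C1_mult; auto].
  intros t x Ht.
  destruct (HF t x Ht) as (a & b & c). destruct (HG t x Ht) as (a' & b' & c').
  split; [exact (dl_mult _ _ _ _ _ a a')|]. split; [intros i; now apply dx_mult|].
  now apply contAt_mult.
Qed.

Lemma C2_comp N (F : R -> RN N -> R) g : C2 F -> C2R g -> C2 (fun t x => g (F t x)).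
Proof.
  intros CF (g1 & Hg & Hg1). pose proof (C2_C1 _ _ CF). destruct CF as (Ft & Fx & HF & HFt & HFx).
  exists (fun t x => g1 (F t x) * Ft t x), (fun i t x => g1 (F t x) * Fx i t x).
  split; [|split; [|intros i]; apply C1_mult; auto; try apply HFx; now apply C1_comp].
  intros t x Ht. destruct (HF t x Ht) as (a & b & c).
  split; [apply (dl_comp (fun s => F s x) g _ _ _ a (Hg _))|].
  split; [intros i; now apply dx_comp|].
  apply contAt_comp; auto; eapply dl_continuity, Hg.
Qed.

Lemma C2_sqd N c : C2 (fun _ (x : RN N) => sqd c x).
Proof.
  exists (fun _ _ => 0), (fun i _ x => 2 * (x i - c i)). split; [|split; [apply C1_const|]].
  - intros t x Ht. split; [exact (dl_const _ _)|]. split; [intros i; apply dl_sqd|apply contAt_sqd].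
  - intros i. exists (fun _ _ => 0), (fun j _ x => if Fin.eq_dec i j then 2 else 0).
    intros t x Ht. split; [exact (dl_const _ _)|]. split.
    { intros j. unfold dx_at, upd. destruct (Fin.eq_dec i j) as [->|]; [|apply dl_const].
      eapply dl_eq; [apply dl_scal, (dl_minus (fun h => h) (fun _ => c j)); [apply dl_id|apply dl_const]|ring]. }
    split; [|split; [apply contAt_const|intros j; apply contAt_const]].
    apply contAt_ext with (fun _ y => 2 * (y i + - c i)); [intros; ring|].
    apply contAt_mult; [apply contAt_const|]. apply contAt_plus; [apply contAt_coord|apply contAt_const].
Qed.

Lemma C2_of_time N g : C2R g -> C2 (fun t (_ : RN N) => g t).
Proof. intros H. apply (C2_comp N (fun t _ => t)); [apply C2_time|exact H]. Qed.

Lemma C2R_pow n : C2R (fun y => y ^ n).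
Proof.
  exists (fun y => INR n * y ^ pred n). split; [intros; apply dl_pow|].
  exists (fun y => INR n * (INR (pred n) * y ^ pred (pred n))).
  split; intros; [apply dl_scal, dl_pow|]. eapply dl_continuity. apply dl_scal, dl_scal, dl_pow.
Qed.

Lemma C2R_exp : C2R exp.
Proof.
  exists exp; split; [apply derivable_pt_lim_exp|]. exists exp; split; [apply derivable_pt_lim_exp|].
  intros y. eapply dl_continuity, derivable_pt_lim_exp.
Qed.

Lemma C2R_linear a b : C2R (fun y => a + b * y).
Proof.
  exists (fun _ => b). split.
  - intros y. eapply dl_eq; [apply (dl_plus (fun _ => a)); [apply dl_const|apply dl_scal, dl_id]|ring].
  - exists (fun _ => 0). split; [intros; apply dl_const|]. intros; eapply dl_continuity, dl_const.
Qed.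

Lemma dl_affine c a b k g g' t : derivable_pt_lim g (b + k * t) g' ->
  derivable_pt_lim (fun s => c + a * g (b + k * s)) t (a * (g' * k)).
Proof.
  intros H. eapply dl_eq.
  - apply (dl_plus (fun _ => c)); [apply dl_const|]. apply dl_scal.
    apply (dl_comp (fun s => b + k * s) g); [|exact H].
    apply (dl_plus (fun _ => b)); [apply dl_const|apply dl_scal, dl_id].
  - ring.
Qed.

(** Covers the exponential correctors, the powers of [T - t] and the shifted radial profile of the
    extinction barrier. Terms such as [0 +] or [1 *] in later definitions merely fit this shape or
    that of [C2R_linear]. *)
Lemma C2R_affine c a b k g : C2R g -> C2R (fun t => c + a * g (b + k * t)).
Proof.
  intros (g1 & H1 & g2 & H2 & Hc). exists (fun t => a * (g1 (b + k * t) * k)).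
  split; [intros; now apply dl_affine|].
  exists (fun t => a * k * (g2 (b + k * t) * k)). split.
  - intros y. apply dl_local with (f := fun t => 0 + a * k * g1 (b + k * t)) (d := 1); [lra|intros; ring|].
    now apply dl_affine.
  - intros y.
    assert (Hl : continuity_pt (fun s => b + k * s) y).
    { eapply dl_continuity. apply (dl_plus (fun _ => b)); [apply dl_const|apply dl_scal, dl_id]. }
    apply (continuity_pt_comp (fun s => b + k * s) (fun z => a * k * (g2 z * k))); [exact Hl|].
    apply (continuity_pt_mult (fun _ => a * k)); [eapply dl_continuity, dl_const|].
    apply (continuity_pt_mult g2 (fun _ => k)); [apply Hc|eapply dl_continuity, dl_const].
Qed.

(** * Powers extended to the whole line *)

(* [y ^ th] continued to the left of [a] by its second-order Taylor polynomial at [a]. *)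
Definition pw (th a y : R) : R :=
  let Y := Rmax a y in
  Rpower Y th + th * Rpower Y (th - 1) * (y - Y) + th * (th - 1) / 2 * Rpower Y (th - 2) * (y - Y) ^ 2.

Definition pw1 (th a y : R) : R :=
  let Y := Rmax a y in
  th * Rpower Y (th - 1) + th * (th - 1) * Rpower Y (th - 2) * (y - Y).

Definition pw2 (th a y : R) : R := th * (th - 1) * Rpower (Rmax a y) (th - 2).

Lemma dl_Rpower th y : 0 < y -> derivable_pt_lim (fun z => Rpower z th) y (th * Rpower y (th - 1)).
Proof. intros; now apply derivable_pt_lim_power. Qed.

Lemma dl_glue f g a l : f a = g a -> derivable_pt_lim f a l -> derivable_pt_lim g a l ->
  derivable_pt_lim (fun y => if Rle_dec a y then g y else f y) a l.
Proof.
  intros E Hf Hg eps He. destruct (Hf eps He) as [d Hd], (Hg eps He) as [d' Hd'].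
  assert (H0 : 0 < Rmin d d') by (apply Rmin_glb_lt; apply cond_pos).
  exists (mkposreal _ H0); simpl; intros h Hh Hh'.
  pose proof (Rmin_l d d'). pose proof (Rmin_r d d').
  destruct (Rle_dec a a) as [_|n]; [|lra]. destruct (Rle_dec a (a + h)).
  - apply Hd'; auto; lra.
  - rewrite <- E. apply Hd; auto; lra.
Qed.

Lemma pw_right th a y : a <= y -> pw th a y = Rpower y th.
Proof. intros H; unfold pw; rewrite Rmax_right by lra; field. Qed.

Lemma pw1_right th a y : a <= y -> pw1 th a y = th * Rpower y (th - 1).
Proof. intros H; unfold pw1; rewrite Rmax_right by lra; ring. Qed.

Lemma pw2_right th a y : a <= y -> pw2 th a y = th * (th - 1) * Rpower y (th - 2).
Proof. intros H; unfold pw2; now rewrite Rmax_right by lra. Qed.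

Lemma dl_piecewise F f g a y l :
  (forall z, a <= z -> F z = g z) -> (forall z, z <= a -> F z = f z) ->
  (a <= y -> derivable_pt_lim g y l) -> (y <= a -> derivable_pt_lim f y l) ->
  derivable_pt_lim F y l.
Proof.
  intros Hg Hf Dg Df. destruct (Rtotal_order a y) as [H|[ -> |H]].
  - apply (dl_local g F y l (y - a)); [lra| |apply Dg; lra].
    intros z Hz; symmetry; apply Hg. apply Rabs_def2 in Hz; lra.
  - apply (dl_local (fun z => if Rle_dec y z then g z else f z) F y l 1); [lra| |].
    + intros z _. destruct (Rle_dec y z); symmetry; [now apply Hg|apply Hf; lra].
    + apply dl_glue; [rewrite <- Hg, <- Hf; lra|apply Df; lra|apply Dg; lra].
  - apply (dl_local f F y l (a - y)); [lra| |apply Df; lra].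
    intros z Hz; symmetry; apply Hf. apply Rabs_def2 in Hz; lra.
Qed.

Lemma dl_pw th a y : 0 < a -> derivable_pt_lim (pw th a) y (pw1 th a y).
Proof.
  intros Ha.
  apply dl_piecewise with (a := a) (g := fun z => Rpower z th)
    (f := fun z => Rpower a th + (th * Rpower a (th - 1) * (z - a) + th * (th - 1) / 2 * Rpower a (th - 2) * (z - a) ^ 2)).
  - intros; now apply pw_right.
  - intros z Hz; unfold pw; rewrite Rmax_left by lra; ring.
  - intros H. rewrite pw1_right by lra. apply dl_Rpower; lra.
  - intros H. unfold pw1; rewrite Rmax_left by lra.
    assert (Hd : derivable_pt_lim (fun z => z - a) y 1).
    { eapply dl_eq; [apply (dl_minus (fun z => z) (fun _ => a)); [apply dl_id|apply dl_const]|ring]. }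
    eapply dl_eq.
    + apply (dl_plus (fun _ => Rpower a th)); [apply dl_const|].
      apply dl_plus; apply dl_scal; [exact Hd|].
      apply (dl_comp (fun z => z - a) (fun v => v ^ 2)); [exact Hd|apply dl_pow].
    + simpl; field.
Qed.

Lemma dl_pw1 th a y : 0 < a -> derivable_pt_lim (pw1 th a) y (pw2 th a y).
Proof.
  intros Ha.
  apply dl_piecewise with (a := a) (g := fun z => th * Rpower z (th - 1))
    (f := fun z => th * Rpower a (th - 1) + th * (th - 1) * Rpower a (th - 2) * (z - a)).
  - intros; now apply pw1_right.
  - intros z Hz; unfold pw1; rewrite Rmax_left by lra; ring.
  - intros H. rewrite pw2_right by lra. eapply dl_eq; [apply dl_scal, dl_Rpower; lra|].
    replace (th - 1 - 1) with (th - 2) by ring; ring.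
  - intros H. unfold pw2; rewrite Rmax_left by lra. eapply dl_eq.
    + apply (dl_plus (fun _ => th * Rpower a (th - 1))); [apply dl_const|].
      apply dl_scal, (dl_minus (fun z => z) (fun _ => a)); [apply dl_id|apply dl_const].
    + ring.
Qed.

Lemma C2R_pw th a : 0 < a -> C2R (pw th a).
Proof.
  intros Ha. exists (pw1 th a); split; [intros; now apply dl_pw|].
  exists (pw2 th a); split; [intros; now apply dl_pw1|].
  intros y e He.
  assert (Hc : continuity_pt (fun z => Rpower z (th - 2)) (Rmax a y)).
  { eapply dl_continuity, dl_Rpower. pose proof (Rmax_l a y); lra. }
  assert (H : continuity_pt (fun z => th * (th - 1) * Rpower z (th - 2)) (Rmax a y)).
  { apply (continuity_pt_mult (fun _ => th * (th - 1))); [eapply dl_continuity, dl_const|exact Hc]. }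
  destruct (continuity_pt_eps _ _ H e He) as [d [Hd H']].
  exists d; split; [exact Hd|]. intros z [_ Hz]. apply H'.
  (* [Rmax a] is 1-Lipschitz. *)
  eapply Rle_lt_trans; [|exact Hz]. simpl; unfold Rdist.
  unfold Rmax. destruct (Rle_dec a z), (Rle_dec a y); unfold Rabs; repeat destruct Rcase_abs; lra.
Qed.

Lemma Rpower_pos y a : 0 < Rpower y a.
Proof. apply exp_pos. Qed.

(** Left of [a] the quadratic continuation keeps decreasing, since [th (th - 1) > 0] and
    [y - Y <= 0]. A derivative that vanishes nowhere keeps barriers free of spurious critical
    points. *)
Lemma pw1_neg th a y : 0 < a -> th < 0 -> pw1 th a y < 0.
Proof.
  intros Ha Hth. unfold pw1. set (Y := Rmax a y).
  assert (y <= Y) by apply Rmax_r. pose proof (Rpower_pos Y (th - 1)). pose proof (Rpower_pos Y (th - 2)).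
  assert (0 < - th * Rpower Y (th - 1)) by (apply Rmult_lt_0_compat; lra).
  assert (0 <= - th * ((1 - th) * (Rpower Y (th - 2) * (Y - y)))).
  { repeat apply Rmult_le_pos; lra. }
  lra.
Qed.

(** Here [th (th - 1) < 0] and [y - Y <= 0], so the second term helps again. *)
Lemma pw1_pos th a y : 0 < a -> 0 < th < 1 -> 0 < pw1 th a y.
Proof.
  intros Ha Hth. unfold pw1. set (Y := Rmax a y).
  assert (y <= Y) by apply Rmax_r. pose proof (Rpower_pos Y (th - 1)). pose proof (Rpower_pos Y (th - 2)).
  assert (0 < th * Rpower Y (th - 1)) by (apply Rmult_lt_0_compat; lra).
  assert (0 <= th * ((1 - th) * (Rpower Y (th - 2) * (Y - y)))).
  { repeat apply Rmult_le_pos; lra. }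
  lra.
Qed.

Lemma pw_decr th a y z : 0 < a -> th < 0 -> y <= z -> pw th a z <= pw th a y.
Proof.
  intros Ha Hth [H| ->]; [|lra].
  destruct (MVT_cor2 (pw th a) (pw1 th a) y z H) as (c & E & _); [intros; now apply dl_pw|].
  pose proof (pw1_neg th a c Ha Hth). nra.
Qed.

Lemma pw_pos th a y : 0 < a -> th < 0 -> 0 < pw th a y.
Proof.
  intros Ha Hth. eapply Rlt_le_trans; [|apply (pw_decr th a y (Rmax a y)); auto using Rmax_r].
  rewrite pw_right by apply Rmax_l. apply Rpower_pos.
Qed.

Lemma Rpower_small s eps : 0 < s -> 0 < eps ->
  exists d, 0 < d /\ forall r, 0 < r < d -> Rpower r s < eps.
Proof.
  intros Hs He. exists (Rpower eps (/ s)). split; [apply Rpower_pos|]. intros r [Hr H].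
  replace eps with (Rpower (Rpower eps (/ s)) s)
    by (rewrite Rpower_mult, Rinv_l, Rpower_1; lra).
  now apply Rlt_Rpower_l.
Qed.

(** * Admissible barriers *)

Lemma in_Fp_pow p j C : 1 < p < 2 -> 1 < (2 * INR j - 1) * (p - 1) -> 0 < C ->
  in_Fp p (fun r => C * r ^ (2 * j)).
Proof.
  intros Hp Hj HC.
  assert (Hj2 : (2 <= j)%nat).
  { destruct j as [|[|j]]; [simpl in Hj; lra|simpl in Hj; lra|lia]. }
  destruct j as [|[|j]]; [lia|lia|]. set (m := (2 * j)%nat).
  replace (2 * S (S j))%nat with (S (S (S (S m)))) by (unfold m; lia).
  replace (INR (S (S j))) with (INR m / 2 + 2) in Hj
    by (unfold m; rewrite mult_INR, !S_INR; simpl; lra).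
  pose proof (pos_INR m) as Hm.
  set (n := INR m + 4).
  exists (fun r => C * (n * r ^ S (S (S m)))), (fun r => C * (n * ((n - 1) * r ^ S (S m)))).
  assert (D1 : forall r, derivable_pt_lim (fun r => C * r ^ S (S (S (S m)))) r (C * (n * r ^ S (S (S m))))).
  { intros r. apply dl_scal. eapply dl_eq; [apply dl_pow|]. unfold n; rewrite !S_INR; simpl pred. ring. }
  assert (D2 : forall r, derivable_pt_lim (fun r => C * (n * r ^ S (S (S m)))) r (C * (n * ((n - 1) * r ^ S (S m))))).
  { intros r. apply dl_scal, dl_scal. eapply dl_eq; [apply dl_pow|]. unfold n; rewrite !S_INR; simpl pred. ring. }
  assert (D0 : forall f l, derivable_pt_lim f 0 l -> rderiv0 f l).
  { intros f l H eps He. destruct (H eps He) as [d Hd]. exists d; split; [apply cond_pos|].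
    intros h Hh. specialize (Hd h ltac:(lra)). rewrite Rplus_0_l in Hd. apply Hd.
    rewrite Rabs_pos_eq; lra. }
  split; [intros; apply D1|]. split; [intros; apply D2|].
  split; [apply D0, D1|]. split; [apply D0, D2|]. split.
  { intros r _ eps He.
    assert (Hc : continuity_pt (fun r => C * (n * ((n - 1) * r ^ S (S m)))) r)
      by (eapply dl_continuity; apply dl_scal, dl_scal, dl_scal, dl_pow).
    destruct (continuity_pt_eps _ _ Hc eps He) as [d [Hd H]]. exists d; split; auto. }
  split; [simpl; ring|]. split; [simpl; ring|]. split; [simpl; ring|]. split.
  { intros r Hr. repeat apply Rmult_lt_0_compat; try apply pow_lt; unfold n; lra. }
  intros eps He.
  (* With [n = 2 j], the quantity [|xi'|^(p-2) xi''] has order [(n - 1)(p - 2) + (n - 2) = (n - 1)(p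
     - 1) - 1] in [r]; the flatness condition [Hj] says that this is positive. *)
  set (s := (n - 1) * (p - 1) - 1). set (K := Rpower (C * n) (p - 2) * (C * n * (n - 1))).
  assert (HK : 0 < K).
  { unfold K. repeat apply Rmult_lt_0_compat; try apply Rpower_pos; unfold n; lra. }
  destruct (Rpower_small s (eps / K)) as [d [Hd H]].
  { unfold s, n; lra. }
  { now apply Rdiv_lt_0_compat. }
  exists d; split; [exact Hd|]. intros r Hr.
  assert (Hn : 0 < C * n) by (apply Rmult_lt_0_compat; unfold n; lra).
  assert (E : Rpower (Rabs (C * (n * r ^ S (S (S m))))) (p - 2) * (C * (n * ((n - 1) * r ^ S (S m))))
     = K * Rpower r s).
  { rewrite Rabs_pos_eq by (rewrite <- Rmult_assoc; apply Rmult_le_pos; [lra|apply pow_le; lra]).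
    rewrite <- (Rmult_assoc C n (r ^ _)), <- Rpower_mult_distr by (auto; apply pow_lt; lra).
    rewrite <- !Rpower_pow by lra. rewrite Rpower_mult. unfold K.
    replace (Rpower r s) with (Rpower r (INR (S (S (S m))) * (p - 2)) * Rpower r (INR (S (S m)))).
    { ring. }
    rewrite <- Rpower_plus. f_equal. unfold s, n. rewrite !S_INR. ring. }
  rewrite E, Rabs_pos_eq by (apply Rmult_le_pos; [lra|left; apply Rpower_pos]).
  specialize (H r Hr). apply Rmult_lt_compat_l with (r := K) in H; [|exact HK].
  replace (K * (eps / K)) with eps in H by (field; lra). exact H.
Qed.

Lemma omega_ok_sqr K : 0 <= K -> omega_ok (fun s => K * s ^ 2).
Proof.
  intros HK. split; [|split].
  - intros t _ eps He.
    assert (Hc : continuity_pt (fun r => K * r ^ 2) t)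
      by (eapply dl_continuity; apply dl_scal, dl_pow).
    destruct (continuity_pt_eps _ _ Hc eps He) as [d [Hd H]]. exists d; split; auto.
  - intros t Ht. apply Rmult_le_pos; [lra|apply pow2_ge_0].
  - intros eps He. exists (eps / (K + 1)). split; [apply Rdiv_lt_0_compat; lra|].
    intros t [Ht H]. replace (K * t ^ 2 / t) with (K * t) by (field; lra).
    rewrite Rabs_pos_eq by (apply Rmult_le_pos; lra).
    apply Rmult_lt_compat_l with (r := K + 1) in H; [|lra].
    replace ((K + 1) * (eps / (K + 1))) with eps in H by (field; lra). lra.
Qed.

Lemma dl_linear_bound f x l : derivable_pt_lim f x l ->
  exists d, 0 < d /\ forall y, Rabs (y - x) < d -> Rabs (f y - f x) <= (Rabs l + 1) * Rabs (y - x).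
Proof.
  intros H. destruct (H 1 Rlt_0_1) as [d Hd]. exists d; split; [apply cond_pos|].
  intros y Hy. destruct (Req_dec y x) as [->|n].
  { rewrite !Rminus_diag, Rabs_R0; lra. }
  specialize (Hd (y - x) ltac:(lra) Hy). replace (x + (y - x)) with y in Hd by ring.
  replace (f y - f x) with ((f y - f x) / (y - x) * (y - x)) by (field; lra).
  rewrite Rabs_mult. apply Rmult_le_compat_r; [apply Rabs_pos|].
  replace ((f y - f x) / (y - x)) with (l + ((f y - f x) / (y - x) - l)) by ring.
  eapply Rle_trans; [apply Rabs_triang|lra].
Qed.

Lemma mvt_two_sided f f' a b : (forall c, Rmin a b <= c <= Rmax a b -> derivable_pt_lim f c (f' c)) ->
  exists c, Rmin a b <= c <= Rmax a b /\ f b - f a = f' c * (b - a).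
Proof.
  intros H. destruct (Rtotal_order a b) as [h|[->|h]].
  - rewrite Rmin_left, Rmax_right in * by lra.
    destruct (MVT_cor2 f f' a b h H) as (c & E & Hc). exists c; split; [lra|exact E].
  - exists b. rewrite Rmin_left, Rmax_left by lra. split; lra.
  - rewrite Rmin_right, Rmax_left in * by lra.
    destruct (MVT_cor2 f f' b a h H) as (c & E & Hc). exists c; split; lra.
Qed.

Lemma between_close a b c x d : Rmin a b <= c <= Rmax a b ->
  Rabs (a - x) < d -> Rabs (b - x) < d -> Rabs (c - x) < d.
Proof.
  intros H Ha Hb. apply Rabs_def2 in Ha, Hb. apply Rabs_def1.
  - apply Rle_lt_trans with (Rmax a b - x); [lra|]. unfold Rmax; destruct Rle_dec; lra.
  - apply Rlt_le_trans with (Rmin a b - x); [|lra]. unfold Rmin; destruct Rle_dec; lra.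
Qed.

Lemma locally_lipschitz f f' x : (forall y, derivable_pt_lim f y (f' y)) -> continuity_pt f' x ->
  exists K d, 0 <= K /\ 0 < d /\ forall y z, Rabs (y - x) < d -> Rabs (z - x) < d ->
    Rabs (f y - f z) <= K * Rabs (y - z).
Proof.
  intros D Hc. destruct (continuity_pt_eps _ _ Hc 1 Rlt_0_1) as [d [Hd H]].
  exists (Rabs (f' x) + 1), d. split; [pose proof (Rabs_pos (f' x)); lra|]. split; [exact Hd|].
  intros y z Hy Hz. destruct (mvt_two_sided f f' z y) as (c & Hc' & E); [intros; apply D|].
  rewrite E, Rabs_mult. apply Rmult_le_compat_r; [apply Rabs_pos|].
  specialize (H c (between_close _ _ _ _ _ Hc' Hz Hy)).
  replace (f' c) with (f' x + (f' c - f' x)) by ring.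
  eapply Rle_trans; [apply Rabs_triang|lra].
Qed.

(** One family for all comparisons: [e] carries the corrector, [f] the amplitude, [Psi] the outer
    power, and [sqd c x ^ j] is [|x - c|^(2 j)]. The inner profile [rho] is linear, except in the
    extinction argument, where it recovers a distance from this even power. *)
Definition bar {N} (c : RN N) (j : nat) (e f E a rho Psi : R -> R) (t : R) (x : RN N) : R :=
  e t + f t * Psi (E t + a t * rho (sqd c x ^ j)).

Lemma bar_dx N (c : RN N) j e f E a rho Psi rho1 Psi1 t x i :
  (forall y, derivable_pt_lim rho y (rho1 y)) -> (forall y, derivable_pt_lim Psi y (Psi1 y)) ->
  dx_at i (bar c j e f E a rho Psi) t x
    (f t * (Psi1 (E t + a t * rho (sqd c x ^ j)) *
      (a t * (rho1 (sqd c x ^ j) * (INR j * sqd c x ^ pred j * (2 * (x i - c i))))))).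
Proof.
  intros Hr1 HP1. unfold dx_at, bar. eapply dl_eq.
  - apply (dl_plus (fun _ => e t)); [apply dl_const|]. apply dl_scal.
    apply (dl_comp (fun h => E t + a t * rho (sqd c (upd x i h) ^ j)) Psi); [|apply HP1].
    apply (dl_plus (fun _ => E t)); [apply dl_const|]. apply dl_scal.
    apply (dl_comp (fun h => sqd c (upd x i h) ^ j) rho); [|apply Hr1].
    apply (dl_comp (fun h => sqd c (upd x i h)) (fun y => y ^ j)); [apply dl_sqd|apply dl_pow].
  - cbv beta. rewrite upd_same. ring.
Qed.

(** At the centre the viscosity inequality only concerns the sign of the time derivative, so a
    barrier strictly monotone in time cannot touch [u] there. *)
Lemma bar_center N (c : RN N) j e f E a rho Psi Dt Dx t :
  is_C2 (bar c j e f E a rho Psi) Dt Dx -> C2R rho -> C2R Psi -> 0 < t ->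
  normN (grad Dx t c) = 0.
Proof.
  intros (? & ? & ? & ? & HD) (r1 & Hr1 & _) (P1 & HP1 & _) Ht.
  apply normN_zero. intros i. unfold grad. destruct (HD t c Ht) as (_ & Hdx & _).
  rewrite (uniqueness_limite _ _ _ _ (Hdx i) (bar_dx N c j e f E a rho Psi r1 P1 t c i Hr1 HP1)). ring.
Qed.

Lemma bar_cont N P (c : RN N) j e f E a rho Psi t x :
  C2R e -> C2R f -> C2R E -> C2R a -> C2R rho -> C2R Psi -> contAt P (bar c j e f E a rho Psi) t x.
Proof.
  assert (HC : forall g y, C2R g -> continuity_pt g y).
  { intros g y (g1 & H & _). eapply dl_continuity, H. }
  assert (HT : forall g, C2R g -> contAt P (fun s (_ : RN N) => g s) t x).
  { intros g Hg. apply (contAt_comp N P g (fun s _ => s)); [apply contAt_time|auto]. }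
  intros He Hf HE Ha Hr HP. unfold bar. apply contAt_plus; [auto|]. apply contAt_mult; [auto|].
  apply (contAt_comp N P Psi); [|auto]. apply contAt_plus; [auto|]. apply contAt_mult; [auto|].
  apply (contAt_comp N P rho); [|auto]. apply (contAt_comp N P (fun y => y ^ j)); [apply contAt_sqd|].
  eapply dl_continuity, dl_pow.
Qed.

Lemma bar_C2 N (c : RN N) j e f E a rho Psi :
  C2R e -> C2R f -> C2R E -> C2R a ->
  C2R rho -> C2R Psi -> C2 (bar c j e f E a rho Psi).
Proof.
  intros He Hf HE Ha Hr HP.
  apply C2_plus; [now apply C2_of_time|]. apply C2_mult; [now apply C2_of_time|].
  apply (C2_comp _ _ Psi); [|exact HP].
  apply C2_plus; [now apply C2_of_time|]. apply C2_mult; [now apply C2_of_time|].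
  apply (C2_comp _ _ rho); [|exact Hr]. apply (C2_comp _ _ (fun y => y ^ j)); [apply C2_sqd|apply C2R_pow].
Qed.

Lemma locally_bounded (f : R -> R) t0 : C2R f ->
  exists d, 0 < d /\ forall t, Rabs (t - t0) < d -> Rabs (f t) <= Rabs (f t0) + 1.
Proof.
  intros (f1 & H & _). destruct (continuity_pt_eps f t0 (dl_continuity _ _ _ (H t0)) 1 Rlt_0_1) as [d [Hd H']].
  exists d; split; [exact Hd|]. intros t Hd'. specialize (H' t Hd').
  replace (f t) with (f t0 + (f t - f t0)) by ring. eapply Rle_trans; [apply Rabs_triang|lra].
Qed.

(* The gradient of [bar] vanishes only at the centre [c], where [bar] is flat of order [2 j]. *)
Lemma bar_admissible N p (c : RN N) j e f E a rho Psi :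
  1 < p < 2 -> 1 < (2 * INR j - 1) * (p - 1) ->
  C2R e -> C2R f -> C2R E -> C2R a ->
  C2R rho -> C2R Psi ->
  (forall t, 0 < t -> f t <> 0) -> (forall t, 0 < t -> a t <> 0) ->
  (forall y l, 0 <= y -> derivable_pt_lim rho y l -> l <> 0) ->
  (forall y l, derivable_pt_lim Psi y l -> l <> 0) ->
  exists Dt Dx, admissible p (bar c j e f E a rho Psi) Dt Dx.
Proof.
  intros Hp Hj He Hf HE Ha Hr HP Hf0 Ha0 Hr0 HP0.
  pose proof (bar_C2 N c j e f E a rho Psi He Hf HE Ha Hr HP) as HC.
  destruct (C2_is_C2 _ _ HC) as (Dt & Dx & HD). exists Dt, Dx. split; [exact HD|].
  intros t0 x0 Ht0 Hx0.
  assert (Hr' := Hr). destruct Hr' as (r1 & Hr1 & _), HP as (P1 & HP1 & (P2 & HP2 & _)).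
  assert (Hj0 : (0 < j)%nat) by (destruct j; [simpl in Hj; lra|lia]).
  assert (Hxc : x0 = c).
  { extensionality i. destruct HD as (? & ? & ? & ? & HD). destruct (HD t0 x0 Ht0) as (_ & Hdx & _).
    assert (H1 := Hdx i). rewrite Hx0 in H1.
    set (s := sqd c x0) in *.
    pose proof (bar_dx N c j e f E a rho Psi r1 P1 t0 x0 i Hr1 HP1) as H2. fold s in H2.
    pose proof (uniqueness_limite _ _ _ _ H1 H2) as H0. symmetry in H0.
    apply Rmult_integral in H0 as [H0|H0]; [now apply Hf0 in H0|].
    apply Rmult_integral in H0 as [H0|H0]; [exfalso; now apply (HP0 _ _ (HP1 _)) in H0|].
    apply Rmult_integral in H0 as [H0|H0]; [now apply Ha0 in H0|].
    assert (Hs : 0 <= s) by apply sqd_nonneg.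
    apply Rmult_integral in H0 as [H0|H0]; [exfalso; revert H0; apply (Hr0 (s ^ j)); auto using pow_le|].
    destruct (Req_dec s 0) as [E0|n0].
    - assert (Hz : normN (vminus x0 c) = 0).
      { assert (Hq := normN_sqd N c x0). fold s in Hq. rewrite E0 in Hq. nra. }
      apply (normN_eq0 _ _ i) in Hz. unfold vminus in Hz; lra.
    - apply Rmult_integral in H0 as [H0|H0]; [|lra].
      apply Rmult_integral in H0 as [H0|H0]; [apply (not_INR j 0) in H0; [tauto|lia]|].
      apply (pow_nonzero s (pred j)) in n0; contradiction. }
  subst x0.
  assert (S0 : sqd c c ^ j = 0).
  { rewrite <- normN_pow_even, normN_refl. apply pow_i; lia. }
  destruct (locally_bounded f t0 Hf) as (d1 & Hd1 & B1).
  destruct (locally_bounded a t0 Ha) as (d2 & Hd2 & B2).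
  destruct (dl_linear_bound _ _ _ (Hr1 0)) as (d3 & Hd3 & B3).
  destruct (locally_lipschitz Psi P1 (E t0 + a t0 * rho 0) HP1) as (K & d4 & HK & Hd4 & B4).
  { eapply dl_continuity, HP2. }
  assert (HI : C2 (fun t x => E t + a t * rho (sqd c x ^ j))).
  { apply C2_plus; [now apply C2_of_time|]. apply C2_mult; [now apply C2_of_time|].
    apply (C2_comp _ (fun _ x => sqd c x ^ j) rho); [|exact Hr].
    apply (C2_comp _ (fun _ x => sqd c x) (fun y => y ^ j)); [apply C2_sqd|apply C2R_pow]. }
  destruct (C1_cont _ _ t0 c (C2_C1 _ _ HI) Ht0 d4 Hd4) as (d5 & Hd5 & B5).
  (* Mean value theorem in time, then a linear bound on the increment of [Dt]: the remainder at the
     centre is quadratic, hence an admissible [omega]. *)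
  assert (B6 : exists d6 K2, 0 < d6 /\ 0 <= K2 /\ forall t, 0 < t -> Rabs (t - t0) < d6 ->
    Rabs (bar c j e f E a rho Psi t c - bar c j e f E a rho Psi t0 c - Dt t0 c * (t - t0)) <= K2 * Rabs (t - t0) ^ 2).
  { destruct HD as (Dtt & ? & ? & ? & HD).
    destruct (HD t0 c Ht0) as (_ & _ & Htt & _).
    destruct (dl_linear_bound _ _ _ Htt) as (d & Hd & B).
    exists d, (Rabs (Dtt t0 c) + 1). split; [exact Hd|]. split; [pose proof (Rabs_pos (Dtt t0 c)); lra|].
    intros t Ht Hdt.
    destruct (mvt_two_sided (fun t => bar c j e f E a rho Psi t c) (fun t => Dt t c) t0 t) as (m & Hm & Em).
    { intros y Hy. apply HD. apply Rlt_le_trans with (Rmin t0 t); [now apply Rmin_glb_lt|tauto]. }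
    rewrite Em, <- Rmult_minus_distr_r, Rabs_mult.
    replace (Rabs (t - t0) ^ 2) with (Rabs (t - t0) * Rabs (t - t0)) by ring.
    rewrite <- Rmult_assoc. apply Rmult_le_compat_r; [apply Rabs_pos|].
    assert (Hm' : Rabs (m - t0) <= Rabs (t - t0)).
    { unfold Rmin, Rmax in Hm. destruct Rle_dec; unfold Rabs; repeat destruct Rcase_abs; lra. }
    eapply Rle_trans; [apply B; lra|]. apply Rmult_le_compat_l; [pose proof (Rabs_pos (Dtt t0 c)); lra|exact Hm']. }
  destruct B6 as (d6 & K2 & Hd6 & HK2 & B6).
  (* Product of the local bounds on [f] and [a] and the local Lipschitz constants of [Psi] and
     [rho]; the final [+ 1] makes [C] positive even when [K = 0]. *)
  set (C := (Rabs (f t0) + 1) * (K * ((Rabs (a t0) + 1) * (Rabs (r1 0) + 1))) + 1).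
  (* For [r < 1] one has [r ^ (2 * j) <= r], so [r < d3] also controls the argument of [rho]. *)
  set (d3' := Rmin 1 d3).
  exists (Rmin (Rmin d1 d2) (Rmin d3' (Rmin d5 d6))).
  assert (Hd3' : 0 < d3') by (apply Rmin_glb_lt; lra).
  split; [apply Rmin_glb_lt; repeat apply Rmin_glb_lt; lra|].
  assert (HC0 : 0 <= (Rabs (f t0) + 1) * (K * ((Rabs (a t0) + 1) * (Rabs (r1 0) + 1)))).
  { pose proof (Rabs_pos (f t0)); pose proof (Rabs_pos (a t0)); pose proof (Rabs_pos (r1 0)).
    repeat apply Rmult_le_pos; lra. }
  exists (fun r => C * r ^ (2 * j)), (fun s => K2 * s ^ 2).
  split; [apply in_Fp_pow; auto; unfold C; lra|]. split; [now apply omega_ok_sqr|].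
  intros t x Ht Htd Hxd.
  unfold d3' in *.
  repeat match goal with H : _ < Rmin _ _ |- _ => apply Rmin_Rgt_l in H; unfold Rgt in H; destruct H end.
  set (b := bar c j e f E a rho Psi) in *.
  (* Spatial increment at time [t], bounded by [xi], plus temporal remainder at the centre, bounded
     by [omega]. *)
  replace (b t x - b t0 c - Dt t0 c * (t - t0))
    with ((b t x - b t c) + (b t c - b t0 c - Dt t0 c * (t - t0))) by ring.
  eapply Rle_trans; [apply Rabs_triang|]. apply Rplus_le_compat; [|now apply B6].
  unfold b, bar. rewrite S0.
  set (r := normN (vminus x c)) in *. assert (Hr0r : 0 <= r) by apply normN_nonneg.
  assert (Ez : sqd c x ^ j = r ^ (2 * j)) by (symmetry; apply normN_pow_even).
  set (z := r ^ (2 * j)) in *. 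
  assert (Hz : 0 <= z) by (now apply pow_le).
  assert (Hd3z : Rabs (z - 0) < d3).
  { rewrite Rminus_0_r, Rabs_pos_eq by assumption.
    apply Rle_lt_trans with r; [|assumption]. unfold z. destruct j as [|j]; [lia|].
    replace (2 * S j)%nat with (S (S (2 * j))) by lia.
    change (r * r ^ S (2 * j) <= r). rewrite <- (Rmult_1_r r) at 3.
    apply Rmult_le_compat_l; [assumption|]. rewrite <- (pow1 (S (2 * j))). apply pow_incr; lra. }
  rewrite Ez.
  replace (e t + f t * Psi (E t + a t * rho z) - (e t + f t * Psi (E t + a t * rho 0)))
    with (f t * (Psi (E t + a t * rho z) - Psi (E t + a t * rho 0))) by ring.
  rewrite Rabs_mult.
  assert (B4' := B4 (E t + a t * rho z) (E t + a t * rho 0)).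
  assert (B5x := B5 t x Ht ltac:(assumption) ltac:(assumption)).
  assert (B5c := B5 t c Ht ltac:(assumption) ltac:(rewrite normN_refl; assumption)).
  cbv beta in B5x, B5c. rewrite S0 in B5x, B5c. rewrite Ez in B5x.
  specialize (B4' B5x B5c).
  replace (E t + a t * rho z - (E t + a t * rho 0)) with (a t * (rho z - rho 0)) in B4' by ring.
  rewrite Rabs_mult in B4'. specialize (B3 z Hd3z).
  rewrite Rminus_0_r, (Rabs_pos_eq z Hz) in B3.
  specialize (B1 t ltac:(assumption)). specialize (B2 t ltac:(assumption)).
  apply Rle_trans with ((Rabs (f t0) + 1) * (K * ((Rabs (a t0) + 1) * ((Rabs (r1 0) + 1) * z)))).
  - apply Rmult_le_compat; auto using Rabs_pos. eapply Rle_trans; [exact B4'|].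
    apply Rmult_le_compat_l; [exact HK|]. apply Rmult_le_compat; auto using Rabs_pos.
  - unfold C. lra.
Qed.

(** * The p-Laplacian of a radial function *)

Lemma dl_norm N (c x : RN N) i : 0 < normN (vminus x c) ->
  derivable_pt_lim (fun h => normN (vminus (upd x i h) c)) (x i) ((x i - c i) / normN (vminus x c)).
Proof.
  intros H.
  apply dl_local with (f := fun h => sqrt (sqd c (upd x i h))) (d := 1); [lra| |].
  { intros y _. rewrite <- normN_sqd, sqrt_pow2; auto using normN_nonneg. }
  assert (Hs : sqrt (sqd c x) = normN (vminus x c)) by (rewrite <- normN_sqd, sqrt_pow2; lra).
  assert (Hp : 0 < sqd c x) by (rewrite <- normN_sqd; apply pow_lt; assumption).
  eapply dl_eq.
  - apply (dl_comp (fun h => sqd c (upd x i h)) sqrt); [apply dl_sqd|].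
    apply derivable_pt_lim_sqrt. rewrite upd_same; exact Hp.
  - cbv beta. rewrite upd_same, Hs. field. lra.
Qed.

(** The one-dimensional flux, differentiated on either side of its singularity; the source of the
    factor [p - 1] in the radial formula. *)
Lemma dl_signed_power p w : w <> 0 ->
  derivable_pt_lim (fun v => Rpower (Rabs v) (p - 2) * v) w ((p - 1) * Rpower (Rabs w) (p - 2)).
Proof.
  intros Hw. assert (Ha : 0 < Rabs w) by now apply Rabs_pos_lt.
  assert (HR : Rpower (Rabs w) (p - 2) = Rpower (Rabs w) (p - 2 - 1) * Rabs w).
  { rewrite <- (Rpower_1 (Rabs w)) at 3 by exact Ha. rewrite <- Rpower_plus. f_equal; ring. }
  destruct (Rtotal_order w 0) as [h|[h|h]]; [|lra|].
  - eapply dl_eq.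
    + apply dl_mult; [|apply dl_id].
      apply (dl_comp Rabs (fun z => Rpower z (p - 2))); [now apply Rabs_derive_2|now apply dl_Rpower].
    + cbv beta. rewrite HR. rewrite Rabs_left by exact h. ring.
  - eapply dl_eq.
    + apply dl_mult; [|apply dl_id].
      apply (dl_comp Rabs (fun z => Rpower z (p - 2))); [now apply Rabs_derive_1|now apply dl_Rpower].
    + cbv beta. rewrite HR. rewrite Rabs_right by lra. ring.
Qed.

Lemma dl_div f g x a b : g x <> 0 -> derivable_pt_lim f x a -> derivable_pt_lim g x b ->
  derivable_pt_lim (fun y => f y / g y) x ((a * g x - b * f x) / (g x) ^ 2).
Proof.
  intros H Hf Hg. eapply dl_eq; [apply (derivable_pt_lim_div f g); eassumption|].
  now rewrite Rsqr_pow2.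
Qed.

(** Near [x0] the flux is [(Phi (r) / r) (x - c)] with [Phi = |W'|^(p-2) W'], and its divergence is
    [Phi' + (N - 1) Phi / r]. The radial form is only required near [x0] at time [t0], which allows
    truncated or shifted profiles. *)
Lemma plap_radial N p (psi Dt : R -> RN N -> R) Dx t0 (x0 c : RN N) W W1 W2 d :
  is_C2 psi Dt Dx -> 0 < t0 -> 0 < normN (vminus x0 c) -> 0 < d ->
  (forall x, normN (vminus x x0) < d -> psi t0 x = W (normN (vminus x c))) ->
  (forall r, Rabs (r - normN (vminus x0 c)) < d -> derivable_pt_lim W r (W1 r)) ->
  derivable_pt_lim W1 (normN (vminus x0 c)) W2 -> W1 (normN (vminus x0 c)) <> 0 ->
  normN (grad Dx t0 x0) = Rabs (W1 (normN (vminus x0 c))) /\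
  plap_at p Dx t0 x0 (Rpower (Rabs (W1 (normN (vminus x0 c)))) (p - 2) *
    ((p - 1) * W2 + (INR N - 1) * (W1 (normN (vminus x0 c)) / normN (vminus x0 c)))).
Proof.
  intros HC Ht Hr0 Hd Hpsi HW HW1 Hne. set (r0 := normN (vminus x0 c)) in *.
  set (d' := Rmin d r0). assert (Hd' : 0 < d') by (apply Rmin_glb_lt; lra).
  assert (Hd1 : d' <= d) by apply Rmin_l. assert (Hd2 : d' <= r0) by apply Rmin_r.
  assert (Hclose : forall x, normN (vminus x x0) < d' ->
    0 < normN (vminus x c) /\ Rabs (normN (vminus x c) - r0) < d).
  { intros x Hx. pose proof (normN_lip N x x0 c) as H. fold r0 in H.
    split; [|lra]. revert H. unfold Rabs; destruct Rcase_abs; lra. }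
  assert (Hgrad : forall x i, normN (vminus x x0) < d' ->
    Dx i t0 x = W1 (normN (vminus x c)) / normN (vminus x c) * (x i - c i)).
  { intros x i Hx. destruct (Hclose x Hx) as [Hp Hx'].
    destruct HC as (? & ? & ? & ? & HC). destruct (HC t0 x Ht) as (_ & Hdx & _).
    apply (uniqueness_limite _ _ _ _ (Hdx i)).
    apply dl_local with (f := fun h => W (normN (vminus (upd x i h) c))) (d := d' - normN (vminus x x0)); [lra| |].
    - intros y Hy. symmetry. apply Hpsi.
      pose proof (normN_triangle N (upd x i y) x x0). rewrite normN_upd in H. lra.
    - eapply dl_eq.
      + apply (dl_comp (fun h => normN (vminus (upd x i h) c)) W); [now apply dl_norm|].
        cbv beta. rewrite upd_same. now apply HW.
      + field. lra. }
  assert (Hgn : forall x, normN (vminus x x0) < d' -> normN (grad Dx t0 x) = Rabs (W1 (normN (vminus x c)))).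
  { intros x Hx. destruct (Hclose x Hx) as [Hp _].
    replace (grad Dx t0 x) with (fun i => W1 (normN (vminus x c)) / normN (vminus x c) * vminus x c i).
    - rewrite normN_scal. rewrite <- (Rabs_pos_eq (normN (vminus x c))) at 3 by lra.
      rewrite <- Rabs_mult. f_equal. field. lra.
    - extensionality i. unfold grad. rewrite Hgrad by exact Hx. reflexivity. }
  assert (Hx0 : normN (vminus x0 x0) < d') by (rewrite normN_refl; exact Hd').
  split; [apply (Hgn x0 Hx0)|].
  set (w := W1 r0) in *. set (A := Rpower (Rabs w) (p - 2)).
  (* The derivative of [Phi (r) / r] at [r0]. The i-th partial derivative of the i-th flux component
     is then [K' (x_i - c_i)^2 / r0 + Phi (r0) / r0], with [Phi (r0) = A * w]. *)
  set (K' := (((p - 1) * A * W2) * r0 - 1 * (A * w)) / r0 ^ 2).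
  assert (HK : derivable_pt_lim (fun r => Rpower (Rabs (W1 r)) (p - 2) * W1 r / r) r0 K').
  { apply (dl_div (fun r => Rpower (Rabs (W1 r)) (p - 2) * W1 r) (fun r => r)); [lra| |apply dl_id].
    apply (dl_comp W1 (fun v => Rpower (Rabs v) (p - 2) * v)); [exact HW1|]. now apply dl_signed_power. }
  exists (fun i => K' / r0 * (x0 i - c i) ^ 2 + A * w / r0). split.
  - intros i.
    apply dl_local with (f := fun h => Rpower (Rabs (W1 (normN (vminus (upd x0 i h) c)))) (p - 2)
        * W1 (normN (vminus (upd x0 i h) c)) / normN (vminus (upd x0 i h) c) * (h - c i)) (d := d'); [exact Hd'| |].
    + intros y Hy. rewrite <- normN_upd in Hy. rewrite Hgn, Hgrad, upd_eq by exact Hy.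
      unfold Rdiv; ring.
    + eapply dl_eq.
      * apply dl_mult.
        -- apply (dl_comp (fun h => normN (vminus (upd x0 i h) c))
             (fun r => Rpower (Rabs (W1 r)) (p - 2) * W1 r / r)); [now apply dl_norm|].
           cbv beta. rewrite upd_same. exact HK.
        -- apply (dl_minus (fun h => h) (fun _ => c i)); [apply dl_id|apply dl_const].
      * cbv beta. rewrite upd_same. fold r0. fold w. fold A. unfold Rdiv; ring.
  - rewrite sumFin_plus, sumFin_scal, sumFin_const. fold (sqd c x0). rewrite <- normN_sqd. fold r0.
    unfold K'. field. lra.
Qed.

Lemma time_derivative N (psi Dt : R -> RN N -> R) Dx t0 x0 l :
  is_C2 psi Dt Dx -> 0 < t0 -> derivable_pt_lim (fun t => psi t x0) t0 l -> Dt t0 x0 = l.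
Proof.
  intros (? & ? & ? & ? & HC) Ht H. destruct (HC t0 x0 Ht) as (Hdt & _).
  exact (uniqueness_limite _ _ _ _ Hdt H).
Qed.

(** * Interior maxima *)

Lemma choice_nat {A : Type} (P : nat -> A -> Prop) :
  (forall n, exists a, P n a) -> exists f, forall n, P n (f n).
Proof.
  intros H. exists (fun n => proj1_sig (constructive_indefinite_description _ (H n))).
  intros n. apply proj2_sig.
Qed.

Lemma inv_INR_small eps : 0 < eps -> exists n0, forall n, (n0 <= n)%nat -> / (INR n + 1) < eps.
Proof.
  intros He. destruct (archimed_cor1 eps He) as (n0 & H & H0). exists n0. intros n Hn.
  eapply Rle_lt_trans; [|exact H]. apply Rinv_le_contravar.
  - apply lt_0_INR; lia.
  - apply le_INR in Hn. lra.
Qed.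

(** The selection [g] need not be increasing: [n <= g n] is enough to transfer limits and to compose
    selections. *)
Lemma bounded_subsequence (u : nat -> R) M : (forall n, Rabs (u n) <= M) ->
  exists g : nat -> nat, (forall n, (n <= g n)%nat) /\ exists l, Un_cv (fun n => u (g n)) l.
Proof.
  intros H.
  destruct (Bolzano_Weierstrass u (fun x => - M <= x <= M) (compact_P3 (- M) M)) as [l Hl].
  { intros n. specialize (H n). revert H. unfold Rabs; destruct Rcase_abs; lra. }
  destruct (choice_nat (fun n k => (n <= k)%nat /\ Rabs (u k - l) < / (INR n + 1))) as [g Hg].
  { intros n. assert (Hp : 0 < / (INR n + 1)) by (apply Rinv_0_lt_compat; pose proof (pos_INR n); lra).
    destruct (Hl (disc l (mkposreal _ Hp)) n) as (k & Hk & Hk').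
    - exists (mkposreal _ Hp). intros x Hx; exact Hx.
    - now exists k. }
  exists g. split; [apply Hg|]. exists l. intros eps He.
  destruct (inv_INR_small eps He) as [n0 Hn0]. exists n0. intros n Hn.
  eapply Rlt_trans; [apply Hg|]. apply Hn0; lia.
Qed.

Lemma Un_cv_subseq u l (g : nat -> nat) : (forall n, (n <= g n)%nat) -> Un_cv u l ->
  Un_cv (fun n => u (g n)) l.
Proof.
  intros Hg H eps He. destruct (H eps He) as [n0 Hn0]. exists n0. intros n Hn. apply Hn0.
  specialize (Hg n). lia.
Qed.

Lemma bounded_subsequence_RN N (X : nat -> RN N) M : (forall n i, Rabs (X n i) <= M) ->
  exists g : nat -> nat, (forall n, (n <= g n)%nat) /\
    exists x : RN N, forall i, Un_cv (fun n => X (g n) i) (x i).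
Proof.
  induction N as [|N IH]; intros H.
  - exists (fun n => n). split; [lia|]. exists (fun _ => 0). intros i. inversion i.
  - destruct (IH (fun n i => X n (Fin.FS i))) as (g & Hg & x & Hx); [intros; apply H|].
    destruct (bounded_subsequence (fun n => X (g n) Fin.F1) M) as (g' & Hg' & l & Hl); [intros; apply H|].
    exists (fun n => g (g' n)). split; [intros n; specialize (Hg' n); specialize (Hg (g' n)); lia|].
    exists (fcons l x). intros i. apply (Fin.caseS' i).
    + exact Hl.
    + intros j. apply (Un_cv_subseq (fun n => X (g n) (Fin.FS j))); [exact Hg'|apply Hx].
Qed.

Lemma Un_cv_norm N (X : nat -> RN N) x : (forall i, Un_cv (fun n => X n i) (x i)) ->
  forall eps, 0 < eps -> exists n0, forall n, (n0 <= n)%nat -> normN (vminus (X n) x) < eps.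
Proof.
  intros H eps He. set (e := eps / (INR N + 1)).
  pose proof (pos_INR N) as HN. assert (He' : 0 < e) by (apply Rdiv_lt_0_compat; lra).
  assert (Hu : exists n0, forall n, (n0 <= n)%nat -> forall i, Rabs (X n i - x i) <= e).
  { clearbody e. clear - H He'. induction N as [|N IH].
    - exists 0%nat. intros n _ i. inversion i.
    - destruct (IH (fun n i => X n (Fin.FS i)) (fun i => x (Fin.FS i))) as [n1 H1]; [intros; apply H|].
      destruct (H Fin.F1 e He') as [n2 H2]. exists (max n1 n2). intros n Hn i.
      apply (Fin.caseS' i); [left; apply H2; lia|intros j; apply H1; lia]. }
  destruct Hu as [n0 Hn0]. exists n0. intros n Hn.
  eapply Rle_lt_trans; [apply (normN_le_sum N _ e); [lra|intros i; now apply Hn0]|].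
  unfold e. apply Rmult_lt_reg_r with (INR N + 1); [lra|]. field_simplify; [nra|lra].
Qed.

Lemma max_on_cylinder N (v : R -> RN N -> R) t1 t2 c r :
  cont_closed v -> 0 <= t1 <= t2 -> 0 <= r ->
  exists t0 x0, t1 <= t0 <= t2 /\ normN (vminus x0 c) <= r /\
    forall t x, t1 <= t <= t2 -> normN (vminus x c) <= r -> v t x <= v t0 x0.
Proof.
  intros Hv Ht Hr.
  (* [atan] turns [v] into a bounded function with the same maximizers. *)
  set (E := fun y => exists t x, t1 <= t <= t2 /\ normN (vminus x c) <= r /\ y = atan (v t x)).
  destruct (completeness E) as [m [Hub Hlub]].
  { exists (PI / 2). intros y (t & x & _ & _ & ->). left; apply atan_bound. }
  { exists (atan (v t1 c)), t1, c. rewrite normN_refl. repeat split; lra. }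
  (* A maximizing sequence for [atan (v t x)], whose limit along a selection will be the
     maximizer. *)
  destruct (choice_nat (fun n (z : R * RN N) => t1 <= fst z <= t2 /\ normN (vminus (snd z) c) <= r /\
    m - / (INR n + 1) < atan (v (fst z) (snd z)))) as [Z HZ].
  { intros n. assert (Hp : 0 < / (INR n + 1)) by (apply Rinv_0_lt_compat; pose proof (pos_INR n); lra).
    destruct (classic (exists z : R * RN N, t1 <= fst z <= t2 /\ normN (vminus (snd z) c) <= r /\
      m - / (INR n + 1) < atan (v (fst z) (snd z)))) as [|Hn]; [assumption|].
    assert (m <= m - / (INR n + 1)); [|lra]. apply Hlub. intros y (t & x & Htt & Hx & ->).
    destruct (Rle_or_lt (atan (v t x)) (m - / (INR n + 1))); [assumption|].
    exfalso; apply Hn. now exists (t, x). }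
  destruct (bounded_subsequence (fun n => fst (Z n)) t2) as (g1 & Hg1 & t0 & Ht0).
  { intros n. destruct (HZ n) as (H & _). rewrite Rabs_pos_eq; lra. }
  destruct (bounded_subsequence_RN N (fun n => snd (Z (g1 n))) (r + normN c)) as (g2 & Hg2 & x0 & Hx0).
  { intros n i. destruct (HZ (g1 n)) as (_ & H & _). set (x := snd (Z (g1 n))) in *.
    eapply Rle_trans; [apply normN_coord|].
    pose proof (normN_triangle N x c (fun _ => 0)) as H'. rewrite !normN_vminus0 in H'. lra. }
  set (g := fun n => g1 (g2 n)).
  assert (Hg : forall n, (n <= g n)%nat).
  { intros n. unfold g. specialize (Hg2 n). specialize (Hg1 (g2 n)). lia. }
  assert (Ct := Un_cv_subseq _ _ g2 Hg2 Ht0). cbv beta in Ct.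
  pose proof (Un_cv_norm N _ _ Hx0) as Cx.
  assert (I1 : t1 <= t0 <= t2).
  { split; apply Rnot_lt_le; intros Hlt.
    - destruct (Ct (t1 - t0)) as [n0 Hn0]; [lra|]. specialize (Hn0 n0 ltac:(lia)).
      destruct (HZ (g n0)) as (H & _). apply Rabs_def2 in Hn0. fold (g n0) in Hn0. lra.
    - destruct (Ct (t0 - t2)) as [n0 Hn0]; [lra|]. specialize (Hn0 n0 ltac:(lia)).
      destruct (HZ (g n0)) as (H & _). apply Rabs_def2 in Hn0. fold (g n0) in Hn0. lra. }
  assert (I2 : normN (vminus x0 c) <= r).
  { apply Rnot_lt_le; intros Hlt. destruct (Cx (normN (vminus x0 c) - r)) as [n0 Hn0]; [lra|].
    specialize (Hn0 n0 ltac:(lia)). destruct (HZ (g n0)) as (_ & H & _).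
    change (normN (vminus (snd (Z (g n0))) x0) < normN (vminus x0 c) - r) in Hn0. pose proof (normN_triangle N x0 (snd (Z (g n0))) c).
    rewrite (normN_sym N x0 (snd (Z (g n0)))) in H0. lra. }
  assert (Hm : m <= atan (v t0 x0)).
  { apply Rnot_lt_le; intros Hlt. set (d := (m - atan (v t0 x0)) / 2).
    assert (Hd : 0 < d) by (unfold d; lra).
    assert (Hc : continuity_pt atan (v t0 x0)) by (eapply dl_continuity, derivable_pt_lim_atan).
    destruct (continuity_pt_eps _ _ Hc d Hd) as [d1 [Hd1 H1]].
    destruct (Hv t0 x0 ltac:(lra) d1 Hd1) as [d2 [Hd2 H2]].
    destruct (Ct d2 Hd2) as [n1 Hn1]. destruct (Cx d2 Hd2) as [n2 Hn2].
    destruct (inv_INR_small d Hd) as [n3 Hn3]. set (n := max n1 (max n2 n3)).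
    destruct (HZ (g n)) as (A & _ & B).
    specialize (H2 (fst (Z (g n))) (snd (Z (g n))) ltac:(lra) (Hn1 n ltac:(lia)) (Hn2 n ltac:(lia))).
    specialize (H1 _ H2). specialize (Hn3 (g n) ltac:(specialize (Hg n); lia)).
    apply Rabs_def2 in H1. unfold d in *. lra. }
  exists t0, x0. split; [exact I1|]. split; [exact I2|]. intros t x Htt Hx.
  apply Rnot_lt_le; intros Hlt. apply atan_increasing in Hlt.
  assert (atan (v t x) <= m) by (apply Hub; now exists t, x). lra.
Qed.

(** A nonnegative maximum would have to lie off the lateral, initial and final boundaries. The final
    time is included because [loc_max] looks at later times as well. *)
Lemma interior_max N (v : R -> RN N -> R) t1 t2 c r :
  cont_closed v -> 0 <= t1 < t2 -> 0 < r ->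
  (forall x, normN (vminus x c) <= r -> v t1 x < 0) ->
  (forall x, normN (vminus x c) <= r -> v t2 x < 0) ->
  (forall t x, t1 <= t <= t2 -> normN (vminus x c) = r -> v t x < 0) ->
  (forall t x, 0 < t -> t1 < t < t2 -> normN (vminus x c) < r -> 0 <= v t x -> ~ loc_max v t x) ->
  forall t x, t1 <= t <= t2 -> normN (vminus x c) <= r -> v t x < 0.
Proof.
  intros Hv Ht Hr B1 B2 B3 Hno t x Htt Hx. apply Rnot_le_lt; intros H0.
  destruct (max_on_cylinder N v t1 t2 c r Hv ltac:(lra) ltac:(lra)) as (t0 & x0 & It & Ix & Hmax).
  assert (Hp : 0 <= v t0 x0) by (specialize (Hmax t x Htt Hx); lra).
  assert (J1 : t0 <> t1) by (intros ->; specialize (B1 x0 Ix); lra).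
  assert (J2 : t0 <> t2) by (intros ->; specialize (B2 x0 Ix); lra).
  assert (J3 : normN (vminus x0 c) <> r) by (intros H; specialize (B3 t0 x0 It H); lra).
  apply (Hno t0 x0); try lra.
  exists (Rmin (r - normN (vminus x0 c)) (Rmin (t0 - t1) (t2 - t0))). split.
  { repeat apply Rmin_glb_lt; lra. }
  intros s y Hs Hst Hy.
  apply Rmin_Rgt_l in Hst as [Hs1 Hs2]. apply Rmin_Rgt_l in Hs2 as [Hs2 Hs3].
  apply Rmin_Rgt_l in Hy as [Hy _]. apply Rabs_def2 in Hs2, Hs3.
  apply Hmax; [lra|]. pose proof (normN_triangle N y x0 c). lra.
Qed.

(** * Local bounds *)

(** Once every base is written as the exponential of its logarithm, an identity between products of
    powers becomes an algebraic identity between exponents. *)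
Ltac exp_simpl :=
  unfold Rpower, Rdiv;
  repeat first [rewrite ln_exp | rewrite <- exp_plus | rewrite <- exp_Ropp].

Lemma Rpower_le_1 y a : 0 < y <= 1 -> 0 <= a -> Rpower y a <= 1.
Proof.
  intros Hy Ha. replace 1 with (Rpower 1 a) by (unfold Rpower; rewrite ln_1, Rmult_0_r; apply exp_0).
  now apply Rle_Rpower_l.
Qed.

Lemma exists_flat_order p : 1 < p -> exists j, (2 <= j)%nat /\ 1 < (2 * INR j - 1) * (p - 1).
Proof.
  intros Hp. destruct (INR_unbounded (/ (p - 1) + 2)) as [j Hj].
  assert (0 < / (p - 1)) by (apply Rinv_0_lt_compat; lra).
  exists j. split.
  - apply INR_le. simpl. lra.
  - apply Rlt_le_trans with ((/ (p - 1) + 2) * (p - 1)).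
    + rewrite Rmult_plus_distr_r, Rinv_l; lra.
    + apply Rmult_le_compat_r; lra.
Qed.

(** The left-hand side is [W1^(p-1) / (y r)] with [v = r / R]. The exponent [m (p - 1) + p] of
    [1 / y] equals [m] for [m = p / (2 - p)], and the exponent of [v] is the one made positive by
    flatness. *)
Lemma blowup_power f m n y v R p : 0 < f -> 0 < m -> 0 < n -> 0 < y -> 0 < v -> 0 < R ->
  Rpower (f * m * n * Rpower y (- m - 1) * Rpower v n / (v * R)) (p - 1) / (y * (v * R))
  = Rpower (f * m * n) (p - 1) * Rpower y (- (m * (p - 1) + p)) * Rpower v ((n - 1) * (p - 1) - 1) * Rpower R (- p).
Proof.
  intros Hf Hm Hn Hy Hv HR. 
  assert (H : 0 < f * m * n) by (repeat apply Rmult_lt_0_compat; assumption).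
  set (k := f * m * n) in *. clearbody k.
  pose proof (exp_ln k H) as Ek. set (lk := ln k) in *. 
  pose proof (exp_ln y Hy) as Ey. pose proof (exp_ln v Hv) as Ev. pose proof (exp_ln R HR) as ER.
  set (ly := ln y) in *; set (lv := ln v) in *; set (lR := ln R) in *.
  clearbody lk ly lv lR. rewrite <- Ek, <- Ey, <- Ev, <- ER. clear.
  exp_simpl. f_equal. ring.
Qed.

Lemma Rpower_ge_1 x a : 1 <= x -> 0 <= a -> 1 <= Rpower x a.
Proof.
  intros Hx Ha. replace 1 with (Rpower 1 a) at 1 by (unfold Rpower; rewrite ln_1, Rmult_0_r; apply exp_0).
  apply Rle_Rpower_l; lra.
Qed.

(* The left-hand side is the radial p-Laplacian of [f y ^ (-m)] with [y = 1 - (r / R) ^ n];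
   the exponent [m = p / (2 - p)] makes it comparable to [y ^ (-m)] itself. *)
Lemma blowup_estimate p m f R r D k :
  1 < p < 2 -> m = p / (2 - p) -> 0 < f -> 0 < R -> 0 < r < R -> 1 <= D ->
  let n := S (S k) in
  1 < (INR n - 1) * (p - 1) ->
  let y := 1 + - / R ^ n * r ^ n in
  let g := - / R ^ n * (INR n * r ^ S k) in
  let W1 := f * (- m * Rpower y (- m - 1) * g) in
  let W2 := f * (- m * (- m - 1) * Rpower y (- m - 2) * g * g
             + - m * Rpower y (- m - 1) * (- / R ^ n * (INR n * ((INR n - 1) * r ^ k)))) in
  0 < y -> 0 < W1 /\
  Rpower (Rabs W1) (p - 2) * ((p - 1) * W2 + (D - 1) * (W1 / r)) <=
  ((m + 1) * INR n + INR n + D) * Rpower (m * INR n) (p - 1) * Rpower f (p - 1) * Rpower y (- m) * Rpower R (- p).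
Proof.
  intros Hp Em Hf HR Hr HD n Hn y g W1 W2 Hy.
  assert (Hn2 : 2 <= INR n) by (unfold n; rewrite !S_INR; pose proof (pos_INR k); lra).
  assert (Hm : 0 < m) by (subst m; apply Rdiv_lt_0_compat; lra).
  set (v := r / R). assert (Hv : 0 < v < 1).
  { unfold v; split; [apply Rdiv_lt_0_compat; lra|].
    apply Rmult_lt_reg_r with R; [lra|]. unfold Rdiv. rewrite Rmult_assoc, Rinv_l; lra. }
  assert (Er : r = v * R) by (unfold v; field; lra).
  assert (Evn : Rpower v (INR n) = v ^ n) by (apply Rpower_pow; lra).
  assert (Hvn : 0 < v ^ n < 1).
  { split; [apply pow_lt; lra|]. apply pow_lt_1_compat; [lra|unfold n; lia]. }
  assert (Ey : y = 1 - v ^ n).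
  { unfold y. rewrite Er, Rpow_mult_distr. field. apply pow_nonzero; lra. }
  assert (Eg : g = - (INR n * v ^ n / r)).
  { unfold g. rewrite Er at 2. unfold n. rewrite Er, !Rpow_mult_distr. simpl pow.
    field. repeat split; try lra; try (apply pow_nonzero; lra). }
  set (P := Rpower y (- m - 1)) in *. assert (HP : 0 < P) by apply Rpower_pos.
  assert (EP : Rpower y (- m - 2) = P / y).
  { unfold P, Rdiv. rewrite <- (Rpower_1 y) at 3 by exact Hy. rewrite <- Rpower_Ropp, <- Rpower_plus. f_equal; ring. }
  assert (EW1 : W1 = f * m * INR n * P * v ^ n / r).
  { unfold W1. rewrite Eg. field; lra. }
  assert (HW1 : 0 < W1).
  { rewrite EW1. apply Rdiv_lt_0_compat; [|lra]. repeat (apply Rmult_lt_0_compat; [|lra]); lra. }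
  split; [exact HW1|].
  assert (EW2 : W2 = W1 * ((m + 1) * INR n * v ^ n / (y * r) + (INR n - 1) / r)).
  { assert (Eg' : - / R ^ n * (INR n * ((INR n - 1) * r ^ k)) = g * (INR n - 1) / r).
    { unfold g. change (r ^ S k) with (r * r ^ k). field. split; [apply pow_nonzero|]; lra. }
    unfold W2. rewrite Eg', EP, EW1, Eg. field; lra. }
  (* Over the common denominator [y r], use [v ^ n < 1], [y < 1] and [p - 1 < 1]. *)
  assert (HB : (p - 1) * W2 + (D - 1) * (W1 / r) <= W1 * (((m + 1) * INR n + INR n + D) / (y * r))).
  { rewrite EW2. replace ((D - 1) * (W1 / r)) with (W1 * ((D - 1) * y / (y * r))) by (field; lra).
    replace ((INR n - 1) / r) with ((INR n - 1) * y / (y * r)) by (field; lra).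
    replace ((p - 1) * (W1 * ((m + 1) * INR n * v ^ n / (y * r) + (INR n - 1) * y / (y * r))) + W1 * ((D - 1) * y / (y * r)))
      with (W1 * (((p - 1) * ((m + 1) * INR n * v ^ n + (INR n - 1) * y) + (D - 1) * y) / (y * r))) by (field; lra).
    apply Rmult_le_compat_l; [lra|]. apply Rmult_le_compat_r.
    { left; apply Rinv_0_lt_compat, Rmult_lt_0_compat; lra. }
    assert (0 <= (m + 1) * INR n) by (apply Rmult_le_pos; lra).
    assert (H1 : (m + 1) * INR n * v ^ n <= (m + 1) * INR n).
    { rewrite <- (Rmult_1_r ((m + 1) * INR n)) at 2. apply Rmult_le_compat_l; lra. }
    assert (0 <= (m + 1) * INR n * v ^ n) by (apply Rmult_le_pos; lra).
    assert (y < 1) by lra.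
    assert (H7 : (INR n - 1) * y <= INR n) by nra. assert (H8 : (D - 1) * y <= D) by nra.
    assert (0 <= (INR n - 1) * y) by (apply Rmult_le_pos; lra).
    nra. }
  rewrite Rabs_pos_eq by lra.
  eapply Rle_trans; [apply Rmult_le_compat_l; [left; apply Rpower_pos|exact HB]|].
  assert (E1 : Rpower W1 (p - 2) * (W1 * (((m + 1) * INR n + INR n + D) / (y * r)))
     = ((m + 1) * INR n + INR n + D) * (Rpower W1 (p - 1) / (y * r))).
  { replace (Rpower W1 (p - 1)) with (Rpower W1 (p - 2) * W1); [field; lra|].
    rewrite <- (Rpower_1 W1) at 2 by exact HW1. rewrite <- Rpower_plus. f_equal; ring. }
  rewrite E1. rewrite !Rmult_assoc.
  apply Rmult_le_compat_l.
  { assert (0 <= (m + 1) * INR n) by (apply Rmult_le_pos; lra). lra. }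
  rewrite EW1, <- Evn, Er. unfold P. rewrite blowup_power by lra.
  (* The defining property of [m]: diffusion reproduces the same power of [y] as the barrier. *)
  replace (m * (p - 1) + p) with m by (subst m; field; lra).
  replace (f * m * INR n) with (m * INR n * f) by ring.
  rewrite <- Rpower_mult_distr by (try apply Rmult_lt_0_compat; lra).
  rewrite !Rmult_assoc. apply Rmult_le_compat_l; [left; apply Rpower_pos|].
  apply Rmult_le_compat_l; [left; apply Rpower_pos|].
  apply Rmult_le_compat_l; [left; apply Rpower_pos|].
  (* The remaining power of [v < 1] has a positive exponent by [Hn], so it is at most 1. *)
  rewrite <- (Rmult_1_l (Rpower R (- p))) at 2.
  apply Rmult_le_compat_r; [left; apply Rpower_pos|]. apply Rpower_le_1; lra.
Qed.

Lemma cont_closed_minus N (F G : R -> RN N -> R) :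
  cont_closed F -> (forall t x, contAt (fun s => 0 <= s) G t x) ->
  cont_closed (fun t x => F t x - G t x).
Proof.
  intros HF HG t x Ht.
  apply (contAt_ext N (fun s => 0 <= s) (fun s y => F s y + - 1 * G s y)); [intros; ring|].
  apply contAt_plus; [exact (HF t x Ht)|]. apply contAt_mult; [apply contAt_const|apply HG].
Qed.

Lemma cont_closed_bounded N (u : R -> RN N -> R) t1 t2 c r :
  cont_closed u -> 0 <= t1 <= t2 -> 0 <= r ->
  exists K, 0 <= K /\ forall t x, t1 <= t <= t2 -> normN (vminus x c) <= r -> u t x <= K.
Proof.
  intros Hu Ht Hr. destruct (max_on_cylinder N u t1 t2 c r Hu Ht Hr) as (t0 & x0 & _ & _ & H).
  exists (Rmax 0 (u t0 x0)). split; [apply Rmax_l|]. intros t x Htt Hx.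
  eapply Rle_trans; [now apply H|apply Rmax_r].
Qed.

Lemma C2R_derivative_neq0 g g1 (P : R -> Prop) : (forall y, derivable_pt_lim g y (g1 y)) ->
  (forall y, P y -> g1 y <> 0) -> forall y l, P y -> derivable_pt_lim g y l -> l <> 0.
Proof. intros H H1 y l Hy Hl. rewrite (uniqueness_limite _ _ _ _ Hl (H y)). now apply H1. Qed.

(* The barrier is [(1 - (|x - c| / R) ^ n) ^ (-m)], truncated near the sphere at a height that [u]
   does not reach on the ball; the bound obtained is independent of this height. *)
Lemma local_bound N p q (u : R -> RN N -> R) : (1 <= N)%nat -> 1 < p < 2 ->
  cont_closed u -> visc_sub p q u ->
  forall T eta, 0 <= T -> 0 < eta -> exists R, 0 < R /\
    forall t1 c M, 0 <= t1 <= T -> (forall x, normN (vminus x c) <= R -> u t1 x <= M) ->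
    forall t, t1 <= t <= T -> u t c <= M + eta.
Proof.
  intros HN Hp Hu Hsub T eta HT Heta.
  destruct (exists_flat_order p) as (j & Hj2 & Hj); [lra|].
  assert (Hk : exists k, (2 * j)%nat = S (S k)) by (exists (2 * j - 2)%nat; lia).
  destruct Hk as [k Ek].
  assert (En : INR (S (S k)) = 2 * INR j) by (rewrite <- Ek, mult_INR; reflexivity).
  set (n := S (S k)) in *.
  set (m := p / (2 - p)). assert (Hm : 0 < m) by (apply Rdiv_lt_0_compat; lra).
  assert (HD : 1 <= INR N) by (apply (le_INR 1); exact HN).
  (* At the centre the power equals 1, so the barrier exceeds [M] by [B (1 + t) <= eta / 2] plus the
     corrector, itself at most [eta / 2]. *)
  set (B := eta / (2 * (1 + T))). assert (HB : 0 < B) by (apply Rdiv_lt_0_compat; lra).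
  set (C1 := (m + 1) * INR n + INR n + INR N).
  assert (Hn0 : 0 < INR n) by (apply lt_0_INR; unfold n; lia).
  assert (HC1 : 0 < C1).
  { unfold C1. assert (0 < (m + 1) * INR n) by (apply Rmult_lt_0_compat; lra). lra. }
  (* Since [f <= B (2 + T)] up to time [T + 1], the diffusion is at most [Q B y^(-m) R0^(-p)]. With
     [R0^(-p) = 1 / (Q + 1)] it stays strictly below [B y^(-m)], a lower bound for the time
     derivative. Neither [c] nor [M] enters this choice. *)
  set (Q := C1 * Rpower (m * INR n) (p - 1) * Rpower (B * (2 + T)) (p - 1) / B).
  assert (HQ : 0 < Q).
  { unfold Q. apply Rdiv_lt_0_compat; [|lra]. repeat apply Rmult_lt_0_compat; auto using Rpower_pos. }
  set (R0 := Rpower (Q + 1) (/ p)). assert (HR0 : 0 < R0) by apply Rpower_pos.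
  assert (ER0 : Rpower R0 (- p) = / (Q + 1)).
  { unfold R0. rewrite Rpower_Ropp, Rpower_mult, Rinv_l, Rpower_1; lra. }
  exists R0. split; [exact HR0|]. intros t1 c M Ht1 HM t Ht.
  destruct (cont_closed_bounded N u t1 (T + 1) c R0 Hu) as (K0 & HK0 & HK1); [lra|lra|].
  set (K := K0 + Rabs M).
  assert (HK : 0 <= K) by (unfold K; pose proof (Rabs_pos M); lra).
  assert (HKu : forall t x, t1 <= t <= T + 1 -> normN (vminus x c) <= R0 -> u t x <= M + K).
  { intros s x Hs Hx. specialize (HK1 s x Hs Hx). unfold K.
    assert (0 <= M + Rabs M) by (unfold Rabs; destruct Rcase_abs; lra). lra. }
  set (d := eta / 2). set (L := K / d). assert (Hd : 0 < d) by (unfold d; lra).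
  assert (HL : 0 <= L) by (apply Rle_mult_inv_pos; lra).
  (* The threshold where [B y1^(-m) = K + B]: from there to the sphere the barrier exceeds the bound
     [M + K] on [u]. *)
  set (y1 := Rpower (K / B + 1) (- / m)).
  assert (HKB : 0 <= K / B) by (apply Rle_mult_inv_pos; lra).
  assert (Hy1 : 0 < y1) by apply Rpower_pos.
  assert (Hy11 : y1 <= 1).
  { unfold y1. rewrite Rpower_Ropp. rewrite <- Rinv_1. apply Rinv_le_contravar; [lra|].
    apply Rpower_ge_1; [lra|]. left; now apply Rinv_0_lt_compat. }
  assert (Ey1 : Rpower y1 (- m) = K / B + 1).
  { unfold y1. rewrite Rpower_mult. replace (- / m * - m) with 1 by (field; lra). apply Rpower_1; lra. }
  (* The corrector is at most [d] up to time [T] and at least [d (1 + L) = d + K] at time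
     [T + 1]. *)
  set (e := fun t => M + d * exp (- (L * T) + L * t)).
  set (f := fun t => B + B * t).
  (* The constant 1, serving both as inner offset and as inner amplitude of [bar]. *)
  set (E := fun t : R => 1 + 0 * t).
  set (rho := fun z => 0 + - / R0 ^ n * z).
  set (Psi := pw (- m) y1).
  set (psi := bar c j e f E E rho Psi).
  assert (HRn : 0 < R0 ^ n) by now apply pow_lt.
  assert (HRi : 0 < / R0 ^ n) by now apply Rinv_0_lt_compat.
  assert (Cr : C2R rho) by apply C2R_linear.
  assert (CP : C2R Psi) by now apply C2R_pw.
  assert (Ce : C2R e) by apply C2R_affine, C2R_exp.
  assert (Cf : C2R f) by apply C2R_linear.
  assert (CE : C2R E) by apply C2R_linear.
  destruct (bar_admissible N p c j e f E E rho Psi) as (Dt & Dx & HA); try assumption.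
  { intros s Hs. unfold f. assert (0 < B * s) by (apply Rmult_lt_0_compat; lra). lra. }
  { intros s Hs. unfold E. lra. }
  { apply (C2R_derivative_neq0 rho (fun _ => - / R0 ^ n) (fun y => 0 <= y)); [|intros; lra].
    intros y. eapply dl_eq; [apply (dl_plus (fun _ => 0)); [apply dl_const|apply dl_scal, dl_id]|ring]. }
  { intros y l. apply (C2R_derivative_neq0 Psi (pw1 (- m) y1) (fun _ => True)); [|intros|exact I].
    - intros; now apply dl_pw.
    - apply Rlt_not_eq, pw1_neg; lra. }
  assert (Epsi : forall t x, psi t x = e t + f t * Psi (1 + - / R0 ^ n * normN (vminus x c) ^ n)).
  { intros s x. unfold psi, bar, E, rho. rewrite <- Ek, normN_pow_even. do 3 f_equal. ring. }
  assert (Hexp : forall s, 0 < d * exp (- (L * T) + L * s)).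
  { intros s. apply Rmult_lt_0_compat; [lra|apply exp_pos]. }
  assert (HPsi : forall y, 0 < Psi y) by (intros; apply pw_pos; lra).
  assert (Hf : forall s, 0 <= s -> B <= f s).
  { intros s Hs. unfold f. assert (0 <= B * s) by (apply Rmult_le_pos; lra). lra. }
  assert (Hbig : forall s x, 0 <= s -> 1 + - / R0 ^ n * normN (vminus x c) ^ n <= y1 -> M + K < psi s x).
  { intros s x Hs Hle. rewrite Epsi. unfold e. specialize (Hexp s).
    apply (pw_decr (- m) y1) in Hle; [|lra|lra]. rewrite pw_right, Ey1 in Hle by lra. fold Psi in Hle.
    specialize (Hf s Hs). 
    assert (B * (K / B + 1) <= f s * Psi (1 + - / R0 ^ n * normN (vminus x c) ^ n)).
    { apply Rmult_le_compat; lra. }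
    replace (B * (K / B + 1)) with (K + B) in H by (field; lra). lra. }
  assert (Hlt : forall s x, t1 <= s <= T + 1 -> normN (vminus x c) <= R0 -> u s x - psi s x < 0).
  { apply interior_max; try lra.
    - apply cont_closed_minus; [exact Hu|]. intros; now apply bar_cont.
    - intros x Hx. rewrite Epsi. unfold e. specialize (HM x Hx). specialize (Hexp t1).
      specialize (Hf t1 ltac:(lra)).
      assert (0 < f t1 * Psi (1 + - / R0 ^ n * normN (vminus x c) ^ n)) by (apply Rmult_lt_0_compat; [lra|apply HPsi]).
      lra.
    - intros x Hx. rewrite Epsi. unfold e. specialize (HKu (T + 1) x ltac:(lra) Hx).
      specialize (Hf (T + 1) ltac:(lra)).
      assert (0 < f (T + 1) * Psi (1 + - / R0 ^ n * normN (vminus x c) ^ n)) by (apply Rmult_lt_0_compat; [lra|apply HPsi]).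
      replace (- (L * T) + L * (T + 1)) with L by ring.
      assert (d * (1 + L) <= d * exp L).
      { apply Rmult_le_compat_l; [lra|]. destruct (Req_dec L 0) as [->|]; [rewrite exp_0; lra|left; now apply exp_ineq1]. }
      replace (d * (1 + L)) with (d + K) in H0 by (unfold L; field; lra). lra.
    - intros s x Hs Hx. specialize (HKu s x Hs ltac:(lra)).
      assert (M + K < psi s x); [|lra]. apply Hbig; [lra|]. rewrite Hx, <- Ropp_mult_distr_l, Rinv_l; lra.
    - intros s x Hs Hs' Hx Hge Hmax.
      destruct (Hsub psi Dt Dx HA s x Hs Hmax) as [V1 V2].
      destruct HA as [HC2 _].
      set (r := normN (vminus x c)) in *.
      set (y := 1 + - / R0 ^ n * r ^ n) in *.
      assert (HDt : Dt s x = d * (exp (- (L * T) + L * s) * L) + B * Psi y).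
      { apply (time_derivative N psi Dt Dx); [exact HC2|exact Hs|].
        apply dl_local with (f := fun t => e t + (B + B * t) * Psi y) (d := 1); [lra| |].
        - intros z _. symmetry; apply Epsi.
        - apply dl_plus; [apply dl_affine, derivable_pt_lim_exp|].
          apply dl_eq with ((0 + B * 1) * Psi y + (B + B * s) * 0); [|ring].
          apply (dl_mult (fun t => B + B * t) (fun _ => Psi y)); [|apply dl_const].
          apply (dl_plus (fun _ => B)); [apply dl_const|apply dl_scal, dl_id]. }
      assert (HDt0 : B * Psi y <= Dt s x).
      { rewrite HDt. assert (0 <= d * (exp (- (L * T) + L * s) * L)); [|lra].
        apply Rmult_le_pos; [lra|]. apply Rmult_le_pos; [left; apply exp_pos|exact HL]. }
      assert (HBP : 0 < B * Psi y) by (apply Rmult_lt_0_compat; auto).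
      assert (Hr0 : 0 <= r) by apply normN_nonneg.
      destruct Hr0 as [Hr0|Hr0].
      (* Contact at the centre would force [Dt <= 0], against [HBP] and [HDt0]. *)
      2:{ assert (x = c).
          { extensionality i. assert (Hz := normN_eq0 N (vminus x c) i (eq_sym Hr0)). unfold vminus in Hz; lra. }
          subst x. specialize (V2 (bar_center N c j e f E E rho Psi Dt Dx s HC2 Cr CP Hs)). lra. }
      (* Contact only happens where [Psi] is the genuine power, not its continuation. *)
      assert (Hy : y1 < y).
      { apply Rnot_le_lt; intros Hle. specialize (Hbig s x ltac:(lra) Hle). specialize (HKu s x ltac:(lra) ltac:(fold r; lra)). lra. }
      set (g := fun r => - / R0 ^ n * (INR n * r ^ S k)).
      set (W1 := fun r => f s * (pw1 (- m) y1 (1 + - / R0 ^ n * r ^ n) * g r)).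
      set (W2 := f s * (- m * (- m - 1) * Rpower y (- m - 2) * g r * g r
             + - m * Rpower y (- m - 1) * (- / R0 ^ n * (INR n * ((INR n - 1) * r ^ k))))).
      assert (Dy : forall r, derivable_pt_lim (fun r => 1 + - / R0 ^ n * r ^ n) r (g r)).
      { intros z. eapply dl_eq; [apply (dl_plus (fun _ => 1)); [apply dl_const|apply dl_scal, dl_pow]|].
        unfold g, n; simpl pred; ring. }
      assert (EW1 : W1 r = f s * (- m * Rpower y (- m - 1) * g r)).
      { unfold W1. fold y. rewrite pw1_right by lra. reflexivity. }
      destruct (blowup_estimate p m (f s) R0 r (INR N) k) as [Hpos Hest]; auto; try lra.
      { specialize (Hf s ltac:(lra)); lra. }
      { fold n. rewrite En. exact Hj. }
      { fold n. fold y. lra. }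
      fold n in Hpos, Hest. fold y in Hpos, Hest. fold (g r) in Hpos, Hest. fold W2 in Hest.
      rewrite <- EW1 in Hpos, Hest.
      destruct (plap_radial N p psi Dt Dx s x c (fun r => e s + f s * Psi (1 + - / R0 ^ n * r ^ n)) W1 W2 1)
        as [Hg Hpl]; try assumption; try lra.
      { intros; apply Epsi. }
      { intros z _. unfold W1. eapply dl_eq.
        - apply (dl_plus (fun _ => e s)); [apply dl_const|]. apply dl_scal.
          apply (dl_comp (fun r => 1 + - / R0 ^ n * r ^ n) Psi); [apply Dy|now apply dl_pw].
        - ring. }
      { fold r. unfold W1. eapply dl_eq.
        - apply dl_scal, dl_mult.
          + apply (dl_comp (fun r => 1 + - / R0 ^ n * r ^ n) (pw1 (- m) y1)); [apply Dy|now apply dl_pw1].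
          + unfold g. apply dl_scal, dl_scal, dl_pow.
        - cbv beta. fold y. rewrite pw1_right, pw2_right by lra. unfold W2.
          change (pred (S k)) with k. replace (INR n - 1) with (INR (S k)) by (unfold n; rewrite (S_INR (S k)); ring).
          ring. }
      { fold r. lra. }
      fold r in Hg, Hpl.
      assert (Hgn : normN (grad Dx s x) <> 0) by (rewrite Hg, Rabs_pos_eq; lra).
      specialize (V1 Hgn _ Hpl).
      (* For an upper bound the absorption has the good sign and is discarded. *)
      assert (HRq : 0 < Rpower (normN (grad Dx s x)) q) by apply Rpower_pos.
      assert (EPsi : Psi y = Rpower y (- m)) by (apply pw_right; lra).
      rewrite ER0 in Hest. fold C1 in Hest.
      assert (Hlast : C1 * Rpower (m * INR n) (p - 1) * Rpower (f s) (p - 1) * Rpower y (- m) * / (Q + 1) < B * Psi y).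
      { rewrite EPsi. pose proof (Rpower_pos y (- m)) as HP0.
        apply Rle_lt_trans with (Q * B * Rpower y (- m) * / (Q + 1)).
        - apply Rmult_le_compat_r; [left; apply Rinv_0_lt_compat; lra|].
          apply Rmult_le_compat_r; [lra|].
          replace (Q * B) with (C1 * Rpower (m * INR n) (p - 1) * Rpower (B * (2 + T)) (p - 1)) by (unfold Q; field; lra).
          apply Rmult_le_compat_l; [apply Rmult_le_pos; [lra|left; apply Rpower_pos]|].
          apply Rle_Rpower_l; [lra|]. specialize (Hf s ltac:(lra)). split; [lra|]. unfold f.
          rewrite <- (Rmult_1_r B) at 1. rewrite <- Rmult_plus_distr_l. apply Rmult_le_compat_l; lra.
        - replace (Q * B * Rpower y (- m) * / (Q + 1)) with (B * Rpower y (- m) * (Q * / (Q + 1))) by ring.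
          rewrite <- (Rmult_1_r (B * Rpower y (- m))) at 2. apply Rmult_lt_compat_l; [apply Rmult_lt_0_compat; lra|].
          apply Rmult_lt_reg_r with (Q + 1); [lra|]. rewrite Rmult_assoc, Rinv_l; lra. }
      lra. }
  specialize (Hlt t c ltac:(lra) ltac:(rewrite normN_refl; lra)).
  rewrite Epsi, normN_refl in Hlt.
  replace (1 + - / R0 ^ n * 0 ^ n) with 1 in Hlt by (unfold n; simpl pow; ring).
  unfold Psi in Hlt. rewrite pw_right in Hlt by lra. unfold Rpower in Hlt.
  rewrite ln_1, Rmult_0_r, exp_0 in Hlt. unfold e, f in Hlt.
  assert (exp (- (L * T) + L * t) <= 1).
  { rewrite <- exp_0. assert (- (L * T) + L * t <= 0) by nra.
    destruct H as [H| ->]; [left; now apply exp_increasing|lra]. }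
  assert (d * exp (- (L * T) + L * t) <= d) by nra.
  assert (B + B * t <= eta / 2).
  { apply Rle_trans with (B * (1 + T)); [|unfold B; right; field; lra]. nra. }
  unfold d in *. lra.
Qed.

(** * Extinction *)

Lemma Rpower_pred y a : 0 < y -> Rpower y (a - 1) = Rpower y a / y.
Proof.
  intros Hy. unfold Rdiv. rewrite <- (Rpower_1 y) at 3 by exact Hy.
  rewrite <- Rpower_Ropp, <- Rpower_plus. reflexivity.
Qed.

Lemma Rpower_decr y z a : 0 < y <= z -> 0 <= a -> Rpower z (- a) <= Rpower y (- a).
Proof.
  intros H Ha. rewrite !Rpower_Ropp. apply Rinv_le_contravar; [apply Rpower_pos|].
  now apply Rle_Rpower_l.
Qed.

(* With [D = T - t], the profile [Y = b D^(-nu) + kappa D^(-1/q) |x|] makes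
   the time derivative, the gradient term and the p-Laplacian of [Y^(-k)] all comparable to [Y^(-k) / D]. *)
Lemma extinction_estimate p q k nu s kappa b D z r M :
  1 < p < 2 -> 0 < q < p / 2 -> k = q / (1 - q) ->
  nu = (p - q) * (1 - q) / (q * (p - 2 * q)) -> s = (p - 2 * q) / (1 - q) ->
  0 < kappa -> 0 < b -> 0 < D -> 0 <= z -> 0 < r -> 1 <= M ->
  Rpower (k * kappa) q = k * (nu + / q) + 1 ->
  (k + 1) * Rpower k (p - 1) * Rpower kappa p * Rpower b (- s) < 1 ->
  let E := b * Rpower D (- nu) in
  let a := kappa * Rpower D (- / q) in
  let Y := E + a * z in
  let W1 := - k * Rpower Y (- k - 1) * a in
  let W2 := - k * (- k - 1) * Rpower Y (- k - 2) * a * a in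
  Rpower (Rabs W1) (p - 2) * ((p - 1) * W2 + (M - 1) * (W1 / r)) - Rpower (Rabs W1) q <
  - k * Rpower Y (- k - 1) * (nu * E / D + / q * a / D * z).
Proof.
  intros Hp Hq Ek Enu Es Hkap Hb HD Hz Hr HM Hkq Hbs E a Y W1 W2.
  assert (Hk : 0 < k) by (subst k; apply Rdiv_lt_0_compat; lra).
  assert (Hnu : 0 < nu).
  { subst nu. apply Rdiv_lt_0_compat; apply Rmult_lt_0_compat; lra. }
  assert (Hs : 0 < s) by (subst s; apply Rdiv_lt_0_compat; lra).
  assert (Hqi : 0 < / q) by (apply Rinv_0_lt_compat; lra).
  assert (HE : 0 < E) by (apply Rmult_lt_0_compat; [lra|apply Rpower_pos]).
  assert (Ha : 0 < a) by (apply Rmult_lt_0_compat; [lra|apply Rpower_pos]).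
  assert (Haz : 0 <= a * z) by (apply Rmult_le_pos; lra).
  assert (HY : E <= Y) by (unfold Y; lra). assert (HY0 : 0 < Y) by lra.
  set (P := Rpower Y (- k)). assert (HP : 0 < P) by apply Rpower_pos.
  assert (EP1 : Rpower Y (- k - 1) = P / Y) by (apply Rpower_pred; lra).
  assert (EP2 : Rpower Y (- k - 2) = P / Y / Y).
  { replace (- k - 2) with (- k - 1 - 1) by ring. rewrite Rpower_pred, EP1; lra. }
  set (G := k * a * P / Y).
  assert (HG : 0 < G) by (apply Rdiv_lt_0_compat; [apply Rmult_lt_0_compat; [apply Rmult_lt_0_compat|]|]; lra).
  assert (EW1 : W1 = - G) by (unfold W1, G; rewrite EP1; field; lra).
  assert (EW2 : W2 = G * ((k + 1) * a / Y)) by (unfold W2, G; rewrite EP2; field; lra).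
  rewrite EW1, Rabs_Ropp, Rabs_pos_eq by lra.
  assert (HW2 : 0 <= W2).
  { rewrite EW2. apply Rmult_le_pos; [lra|]. apply Rle_mult_inv_pos; [apply Rmult_le_pos; lra|lra]. }
  (* The profile is radially decreasing, so the term in [1 / r] is nonpositive whatever [r > 0] is;
     and [p - 1 < 1] while [W2 >= 0]. *)
  assert (HB : (p - 1) * W2 + (M - 1) * (- G / r) <= W2).
  { assert (0 <= (M - 1) * (G / r)).
    { apply Rmult_le_pos; [lra|]. apply Rle_mult_inv_pos; lra. }
    replace (- G / r) with (- (G / r)) by (unfold Rdiv; ring).
    assert (0 <= (2 - p) * W2) by (apply Rmult_le_pos; lra). lra. }
  (* Since [(k + 1) q = k] and [a^q = kappa^q / D], the gradient term is an exact multiple of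
     [Y^(-k) / D]. *)
  assert (EZ : Rpower G q = Rpower (k * kappa) q * (P / D)).
  { unfold G, P, a.
    replace (Rpower Y (- k)) with (Rpower Y (- (q / (1 - q)))) by (now rewrite Ek). clear - Hp Hk Hkap HD HY0 Hq. clearbody Y.
    pose proof (exp_ln k Hk) as E1. pose proof (exp_ln kappa Hkap) as E2.
    pose proof (exp_ln D HD) as E3. pose proof (exp_ln Y HY0) as E4.
    set (lk := ln k) in *; set (lp := ln kappa) in *; set (lD := ln D) in *; set (lY := ln Y) in *.
    clearbody lk lp lD lY. rewrite <- E1, <- E2, <- E3, <- E4.
    exp_simpl. f_equal. field. repeat split; lra. }
  (* The surplus [Y^(-s)] arises from [k (p - 2) + p = s]. *)
  assert (EX : Rpower G (p - 2) * W2 =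
      (k + 1) * (Rpower k (p - 1) * Rpower kappa p * (Rpower D (- (p / q)) * (P * Rpower Y (- s))))).
  { rewrite EW2. replace (Rpower G (p - 2) * (G * ((k + 1) * a / Y))) with ((k + 1) * (Rpower G (p - 2) * G * a / Y)) by (field; lra).
    f_equal. unfold G, P, a.
    replace (Rpower Y (- k)) with (Rpower Y (- (q / (1 - q)))) by (now rewrite Ek). clear - Hp Hk Hkap HD HY0 Es Hq. clearbody Y.
    pose proof (exp_ln k Hk) as E1. pose proof (exp_ln kappa Hkap) as E2.
    pose proof (exp_ln D HD) as E3. pose proof (exp_ln Y HY0) as E4.
    set (lk := ln k) in *; set (lp := ln kappa) in *; set (lD := ln D) in *; set (lY := ln Y) in *.
    clearbody lk lp lD lY. rewrite <- E1, <- E2, <- E3, <- E4.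
    exp_simpl. f_equal. rewrite Es. field. repeat split; lra. }
  assert (HYs : Rpower Y (- s) <= Rpower E (- s)) by (apply Rpower_decr; lra).
  (* The exponent [nu] is fixed by [nu s = p / q - 1], which leaves exactly [1 / D]. *)
  assert (EE : Rpower D (- (p / q)) * Rpower E (- s) = Rpower b (- s) / D).
  { unfold E. clear - Hp Hb HD Enu Es Hq.
    pose proof (exp_ln b Hb) as E1. pose proof (exp_ln D HD) as E2.
    set (lb := ln b) in *; set (lD := ln D) in *. clearbody lb lD. rewrite <- E1, <- E2.
    exp_simpl. f_equal. rewrite Enu, Es. field. repeat split; lra. }
  set (Z := P / D). assert (HZ : 0 < Z) by (apply Rdiv_lt_0_compat; lra).
  assert (HX : Rpower G (p - 2) * W2 < Z).
  { rewrite EX. apply Rle_lt_trans with ((k + 1) * (Rpower k (p - 1) * Rpower kappa p * (Rpower D (- (p / q)) * (P * Rpower E (- s))))).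
    - apply Rmult_le_compat_l; [lra|].
      apply Rmult_le_compat_l; [apply Rmult_le_pos; left; apply Rpower_pos|].
      apply Rmult_le_compat_l; [left; apply Rpower_pos|]. apply Rmult_le_compat_l; lra.
    - replace (Rpower D (- (p / q)) * (P * Rpower E (- s))) with (P * (Rpower D (- (p / q)) * Rpower E (- s))) by ring.
      rewrite EE. unfold Z.
      replace ((k + 1) * (Rpower k (p - 1) * Rpower kappa p * (P * (Rpower b (- s) / D))))
        with ((k + 1) * Rpower k (p - 1) * Rpower kappa p * Rpower b (- s) * (P / D)) by (field; lra).
      fold Z. rewrite <- (Rmult_1_l Z) at 2. now apply Rmult_lt_compat_r. }
  (* Each of [E] and [a z] is at most [Y], so their weighted sum is at most [(nu + 1/q) Y]. *)
  assert (HT : - (k * (nu + / q) * Z) <= - k * Rpower Y (- k - 1) * (nu * E / D + / q * a / D * z)).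
  { rewrite EP1. unfold Z.
    replace (- k * (P / Y) * (nu * E / D + / q * a / D * z))
      with (- (k * ((nu * E + / q * (a * z)) / Y) * (P / D))) by (field; lra).
    apply Ropp_le_contravar. apply Rmult_le_compat_r; [unfold Z in HZ; lra|].
    apply Rmult_le_compat_l; [lra|]. apply Rmult_le_reg_r with Y; [lra|].
    unfold Rdiv. rewrite Rmult_assoc, Rinv_l, Rmult_1_r by lra. unfold Y.
    assert (0 <= nu * (a * z)) by (apply Rmult_le_pos; lra).
    assert (0 <= / q * E) by (apply Rmult_le_pos; lra). lra. }
  rewrite EZ, Hkq. fold Z.
  assert (H : Rpower G (p - 2) * ((p - 1) * W2 + (M - 1) * (- G / r)) <= Rpower G (p - 2) * W2).
  { apply Rmult_le_compat_l; [left; apply Rpower_pos|exact HB]. }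
  lra.
Qed.

Lemma Rpower_root y a : 0 < y -> a <> 0 -> Rpower (Rpower y (/ a)) a = y.
Proof. intros Hy Ha. rewrite Rpower_mult, Rinv_l, Rpower_1; auto. Qed.

Lemma Rpower_neg_small s z : 0 < s -> 0 < z ->
  exists T0, 0 < T0 /\ forall T, T0 <= T -> Rpower T (- s) <= z.
Proof.
  intros Hs Hz. exists (Rpower z (/ - s)). split; [apply Rpower_pos|]. intros T HT.
  rewrite <- (Rpower_root z (- s)) by lra.
  apply Rpower_decr; [|lra]. split; [apply Rpower_pos|exact HT].
Qed.

(** The bound is the value of the self-similar profile at the origin, where it is largest. The decay
    hypothesis closes the comparison on a large sphere. *)
Lemma extinction N p q C0 (u : R -> RN (S N) -> R) :
  1 < p < 2 -> 0 < q < p / 2 -> cont_closed u -> visc_sub p q u ->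
  (forall T eta, 0 <= T -> 0 < eta -> exists R, 0 < R /\
     forall t x, 0 <= t <= T -> R <= normN x -> u t x <= eta) ->
  0 < C0 -> (forall x, u 0 x <= C0 * Rpower (1 + normN x) (- (q / (1 - q)))) ->
  exists T b nu k, 0 < T /\ 0 < b /\ 0 < nu /\ 0 < k /\
    forall t x, 0 <= t < T -> u t x <= Rpower (b * Rpower (T - t) (- nu)) (- k).
Proof.
  intros Hp Hq Hu Hsub Hdec HC0 Hini.
  set (k := q / (1 - q)) in *.
  set (nu := (p - q) * (1 - q) / (q * (p - 2 * q))).
  set (s := (p - 2 * q) / (1 - q)).
  assert (Hk : 0 < k) by (apply Rdiv_lt_0_compat; lra).
  assert (Hnu : 0 < nu) by (apply Rdiv_lt_0_compat; apply Rmult_lt_0_compat; lra).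
  assert (Hs : 0 < s) by (apply Rdiv_lt_0_compat; lra).
  assert (Hqi : 0 < / q) by (apply Rinv_0_lt_compat; lra).
  (* Makes the gradient term exceed the time derivative by one full unit of [Y^(-k) / D]; this
     surplus pays for the diffusion. *)
  set (kappa := Rpower (k * (nu + / q) + 1) (/ q) / k).
  assert (Hkc : 0 < k * (nu + / q)) by (apply Rmult_lt_0_compat; lra).
  assert (Hkap : 0 < kappa) by (apply Rdiv_lt_0_compat; [apply Rpower_pos|lra]).
  assert (Ekap : Rpower (k * kappa) q = k * (nu + / q) + 1).
  { unfold kappa. replace (k * (Rpower (k * (nu + / q) + 1) (/ q) / k)) with (Rpower (k * (nu + / q) + 1) (/ q)) by (field; lra).
    apply Rpower_root; lra. }
  set (C := (k + 1) * Rpower k (p - 1) * Rpower kappa p).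
  assert (HC : 0 < C).
  { unfold C. apply Rmult_lt_0_compat; [|apply Rpower_pos]. apply Rmult_lt_0_compat; [lra|apply Rpower_pos]. }
  (* Here [b^(-s) = 1 / (C + 1)], so the diffusion costs less than that unit. *)
  set (b := Rpower (C + 1) (/ s)). assert (Hb : 0 < b) by apply Rpower_pos.
  assert (Eb : C * Rpower b (- s) < 1).
  { rewrite Rpower_Ropp. unfold b. rewrite Rpower_root by lra.
    apply Rmult_lt_reg_r with (C + 1); [lra|]. rewrite Rmult_assoc, Rinv_l; lra. }
  (* The initial bound reads [(c0 (1 + |x|))^(-k)]; it suffices that both coefficients of [Y] at
     time 0 are at most [c0], which a large [T] ensures. *)
  set (c0 := Rpower C0 (/ - k)). assert (Hc0 : 0 < c0) by apply Rpower_pos.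
  assert (Ec0 : Rpower c0 (- k) = C0) by (apply Rpower_root; lra).
  destruct (Rpower_neg_small nu (c0 / b)) as (Ta & HTa & HTa'); [lra|now apply Rdiv_lt_0_compat|].
  destruct (Rpower_neg_small (/ q) (c0 / kappa)) as (Tb & HTb & HTb'); [lra|now apply Rdiv_lt_0_compat|].
  set (T := Rmax Ta Tb).
  assert (HT : 0 < T) by (unfold T; pose proof (Rmax_l Ta Tb); lra).
  assert (I1 : b * Rpower T (- nu) <= c0).
  { replace c0 with (b * (c0 / b)) by (field; lra). apply Rmult_le_compat_l; [lra|]. apply HTa', Rmax_l. }
  assert (I2 : kappa * Rpower T (- / q) <= c0).
  { replace c0 with (kappa * (c0 / kappa)) by (field; lra). apply Rmult_le_compat_l; [lra|]. apply HTb', Rmax_r. }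
  exists T, b, nu, k. repeat (split; [assumption|]). intros t xt Ht.
  apply Rle_plus_epsilon. intros eps Heps. set (ep := eps / 2). assert (Hep : 0 < ep) by (unfold ep; lra).
  (* Stopping before [T] keeps the powers of [T - t] away from their singularity; [tau] is the
     threshold of their continuation. *)
  set (T' := (t + T) / 2). set (tau := T - T').
  assert (HT' : t < T' < T) by (unfold T'; lra). assert (Htau : 0 < tau) by (unfold tau; lra).
  destruct (exists_flat_order p) as (j & Hj2 & Hj); [lra|].
  assert (Hkj : exists i, (2 * j)%nat = S (S i)) by (exists (2 * j - 2)%nat; lia).
  destruct Hkj as [i Ei]. set (n := S (S i)) in *.
  assert (Hn2 : 2 <= INR n) by (unfold n; rewrite !S_INR; pose proof (pos_INR i); lra).
  assert (Hni : 0 < / INR n < 1).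
  { split; [apply Rinv_0_lt_compat; lra|]. rewrite <- Rinv_1. apply Rinv_lt_contravar; lra. }
  set (o := fun _ : Fin.t (S N) => 0).
  destruct (Hdec T' ep) as (R1 & HR1 & Hfar); [lra|lra|].
  set (R0 := Rmax R1 (normN xt)).
  assert (HR0 : 0 < R0) by (unfold R0; pose proof (Rmax_l R1 (normN xt)); lra).
  destruct (cont_closed_bounded _ u 0 T' o R0 Hu) as (K & HK & HKu); [lra|lra|].
  (* The corrector equals [ep] at time [t], so [e t = eps] there, and is at least [ep + K] at time
     [T']. *)
  set (L := K / (ep * (T' - t))).
  assert (HepT : 0 < ep * (T' - t)) by (apply Rmult_lt_0_compat; lra).
  assert (HL : 0 <= L) by (apply Rle_mult_inv_pos; lra).
  (* Half the least value of [E] on [[0, T']]: the continuation of [Psi] is inactive there. *)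
  set (y1 := b * Rpower T (- nu) / 2).
  assert (Hy1 : 0 < y1).
  { unfold y1. pose proof (Rpower_pos T (- nu)). assert (0 < b * Rpower T (- nu)) by (apply Rmult_lt_0_compat; lra). lra. }
  (* With this threshold, [rho] below sends [|x - x1| ^ n] to [|x - x1| - 1] as soon as
     [|x - x1| >= 1/2], and its derivative never vanishes. *)
  set (z1 := (/ 2) ^ n). assert (Hz1 : 0 < z1) by (apply pow_lt; lra).
  set (e := fun t' => ep + ep * exp (- (L * t) + L * t')).
  set (f := fun t : R => 1 + 0 * t).
  set (E := fun t => 0 + b * pw (- nu) tau (T + - 1 * t)).
  set (a := fun t => 0 + kappa * pw (- / q) tau (T + - 1 * t)).
  set (rho := fun z => - 1 + 1 * pw (/ INR n) z1 (0 + 1 * z)).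
  set (Psi := pw (- k) y1).
  (* The cusped barrier enters the maximum argument only through its continuity; an admissible
     function replaces it at the contact point. *)
  set (w := fun t (x : RN (S N)) => e t + Psi (E t + a t * normN (vminus x o))).
  assert (Cr : C2R rho) by (apply C2R_affine; now apply C2R_pw).
  assert (CP : C2R Psi) by now apply C2R_pw.
  assert (Ce : C2R e) by apply C2R_affine, C2R_exp.
  assert (Cf : C2R f) by apply C2R_linear.
  assert (CE : C2R E) by (apply C2R_affine; now apply C2R_pw).
  assert (Ca : C2R a) by (apply C2R_affine; now apply C2R_pw).
  assert (Hexp : forall s, 0 < ep * exp (- (L * t) + L * s)).
  { intros r. apply Rmult_lt_0_compat; [lra|apply exp_pos]. }
  assert (HPsi : forall y, 0 < Psi y) by (intros; apply pw_pos; lra).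
  assert (Hap : forall r, 0 < a r).
  { intros r. unfold a. rewrite Rplus_0_l. apply Rmult_lt_0_compat; [lra|]. apply pw_pos; lra. }
  assert (HE : forall r, r <= T' -> E r = b * Rpower (T - r) (- nu)).
  { intros r Hr. unfold E. rewrite pw_right by (unfold tau; lra). rewrite Rplus_0_l. do 2 f_equal; ring. }
  assert (Ha : forall r, r <= T' -> a r = kappa * Rpower (T - r) (- / q)).
  { intros r Hr. unfold a. rewrite pw_right by (unfold tau; lra). rewrite Rplus_0_l. do 2 f_equal; ring. }
  assert (HEy : forall r, 0 <= r <= T' -> y1 < E r).
  { intros r Hr. rewrite HE by lra. unfold y1.
    assert (Rpower T (- nu) <= Rpower (T - r) (- nu)) by (apply Rpower_decr; lra).
    apply (Rmult_le_compat_l b) in H; [|lra].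
    assert (0 < b * Rpower T (- nu)) by (apply Rmult_lt_0_compat; [lra|apply Rpower_pos]). lra. }
  assert (Hlt : forall r x, 0 <= r <= T' -> normN (vminus x o) <= R0 -> u r x - w r x < 0).
  { apply interior_max; try lra.
    - apply cont_closed_minus; [exact Hu|]. intros r x.
      assert (HCc : forall g y, C2R g -> continuity_pt g y) by (intros g y (g1 & H & _); eapply dl_continuity, H).
      assert (HTc : forall g, C2R g -> contAt (fun s => 0 <= s) (fun s (_ : RN (S N)) => g s) r x).
      { intros g Hg. apply (contAt_comp _ _ g (fun s _ => s)); [apply contAt_time|auto]. }
      apply contAt_plus; [auto|]. apply (contAt_comp _ _ Psi); [|auto].
      apply contAt_plus; [auto|]. apply contAt_mult; [auto|apply contAt_norm].
    - intros x Hx. unfold w, e. specialize (Hini x). specialize (Hexp 0).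
      rewrite HE, Ha, Rminus_0_r by lra. unfold o. rewrite normN_vminus0.
      pose proof (normN_nonneg _ x) as Hnx.
      assert (Hle : b * Rpower T (- nu) + kappa * Rpower T (- / q) * normN x <= c0 * (1 + normN x)).
      { apply (Rmult_le_compat_r (normN x)) in I2; lra. }
      apply (pw_decr (- k) y1) in Hle; [|lra|lra]. fold Psi in Hle.
      rewrite <- Ec0, Rpower_mult_distr in Hini by lra.
      assert (Hy : y1 <= c0 * (1 + normN x)).
      { assert (0 <= c0 * normN x) by (apply Rmult_le_pos; lra). 
        assert (0 < b * Rpower T (- nu)) by (apply Rmult_lt_0_compat; [lra|apply Rpower_pos]). unfold y1; lra. }
      rewrite <- (pw_right (- k) y1) in Hini by exact Hy. fold Psi in Hini. lra.
    - intros x Hx. unfold w, e. specialize (HKu T' x ltac:(lra) Hx).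
      specialize (HPsi (E T' + a T' * normN (vminus x o))).
      replace (- (L * t) + L * T') with (L * (T' - t)) by ring.
      assert (HLe : 0 <= L * (T' - t)) by (apply Rmult_le_pos; lra).
      assert (H1 : ep * (1 + L * (T' - t)) <= ep * exp (L * (T' - t))).
      { apply Rmult_le_compat_l; [lra|].
        destruct (Req_dec (L * (T' - t)) 0) as [H0|H0]; [rewrite H0, exp_0; lra|left; now apply exp_ineq1]. }
      replace (ep * (1 + L * (T' - t))) with (ep + K) in H1 by (unfold L; field; lra). lra.
    - intros r x Hr Hx. unfold w, e. unfold o in Hx; rewrite normN_vminus0 in Hx. fold o in Hx.
      assert (u r x <= ep) by (apply Hfar; [lra|rewrite Hx; apply Rmax_l]).
      specialize (Hexp r). specialize (HPsi (E r + a r * normN (vminus x o))). lra.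
    - intros r x0 Hr Hr' Hx0 Hge (dl & Hdl & Hmax).
      unfold o in Hx0; rewrite normN_vminus0 in Hx0.
      destruct (polar_decomposition N x0) as (v & Hv & Exv).
      (* The origin lies on the segment from [x1] to [x0], whence equality in the triangle
         inequality at [x0]. As [|x0 - x1| = Z + 1 >= 1], the gradient of the test function does not
         vanish at contact, even when [x0] is the origin. *)
      set (x1 := fun i => - v i).
      set (Z := normN x0) in *. assert (HZ : 0 <= Z) by apply normN_nonneg.
      assert (Hr0 : normN (vminus x0 x1) = Z + 1).
      { replace (vminus x0 x1) with (fun i => (Z + 1) * v i).
        - rewrite normN_scal, Hv, Rabs_pos_eq; lra.
        - extensionality m. unfold vminus, x1. rewrite (Exv m). ring. }
      (* The cusp of the barrier at the origin is avoided by replacing [|x|] with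
         [|x - x1| - 1 <= |x|], where [|x1| = 1]; both sides agree at the contact point. *)
      assert (Htri : forall x, normN (vminus x x1) - 1 <= normN x).
      { intros x. pose proof (normN_triangle _ x o x1) as H. unfold o in H at 1.
        rewrite normN_vminus0 in H.
        replace (vminus o x1) with v in H by (extensionality m; unfold vminus, o, x1; ring). lra. }
      set (psi := bar x1 j e f E a rho Psi).
      assert (Hrho : forall y, / 2 <= y -> rho (y ^ n) = y - 1).
      { intros y Hy. unfold rho. rewrite pw_right.
        - rewrite Rplus_0_l, !Rmult_1_l, <- Rpower_pow, Rpower_mult, Rinv_r, Rpower_1 by lra. ring.
        - rewrite Rplus_0_l, Rmult_1_l. apply pow_incr; lra. }
      assert (Epsi : forall r x, normN (vminus x x0) < / 2 ->
        psi r x = e r + Psi (E r + a r * (normN (vminus x x1) - 1))).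
      { intros r' x Hx. unfold psi, bar, f. rewrite <- normN_pow_even, Ei. rewrite Hrho.
        - ring.
        - pose proof (normN_triangle _ x0 x x1) as H. rewrite (normN_sym _ x0 x) in H. lra. }
      assert (Hx00 : normN (vminus x0 x0) < / 2) by (rewrite normN_refl; lra).
      assert (Hmax' : loc_max (fun t x => u t x - psi t x) r x0).
      { exists (Rmin dl (/ 2)). split; [apply Rmin_glb_lt; lra|]. intros r' x Hrp Hrd Hxd.
        apply Rmin_Rgt_l in Hrd as [Hrd _]. apply Rmin_Rgt_l in Hxd as [Hxd Hxd'].
        specialize (Hmax r' x Hrp Hrd Hxd). unfold w in Hmax. unfold o in Hmax. rewrite !normN_vminus0 in Hmax. fold o in Hmax.
        rewrite !Epsi by (try exact Hxd'; exact Hx00). rewrite Hr0.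
        replace (Z + 1 - 1) with Z by ring. fold Z in Hmax.
        assert (Psi (E r' + a r' * normN x) <= Psi (E r' + a r' * (normN (vminus x x1) - 1))); [|lra].
        apply pw_decr; [lra|lra|]. apply Rplus_le_compat_l, Rmult_le_compat_l; [left; apply Hap|apply Htri]. }
      destruct (bar_admissible (S N) p x1 j e f E a rho Psi) as (Dt & Dx & HA); try assumption.
      { intros y Hy; unfold f; lra. }
      { intros y Hy. specialize (Hap y). lra. }
      { apply (C2R_derivative_neq0 rho (fun z => 1 * (pw1 (/ INR n) z1 (0 + 1 * z) * 1)) (fun y => 0 <= y)).
        - intros y. apply dl_affine. now apply dl_pw.
        - intros y _. pose proof (pw1_pos (/ INR n) z1 (0 + 1 * y) Hz1 Hni). lra. }
      { intros y l. apply (C2R_derivative_neq0 Psi (pw1 (- k) y1) (fun _ => True)); [|intros|exact I].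
        - intros; now apply dl_pw.
        - apply Rlt_not_eq, pw1_neg; lra. }
      destruct (Hsub psi Dt Dx HA r x0 Hr Hmax') as [V _]. destruct HA as [HC2 _].
      set (Y := E r + a r * Z).
      assert (HyY : y1 < Y).
      { unfold Y. specialize (HEy r ltac:(lra)). specialize (Hap r).
        assert (0 <= a r * Z) by (apply Rmult_le_pos; lra). lra. }
      set (D := T - r). assert (HD : tau < D) by (unfold D, tau; lra).
      assert (HDt : Dt r x0 = ep * (exp (- (L * t) + L * r) * L)
         + - k * Rpower Y (- k - 1) * (nu * E r / D + / q * a r / D * Z)).
      { apply (time_derivative (S N) psi Dt Dx); [exact HC2|exact Hr|].
        apply dl_local with (f := fun t => e t + Psi (E t + a t * Z)) (d := 1); [lra| |].
        - intros y _. rewrite Epsi by exact Hx00. rewrite Hr0. do 4 f_equal. ring.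
        - apply dl_plus; [apply dl_affine, derivable_pt_lim_exp|].
          apply dl_eq with (pw1 (- k) y1 Y *
            (b * (pw1 (- nu) tau (T + - 1 * r) * - 1) + (kappa * (pw1 (- / q) tau (T + - 1 * r) * - 1) * Z + a r * 0))).
          + apply (dl_comp (fun t => E t + a t * Z) Psi); [|now apply dl_pw].
            apply dl_plus; [apply dl_affine; now apply dl_pw|].
            apply (dl_mult a (fun _ => Z)); [apply dl_affine; now apply dl_pw|apply dl_const].
          + rewrite !pw1_right by (unfold D in HD; lra).
            replace (T + - 1 * r) with D by (unfold D; ring).
            rewrite HE, Ha by lra. fold D. rewrite !(Rpower_pred D) by lra. field. lra. }
      set (W1 := fun z => pw1 (- k) y1 (E r + a r * (z - 1)) * a r).
      set (W2 := - k * (- k - 1) * Rpower Y (- k - 2) * a r * a r).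
      assert (Dy : forall z, derivable_pt_lim (fun z => E r + a r * (z - 1)) z (a r)).
      { intros z. apply dl_eq with (0 + a r * (1 - 0)); [|ring].
        apply (dl_plus (fun _ => E r)); [apply dl_const|]. apply dl_scal, (dl_minus (fun z => z) (fun _ => 1)); [apply dl_id|apply dl_const]. }
      assert (EY : E r + a r * (Z + 1 - 1) = Y) by (unfold Y; ring).
      assert (EW1 : W1 (Z + 1) = - k * Rpower Y (- k - 1) * a r).
      { unfold W1. rewrite EY, pw1_right by lra. reflexivity. }
      assert (HW1 : W1 (Z + 1) < 0).
      { rewrite EW1. pose proof (Rpower_pos Y (- k - 1)). specialize (Hap r).
        assert (0 < k * Rpower Y (- k - 1) * a r) by (repeat (apply Rmult_lt_0_compat; [|lra]); lra). lra. }
      destruct (plap_radial (S N) p psi Dt Dx r x0 x1 (fun z => e r + Psi (E r + a r * (z - 1))) W1 W2 (/ 2))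
        as [Hg Hpl]; try assumption; try lra.
      { intros; now apply Epsi. }
      { intros z _. unfold W1. apply dl_eq with (0 + pw1 (- k) y1 (E r + a r * (z - 1)) * a r); [|ring].
        apply (dl_plus (fun _ => e r)); [apply dl_const|].
        apply (dl_comp (fun z => E r + a r * (z - 1)) Psi); [apply Dy|now apply dl_pw]. }
      { rewrite Hr0. unfold W1.
        apply dl_eq with (pw2 (- k) y1 (E r + a r * (Z + 1 - 1)) * a r * a r + pw1 (- k) y1 (E r + a r * (Z + 1 - 1)) * 0).
        - apply (dl_mult (fun z => pw1 (- k) y1 (E r + a r * (z - 1))) (fun _ => a r)); [|apply dl_const].
          apply (dl_comp (fun z => E r + a r * (z - 1)) (pw1 (- k) y1)); [apply Dy|now apply dl_pw1].
        - rewrite EY, pw2_right by lra. unfold W2. ring. }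
      { rewrite Hr0. lra. }
      rewrite Hr0 in Hg, Hpl.
      assert (Hgn : normN (grad Dx r x0) <> 0) by (rewrite Hg, Rabs_left; lra).
      specialize (V Hgn _ Hpl). rewrite Hg, HDt in V.
      assert (HNn : 1 <= INR (S N)) by (rewrite S_INR; pose proof (pos_INR N); lra).
      (* The profile has argument [Z] but is radial about a centre at distance [Z + 1]: hence the
         separate variables [z] and [r] of the estimate. *)
      pose proof (extinction_estimate p q k nu s kappa b D Z (Z + 1) (INR (S N)) Hp Hq eq_refl eq_refl eq_refl
        Hkap Hb ltac:(lra) HZ ltac:(lra) HNn Ekap Eb) as Hest.
      cbv zeta in Hest. fold D in HE, Ha.
      unfold D in Hest. rewrite <- HE, <- Ha in Hest by lra. fold D in Hest. fold Y in Hest. fold W2 in Hest.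
      rewrite <- EW1 in Hest.
      assert (0 <= ep * (exp (- (L * t) + L * r) * L)).
      { apply Rmult_le_pos; [lra|]. apply Rmult_le_pos; [left; apply exp_pos|exact HL]. }
      lra. }
  specialize (Hlt t xt ltac:(lra)). unfold o in Hlt at 1. rewrite normN_vminus0 in Hlt.
  specialize (Hlt (Rmax_r _ _)). unfold w, e in Hlt.
  replace (- (L * t) + L * t) with 0 in Hlt by ring. rewrite exp_0 in Hlt.
  assert (Psi (E t + a t * normN (vminus xt o)) <= Psi (E t)).
  { apply pw_decr; [lra|lra|]. specialize (Hap t). pose proof (normN_nonneg _ (vminus xt o)).
    assert (0 <= a t * normN (vminus xt o)) by (apply Rmult_le_pos; lra). lra. }
  assert (EPt : Psi (E t) = Rpower (E t) (- k)) by (apply pw_right; left; apply HEy; lra).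
  rewrite <- (HE t) by lra.
  unfold ep in Hlt. lra.
Qed.

(** * Positivity *)

(** Both exponents [p - 1] and [q] are below 1, so each term is at most [f / 3] for large [f]. This
    is why a large amplitude lets the decay [exp (- t)] beat diffusion and absorption. *)
Lemma sublinear_small p q C k : 1 < p < 2 -> 0 < q < 1 -> 0 < C -> 0 < k ->
  exists F0, 0 < F0 /\ forall f, F0 <= f -> C * Rpower (f * k) (p - 1) + Rpower (f * k) q < f.
Proof.
  intros Hp Hq HC Hk.
  set (A := C * Rpower k (p - 1)). set (B := Rpower k q).
  assert (HA : 0 < A) by (apply Rmult_lt_0_compat; [lra|apply Rpower_pos]).
  assert (HB : 0 < B) by apply Rpower_pos.
  destruct (Rpower_neg_small (2 - p) (/ 3 / A)) as (Ta & HTa & Ha); [lra|apply Rdiv_lt_0_compat; lra|].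
  destruct (Rpower_neg_small (1 - q) (/ 3 / B)) as (Tb & HTb & Hb); [lra|apply Rdiv_lt_0_compat; lra|].
  exists (Rmax Ta Tb). pose proof (Rmax_l Ta Tb). pose proof (Rmax_r Ta Tb).
  split; [lra|]. intros f Hf. assert (Hf0 : 0 < f) by lra.
  rewrite <- !Rpower_mult_distr by lra.
  replace (Rpower f (p - 1)) with (f * Rpower f (- (2 - p))).
  2:{ rewrite <- (Rpower_1 f) at 1 by lra. rewrite <- Rpower_plus. f_equal; ring. }
  replace (Rpower f q) with (f * Rpower f (- (1 - q))).
  2:{ rewrite <- (Rpower_1 f) at 1 by lra. rewrite <- Rpower_plus. f_equal; ring. }
  specialize (Ha f ltac:(lra)). specialize (Hb f ltac:(lra)).
  apply (Rmult_le_compat_l (A * f)) in Ha; [|apply Rmult_le_pos; lra].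
  apply (Rmult_le_compat_l (B * f)) in Hb; [|apply Rmult_le_pos; lra].
  replace (A * f * (/ 3 / A)) with (f / 3) in Ha by (field; lra).
  replace (B * f * (/ 3 / B)) with (f / 3) in Hb by (field; lra).
  replace (C * (f * Rpower f (- (2 - p)) * Rpower k (p - 1))) with (A * f * Rpower f (- (2 - p))) by (unfold A; ring).
  replace (f * Rpower f (- (1 - q)) * Rpower k q) with (B * f * Rpower f (- (1 - q))) by (unfold B; ring).
  lra.
Qed.

(* Since [r <= Y^(1/n)] and [Y >= 1], every term is at most a constant times [Y^(-k/n)]. *)
Lemma positivity_estimate p q k h f b r M i :
  1 < p < 2 -> 0 < q < p / 2 -> k = q / (1 - q) ->
  let n := S (S i) in
  h = k / INR n -> 1 < (INR n - 1) * (p - 1) ->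
  0 < f -> 1 <= b -> 0 < r -> 1 <= M ->
  let Y := b + r ^ n in
  let W1 := f * (- h * Rpower Y (- h - 1) * (INR n * r ^ S i)) in
  let W2 := f * (- h * (- h - 1) * Rpower Y (- h - 2) * (INR n * r ^ S i) * (INR n * r ^ S i)
             + - h * Rpower Y (- h - 1) * (INR n * ((INR n - 1) * r ^ i))) in
  W1 < 0 /\
  - (((INR n + M) * Rpower (f * k) (p - 1) + Rpower (f * k) q) * Rpower Y (- h)) <=
  Rpower (Rabs W1) (p - 2) * ((p - 1) * W2 + (M - 1) * (W1 / r)) - Rpower (Rabs W1) q.
Proof.
  intros Hp Hq Ek n Eh Hn Hf Hb Hr HM Y W1 W2.
  assert (Hn2 : 2 <= INR n) by (unfold n; rewrite !S_INR; pose proof (pos_INR i); lra).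
  assert (Hk : 0 < k) by (subst k; apply Rdiv_lt_0_compat; lra).
  assert (Hh : 0 < h) by (subst h; apply Rdiv_lt_0_compat; lra).
  assert (Hrn : 0 < r ^ n) by now apply pow_lt.
  assert (HY : 1 <= Y) by (unfold Y; lra).
  assert (HrY : r <= Rpower Y (/ INR n)).
  { rewrite <- (Rpower_1 r) at 1 by exact Hr. replace 1 with (INR n * / INR n) by (field; lra).
    rewrite <- Rpower_mult, Rpower_pow by exact Hr.
    apply Rle_Rpower_l; [left; apply Rinv_0_lt_compat; lra|]. unfold Y; lra. }
  set (P := Rpower Y (- h - 1)). assert (HP : 0 < P) by apply Rpower_pos.
  assert (Er1 : r ^ S i = Rpower r (INR n - 1)).
  { rewrite <- Rpower_pow by exact Hr. f_equal. unfold n. rewrite (S_INR (S i)). ring. }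
  set (Q := Rpower r (INR n - 1)) in *. assert (HQ : 0 < Q) by apply Rpower_pos.
  assert (Er0 : r ^ i = Q / r).
  { rewrite <- Er1. simpl. field. lra. }
  set (G := f * k * (Q * P)).
  assert (HQP : 0 < Q * P) by (apply Rmult_lt_0_compat; lra).
  assert (Hfk : 0 < f * k) by (apply Rmult_lt_0_compat; lra).
  assert (HG : 0 < G) by (apply Rmult_lt_0_compat; lra).
  assert (Ekh : k = h * INR n) by (subst h; field; lra).
  assert (EW1 : W1 = - G).
  { unfold W1, G. rewrite Er1. fold P. rewrite Ekh. ring. }
  rewrite EW1, Rabs_Ropp, Rabs_pos_eq by lra. split; [lra|].
  assert (HW2 : - (G * (INR n - 1) / r) <= W2).
  { unfold W2. rewrite Er1, Er0. fold P.
    assert (0 <= f * (- h * (- h - 1) * Rpower Y (- h - 2) * (INR n * Q) * (INR n * Q))).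
    { replace (f * (- h * (- h - 1) * Rpower Y (- h - 2) * (INR n * Q) * (INR n * Q)))
        with (f * h * (h + 1) * Rpower Y (- h - 2) * (INR n * Q) ^ 2) by ring.
      pose proof (Rpower_pos Y (- h - 2)).
      apply Rmult_le_pos; [|apply pow2_ge_0]. repeat (apply Rmult_le_pos; [|lra]); lra. }
    replace (- (G * (INR n - 1) / r)) with (f * (- h * P * (INR n * ((INR n - 1) * (Q / r))))); [lra|].
    unfold G. rewrite Ekh. field. lra. }
  assert (HB : - (G * (INR n + M) / r) <= (p - 1) * W2 + (M - 1) * (- G / r)).
  { assert (0 < G / r) by (apply Rdiv_lt_0_compat; lra).
    replace (- (G * (INR n + M) / r)) with (- (G / r * (INR n + M))) by (field; lra).
    replace (- (G * (INR n - 1) / r)) with (- (G / r * (INR n - 1))) in HW2 by (field; lra).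
    replace (- G / r) with (- (G / r)) by (field; lra). set (g := G / r) in *.
    apply (Rmult_le_compat_l (p - 1)) in HW2; [|lra].
    assert (0 <= g * (INR n - 1)) by (apply Rmult_le_pos; lra).
    assert ((p - 1) * (g * (INR n - 1)) <= g * (INR n - 1)) by nra.
    assert (0 <= g * M) by (apply Rmult_le_pos; lra). nra. }
  set (s := (p - 2 * q) / (1 - q)). assert (Hs : 0 < s) by (apply Rdiv_lt_0_compat; lra).
  assert (X1 : Rpower G (p - 2) * (G / r) <= Rpower (f * k) (p - 1) * Rpower Y (- h)).
  { assert (E1 : Rpower G (p - 2) * (G / r) = Rpower (f * k) (p - 1) *
      (Rpower r ((INR n - 1) * (p - 1) - 1) * Rpower Y ((- h - 1) * (p - 1)))).
    { unfold G, Q, P. assert (HY0 : 0 < Y) by lra. clear - Hfk Hr HY0. clearbody Y. set (w := f * k) in *. clearbody w.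
      set (N' := INR n) in *. clearbody N'.
      pose proof (exp_ln w Hfk) as E1. pose proof (exp_ln r Hr) as E2. pose proof (exp_ln Y HY0) as E3.
      set (lw := ln w) in *; set (lr := ln r) in *; set (lY := ln Y) in *. clearbody lw lr lY.
      rewrite <- E1, <- E2, <- E3. exp_simpl. f_equal. ring. }
    rewrite E1. apply Rmult_le_compat_l; [left; apply Rpower_pos|].
    apply Rle_trans with (Rpower (Rpower Y (/ INR n)) ((INR n - 1) * (p - 1) - 1) * Rpower Y ((- h - 1) * (p - 1))).
    - apply Rmult_le_compat_r; [left; apply Rpower_pos|]. apply Rle_Rpower_l; lra.
    - rewrite Rpower_mult, <- Rpower_plus. apply Rle_Rpower; [lra|].
      (* Diffusion decays faster than needed by [Y^(-s/n)], which is harmless as [Y >= 1]. *)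
      replace (/ INR n * ((INR n - 1) * (p - 1) - 1) + (- h - 1) * (p - 1)) with (- h - s / INR n).
      + assert (0 < s / INR n) by (apply Rdiv_lt_0_compat; lra). lra.
      + rewrite Eh. unfold s. rewrite Ek. field. lra. }
  assert (X2 : Rpower G q <= Rpower (f * k) q * Rpower Y (- h)).
  { unfold G. rewrite <- (Rpower_mult_distr (f * k) (Q * P)), <- (Rpower_mult_distr Q P) by lra.
    apply Rmult_le_compat_l; [left; apply Rpower_pos|]. unfold Q, P. rewrite !Rpower_mult.
    apply Rle_trans with (Rpower (Rpower Y (/ INR n)) ((INR n - 1) * q) * Rpower Y ((- h - 1) * q)).
    - apply Rmult_le_compat_r; [left; apply Rpower_pos|]. apply Rle_Rpower_l; [apply Rmult_le_pos; lra|lra].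
    (* For absorption there is no slack: the exponents coincide because [h n = k] and
       [k (1 - q) = q]. *)
    - rewrite Rpower_mult, <- Rpower_plus. right. f_equal. rewrite Eh, Ek. field. lra. }
  assert (X3 : Rpower G (p - 2) * - (G * (INR n + M) / r) <= Rpower G (p - 2) * ((p - 1) * W2 + (M - 1) * (- G / r))).
  { apply Rmult_le_compat_l; [left; apply Rpower_pos|exact HB]. }
  replace (Rpower G (p - 2) * - (G * (INR n + M) / r)) with (- ((INR n + M) * (Rpower G (p - 2) * (G / r)))) in X3 by (field; lra).
  apply (Rmult_le_compat_l (INR n + M)) in X1; [|lra].
  rewrite Rmult_plus_distr_r. lra.
Qed.

(** Nonnegativity of [u] closes the comparison on a large sphere and at the final time, where the
    barrier lowered by the corrector is negative. *)
Lemma positivity N p q (u : R -> RN N -> R) :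
  (1 <= N)%nat -> 1 < p < 2 -> 0 < q < p / 2 -> cont_closed u -> visc_super p q u ->
  (forall t x, 0 <= t -> 0 <= u t x) ->
  (forall M, exists R, forall x, R < normN x -> M < Rpower (normN x) (q / (1 - q)) * u 0 x) ->
  (forall x, 0 < u 0 x) -> forall t x, 0 < t -> 0 < u t x.
Proof.
  intros HN Hp Hq Hu Hsup Hnn Hgrow Hpos t xt Ht.
  set (k := q / (1 - q)) in *.
  assert (Hk : 0 < k) by (apply Rdiv_lt_0_compat; lra).
  destruct (exists_flat_order p) as (j & Hj2 & Hj); [lra|].
  assert (Hkj : exists i, (2 * j)%nat = S (S i)) by (exists (2 * j - 2)%nat; lia).
  destruct Hkj as [i Ei].
  assert (En : INR (S (S i)) = 2 * INR j) by (rewrite <- Ei, mult_INR; reflexivity).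
  set (n := S (S i)) in *.
  assert (Hn2 : 2 <= INR n) by (unfold n; rewrite !S_INR; pose proof (pos_INR i); lra).
  set (h := k / INR n). assert (Hh : 0 < h) by (apply Rdiv_lt_0_compat; lra).
  assert (HM : 1 <= INR N) by (apply (le_INR 1); exact HN).
  destruct (sublinear_small p q (INR n + INR N) k) as (F0 & HF0 & HF); try lra.
  (* Keeps the amplitude [A exp (- s)] above [F0] up to the final time [t + 1]. *)
  set (A := F0 * exp (t + 1)). assert (HA : 0 < A) by (apply Rmult_lt_0_compat; [lra|apply exp_pos]).
  set (o := fun _ : Fin.t N => 0).
  destruct (Hgrow A) as (R1 & HR1).
  (* The minimum of the initial datum over a ball, obtained on a cylinder reduced to time 0. *)
  destruct (max_on_cylinder N (fun t x => - 1 * u t x) 0 0 o (Rmax 0 R1)) as (t0 & xm & Ht0 & _ & Hmin).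
  { intros s x Hs. apply (contAt_mult N (fun s => 0 <= s)); [apply contAt_const|exact (Hu s x Hs)]. }
  { lra. }
  { apply Rmax_l. }
  assert (t0 = 0) by lra. subst t0.
  set (c := u 0 xm) in *. assert (Hc : 0 < c) by apply Hpos.
  destruct (Rpower_neg_small h (c / A)) as (T0 & HT0 & Hb0); [lra|now apply Rdiv_lt_0_compat|].
  set (b := Rmax 1 T0). assert (Hb : 1 <= b) by apply Rmax_l.
  assert (HbA : A * Rpower b (- h) <= c).
  { replace c with (A * (c / A)) by (field; lra). apply Rmult_le_compat_l; [lra|]. apply Hb0, Rmax_r. }
  set (Y := fun r => b + r ^ n).
  assert (HY : forall r, 0 <= r -> b <= Y r) by (intros r Hr; unfold Y; pose proof (pow_le r n Hr); lra).
  (* Inside the ball [Y >= b], with [b] chosen from the minimum [c]; outside [Y >= |x|^n] gives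
     [Y^(-h) <= |x|^(-k)], and the growth hypothesis applies. *)
  assert (Hini : forall x, A * Rpower (Y (normN x)) (- h) <= u 0 x).
  { intros x. pose proof (normN_nonneg N x) as Hx. specialize (HY _ Hx).
    destruct (Rle_or_lt (normN x) (Rmax 0 R1)) as [Hle|Hgt].
    - specialize (Hmin 0 x ltac:(lra)). unfold o in Hmin. rewrite normN_vminus0 in Hmin. specialize (Hmin Hle).
      assert (Rpower (Y (normN x)) (- h) <= Rpower b (- h)) by (apply Rpower_decr; lra).
      apply (Rmult_le_compat_l A) in H; [|lra]. cbv beta in Hmin. fold c in Hmin. lra.
    - assert (Hx0 : 0 < normN x) by (pose proof (Rmax_l 0 R1); lra).
      specialize (HR1 x ltac:(pose proof (Rmax_r 0 R1); lra)).
      assert (Hle : Rpower (Y (normN x)) (- h) <= Rpower (normN x ^ n) (- h)).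
      { apply Rpower_decr; [|lra]. split; [now apply pow_lt|unfold Y; lra]. }
      rewrite <- (Rpower_pow n) in Hle by exact Hx0. rewrite Rpower_mult in Hle.
      replace (INR n * - h) with (- k) in Hle by (unfold h; field; lra). rewrite (Rpower_Ropp (normN x)) in Hle.
      pose proof (Rpower_pos (normN x) k) as Hpk.
      apply Rle_trans with (A * / Rpower (normN x) k); [apply Rmult_le_compat_l; lra|].
      apply Rmult_le_reg_r with (Rpower (normN x) k); [lra|]. rewrite Rmult_assoc, Rinv_l; lra. }
  set (wt := A * exp (- t) * Rpower (Y (normN xt)) (- h)).
  assert (Hwt : 0 < wt) by (repeat apply Rmult_lt_0_compat; auto using exp_pos, Rpower_pos).
  (* At [(t, xt)] the barrier will be [wt - 2 ep], still positive. *)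
  set (ep := wt / 4). assert (Hep : 0 < ep) by (unfold ep; lra).
  (* On the sphere of radius [R2] the profile is at most [ep], which the lowering in [e] absorbs. *)
  destruct (Rpower_neg_small h (ep / A)) as (T1 & HT1 & HbR); [lra|apply Rdiv_lt_0_compat; lra|].
  set (R2 := Rmax 1 (Rmax T1 (normN xt))).
  assert (HR2 : 1 <= R2 /\ T1 <= R2 /\ normN xt <= R2).
  { unfold R2. split; [apply Rmax_l|]. pose proof (Rmax_r 1 (Rmax T1 (normN xt))).
    pose proof (Rmax_l T1 (normN xt)). pose proof (Rmax_r T1 (normN xt)). split; lra. }
  (* At time [t + 1] the corrector lowers the barrier by at least [ep + A], more than its
     amplitude. *)
  set (L := A / ep). assert (HL : 0 < L) by (apply Rdiv_lt_0_compat; lra).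
  set (e := fun s => - ep + - ep * exp (- (L * t) + L * s)).
  set (f := fun s => 0 + A * exp (0 + - 1 * s)).
  set (E := fun s : R => b + 0 * s).
  set (a := fun s : R => 1 + 0 * s).
  set (rho := fun z => 0 + 1 * z).
  (* As [Y >= b >= 1], the continuation is never reached. *)
  set (Psi := pw (- h) 1).
  set (psi := bar o j e f E a rho Psi).
  assert (Cr : C2R rho) by apply C2R_linear.
  assert (CP : C2R Psi) by (apply C2R_pw; lra).
  assert (Ce : C2R e) by apply C2R_affine, C2R_exp.
  assert (Cf : C2R f) by apply C2R_affine, C2R_exp.
  assert (CE : C2R E) by apply C2R_linear.
  assert (Ca : C2R a) by apply C2R_linear.
  assert (Ef : forall s, f s = A * exp (- s)).
  { intros s. unfold f. rewrite Rplus_0_l. do 2 f_equal; ring. }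
  assert (Hf : forall s, 0 < f s) by (intros s; rewrite Ef; apply Rmult_lt_0_compat; [lra|apply exp_pos]).
  assert (HfA : forall s, 0 <= s -> f s <= A).
  { intros s Hs. rewrite Ef. rewrite <- (Rmult_1_r A) at 2. apply Rmult_le_compat_l; [lra|].
    rewrite <- exp_0. destruct Hs as [Hs| <-]; [left; apply exp_increasing; lra|rewrite Ropp_0; lra]. }
  assert (HfF : forall s, s <= t + 1 -> F0 <= f s).
  { intros s Hs. rewrite Ef. unfold A. rewrite Rmult_assoc, <- exp_plus.
    rewrite <- (Rmult_1_r F0) at 1. apply Rmult_le_compat_l; [lra|].
    apply Rle_trans with (exp 0); [rewrite exp_0; lra|].
    destruct Hs as [Hs| ->]; [left; apply exp_increasing; lra|]. rewrite Rplus_opp_r. lra. }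
  assert (Hexp : forall s, 0 < ep * exp (- (L * t) + L * s)).
  { intros s. apply Rmult_lt_0_compat; [lra|apply exp_pos]. }
  destruct (bar_admissible N p o j e f E a rho Psi) as (Dt & Dx & HAd); try assumption.
  { intros s _. specialize (Hf s); lra. }
  { intros s _. unfold a. lra. }
  { apply (C2R_derivative_neq0 rho (fun _ => 1) (fun y => 0 <= y)); [|intros; lra].
    intros y. eapply dl_eq; [apply (dl_plus (fun _ => 0)); [apply dl_const|apply dl_scal, dl_id]|ring]. }
  { intros y l. apply (C2R_derivative_neq0 Psi (pw1 (- h) 1) (fun _ => True)); [|intros|exact I].
    - intros; apply dl_pw; lra.
    - apply Rlt_not_eq, pw1_neg; lra. }
  assert (EPsi : forall r, 0 <= r -> Psi (Y r) = Rpower (Y r) (- h)).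
  { intros r Hr. apply pw_right. specialize (HY r Hr); lra. }
  assert (Epsi : forall s x, psi s x = e s + f s * Psi (Y (normN (vminus x o)))).
  { intros s x. unfold psi, bar, E, a, rho, Y. rewrite <- Ei, normN_pow_even. do 3 f_equal. ring. }
  assert (HP1 : forall r, 0 <= r -> 0 < Psi (Y r) <= 1).
  { intros r Hr. rewrite EPsi by exact Hr. split; [apply Rpower_pos|]. rewrite Rpower_Ropp.
    rewrite <- Rinv_1. apply Rinv_le_contravar; [lra|]. apply Rpower_ge_1; [|lra]. specialize (HY r Hr); lra. }
  assert (Hlt : forall s x, 0 <= s <= t + 1 -> normN (vminus x o) <= R2 -> psi s x - u s x < 0).
  { apply interior_max; try lra.
    - intros s x Hs. apply (contAt_ext N (fun s => 0 <= s) (fun s y => psi s y + - 1 * u s y)); [intros; ring|].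
      apply contAt_plus; [now apply bar_cont|]. apply contAt_mult; [apply contAt_const|exact (Hu s x Hs)].
    - intros x _. rewrite Epsi. rewrite EPsi by apply normN_nonneg. unfold o. rewrite normN_vminus0.
      specialize (Hini x). rewrite Ef, Ropp_0, exp_0, Rmult_1_r. unfold e. specialize (Hexp 0). lra.
    - intros x _. rewrite Epsi. specialize (HP1 _ (normN_nonneg N (vminus x o))).
      specialize (Hnn (t + 1) x ltac:(lra)). specialize (HfA (t + 1) ltac:(lra)). specialize (Hf (t + 1)).
      unfold e. replace (- (L * t) + L * (t + 1)) with L by ring.
      assert (H1 : ep * (1 + L) <= ep * exp L).
      { apply Rmult_le_compat_l; [lra|left; apply exp_ineq1; lra]. }
      replace (ep * (1 + L)) with (ep + A) in H1 by (unfold L; field; lra).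
      assert (f (t + 1) * Psi (Y (normN (vminus x o))) <= A * 1) by (apply Rmult_le_compat; lra). lra.
    - intros s x Hs Hx. rewrite Epsi, Hx. rewrite EPsi by lra.
      specialize (Hnn s x ltac:(lra)). specialize (HfA s ltac:(lra)). specialize (Hf s). specialize (Hexp s).
      assert (HYR : R2 <= Y R2).
      { unfold Y. assert (R2 <= R2 ^ n); [|lra]. unfold n. change (R2 <= R2 * R2 ^ S i).
        rewrite <- (Rmult_1_r R2) at 1. apply Rmult_le_compat_l; [lra|]. apply pow_R1_Rle; lra. }
      specialize (HbR (Y R2) ltac:(lra)).
      assert (f s * Rpower (Y R2) (- h) <= A * (ep / A)).
      { apply Rmult_le_compat; try lra. left; apply Rpower_pos. }
      replace (A * (ep / A)) with ep in H by (field; lra). unfold e. lra.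
    - intros s x Hs Hs' Hx Hge Hmax.
      assert (Hmin' : loc_min (fun t x => u t x - psi t x) s x).
      { destruct Hmax as (dl & Hdl & Hmax). exists dl. split; [exact Hdl|].
        intros s' y H1 H2 H3. specialize (Hmax s' y H1 H2 H3). cbv beta in Hmax. lra. }
      destruct (Hsup psi Dt Dx HAd s x Hs Hmin') as [V1 V2]. destruct HAd as [HC2 _].
      set (r := normN (vminus x o)) in *.
      assert (Hr : 0 <= r) by apply normN_nonneg.
      assert (HDt : Dt s x = - ep * (exp (- (L * t) + L * s) * L) + A * (exp (0 + - 1 * s) * - 1) * Psi (Y r)).
      { apply (time_derivative N psi Dt Dx); [exact HC2|exact Hs|].
        apply dl_local with (f := fun t => e t + f t * Psi (Y r)) (d := 1); [lra| |].
        - intros z _. symmetry; apply Epsi.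
        - apply dl_plus; [apply dl_affine, derivable_pt_lim_exp|].
          apply dl_eq with (A * (exp (0 + - 1 * s) * - 1) * Psi (Y r) + f s * 0); [|ring].
          apply (dl_mult f (fun _ => Psi (Y r))); [|apply dl_const].
          apply dl_affine, derivable_pt_lim_exp. }
      assert (HDt' : Dt s x < - (f s * Psi (Y r))).
      { rewrite HDt. assert (0 < ep * (exp (- (L * t) + L * s) * L)).
        { apply Rmult_lt_0_compat; [lra|]. apply Rmult_lt_0_compat; [apply exp_pos|exact HL]. }
        unfold f. lra. }
      destruct (HP1 r Hr) as [HPp _].
      assert (HfP : 0 < f s * Psi (Y r)) by (apply Rmult_lt_0_compat; auto).
      destruct Hr as [Hr|Hr].
      (* Contact at the centre would force [0 <= Dt], but the barrier strictly decreases in time. *)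
      2:{ assert (x = o).
          { extensionality m. assert (Hz := normN_eq0 N (vminus x o) m (eq_sym Hr)). unfold vminus in Hz; lra. }
          rewrite H in V2. specialize (V2 (bar_center N o j e f E a rho Psi Dt Dx s HC2 Cr CP Hs)).
          rewrite H in HDt'. lra. }
      destruct (positivity_estimate p q k h (f s) b r (INR N) i) as [Hneg Hest]; auto; try lra.
      { fold n. rewrite En. exact Hj. }
      fold n in Hneg, Hest. fold (Y r) in Hneg, Hest.
      set (g := fun r => INR n * r ^ S i).
      set (W1 := fun r => f s * (pw1 (- h) 1 (Y r) * g r)).
      set (W2 := f s * (- h * (- h - 1) * Rpower (Y r) (- h - 2) * g r * g r
             + - h * Rpower (Y r) (- h - 1) * (INR n * ((INR n - 1) * r ^ i)))).
      assert (Dy : forall r, derivable_pt_lim Y r (g r)).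
      { intros z. apply dl_eq with (0 + g z); [|ring].
        apply (dl_plus (fun _ => b)); [apply dl_const|apply dl_pow]. }
      assert (HYr : b <= Y r) by (apply HY; lra).
      assert (EW1 : W1 r = f s * (- h * Rpower (Y r) (- h - 1) * g r)).
      { unfold W1. rewrite pw1_right by lra. reflexivity. }
      fold (g r) in Hneg, Hest. fold W2 in Hest. rewrite <- EW1 in Hneg, Hest.
      destruct (plap_radial N p psi Dt Dx s x o (fun r => e s + f s * Psi (Y r)) W1 W2 1)
        as [Hg Hpl]; try assumption; try lra.
      { intros; apply Epsi. }
      { intros z _. unfold W1. apply dl_eq with (0 + f s * (pw1 (- h) 1 (Y z) * g z)); [|ring].
        apply (dl_plus (fun _ => e s)); [apply dl_const|]. apply dl_scal.
        apply (dl_comp Y Psi); [apply Dy|apply dl_pw; lra]. }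
      { fold r. unfold W1.
        apply dl_eq with (f s * (pw2 (- h) 1 (Y r) * g r * g r + pw1 (- h) 1 (Y r) * (INR n * (INR (S i) * r ^ pred (S i))))).
        - apply dl_scal. apply (dl_mult (fun r => pw1 (- h) 1 (Y r)) g).
          + apply (dl_comp Y (pw1 (- h) 1)); [apply Dy|apply dl_pw1; lra].
          + unfold g. apply dl_scal, dl_pow.
        - rewrite pw1_right, pw2_right by lra. unfold W2. change (pred (S i)) with i.
          replace (INR n - 1) with (INR (S i)) by (unfold n; rewrite (S_INR (S i)); ring). ring. }
      { fold r. lra. }
      fold r in Hg, Hpl.
      assert (Hgn : normN (grad Dx s x) <> 0) by (rewrite Hg, Rabs_left; lra).
      specialize (V1 Hgn _ Hpl). rewrite Hg in V1.
      rewrite EPsi in HDt', HfP, HPp by lra.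
      specialize (HF (f s) (HfF s ltac:(lra))).
      apply (Rmult_lt_compat_r (Rpower (Y r) (- h))) in HF; [|exact HPp]. lra. }
  specialize (Hlt t xt ltac:(lra)). unfold o in Hlt at 1. rewrite normN_vminus0 in Hlt.
  specialize (Hlt ltac:(lra)). rewrite Epsi in Hlt. unfold o in Hlt. rewrite normN_vminus0 in Hlt.
  rewrite EPsi, Ef in Hlt by apply normN_nonneg. fold wt in Hlt. unfold e in Hlt.
  replace (- (L * t) + L * t) with 0 in Hlt by ring. rewrite exp_0 in Hlt. unfold ep in Hlt. lra.
Qed.

(** * Decay at infinity, vanishing after the extinction time, conclusion *)

Lemma decay_at_infinity N p q C0 k (u : R -> RN N -> R) :
  (1 <= N)%nat -> 1 < p < 2 -> cont_closed u -> visc_sub p q u ->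
  0 < C0 -> 0 < k -> (forall x, u 0 x <= C0 * Rpower (1 + normN x) (- k)) ->
  forall T eta, 0 <= T -> 0 < eta -> exists R, 0 < R /\
    forall t x, 0 <= t <= T -> R <= normN x -> u t x <= eta.
Proof.
  intros HN Hp Hu Hsub HC0 Hk Hini T eta HT Heta.
  (* The radius [R1] does not depend on the centre: around a distant point, the initial datum is at
     most [eta / 2] on the whole ball. *)
  destruct (local_bound N p q u HN Hp Hu Hsub T (eta / 2)) as (R1 & HR1 & H); [lra|lra|].
  destruct (Rpower_neg_small k (eta / 2 / C0)) as (R2 & HR2 & H2); [lra|apply Rdiv_lt_0_compat; lra|].
  exists (R1 + R2). split; [lra|]. intros t c Ht Hc.
  replace eta with (eta / 2 + eta / 2) by field. apply (H 0 c); [lra| |lra].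
  intros x Hx. eapply Rle_trans; [apply Hini|].
  replace (eta / 2) with (C0 * (eta / 2 / C0)) by (field; lra).
  apply Rmult_le_compat_l; [lra|]. apply H2.
  pose proof (normN_triangle N c x (fun _ => 0)) as Htri. rewrite !normN_vminus0, normN_sym in Htri. lra.
Qed.

(** Continuity at [T] gives [u <= 0] there, because the bound is of order [(T - t)^(nu k)]. The
    local bound restarted at [T] with [M = 0] and arbitrary [eta] propagates this to all later
    times. *)
Lemma vanishing_after N p q (u : R -> RN N -> R) T b nu k :
  (1 <= N)%nat -> 1 < p < 2 -> cont_closed u -> visc_sub p q u ->
  0 < T -> 0 < b -> 0 < nu -> 0 < k ->
  (forall t x, 0 <= t < T -> u t x <= Rpower (b * Rpower (T - t) (- nu)) (- k)) ->
  forall t x, T <= t -> u t x <= 0.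
Proof.
  intros HN Hp Hu Hsub HT Hb Hnu Hk Hbd.
  assert (HuT : forall x, u T x <= 0).
  { intros x. apply Rle_plus_epsilon. intros eps Heps. rewrite Rplus_0_l.
    destruct (Hu T x ltac:(lra) (eps / 2) ltac:(lra)) as (d & Hd & H).
    pose proof (Rpower_pos b (- k)) as HB.
    destruct (Rpower_small (nu * k) (eps / 2 / Rpower b (- k))) as (d' & Hd' & H').
    { apply Rmult_lt_0_compat; lra. }
    { apply Rdiv_lt_0_compat; lra. }
    set (h := Rmin T (Rmin d d') / 2).
    assert (Hh : 0 < h /\ h < T /\ h < d /\ h < d').
    { assert (0 < Rmin T (Rmin d d')) by (repeat apply Rmin_glb_lt; lra).
      pose proof (Rmin_l T (Rmin d d')). pose proof (Rmin_r T (Rmin d d')).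
      pose proof (Rmin_l d d'). pose proof (Rmin_r d d'). unfold h. lra. }
    specialize (H (T - h) x ltac:(lra)). specialize (H' h ltac:(lra)).
    replace (T - h - T) with (- h) in H by ring. rewrite Rabs_Ropp, Rabs_pos_eq, normN_refl in H by lra.
    specialize (H ltac:(lra) ltac:(lra)). apply Rabs_def2 in H.
    specialize (Hbd (T - h) x ltac:(lra)). replace (T - (T - h)) with h in Hbd by ring.
    rewrite <- Rpower_mult_distr, Rpower_mult in Hbd by (try apply Rpower_pos; lra).
    replace (- nu * - k) with (nu * k) in Hbd by ring.
    apply (Rmult_lt_compat_l (Rpower b (- k))) in H'; [|lra].
    replace (Rpower b (- k) * (eps / 2 / Rpower b (- k))) with (eps / 2) in H' by (field; lra). lra. }
  intros t x Ht. apply Rle_plus_epsilon. intros eps Heps.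
  destruct (local_bound N p q u HN Hp Hu Hsub t eps) as (R1 & _ & H); [lra|lra|].
  apply (H T x 0); [lra| |lra]. intros; apply HuT.
Qed.

Theorem theorem1p1 (N : nat) (p q : R) (u0 : RN N -> R) (u : R -> RN N -> R)
  (HN : (1 <= N)%nat)
  (Hp : 2 * INR N / (INR N + 1) < p /\ p < 2)
  (Hq : 0 < q /\ q < p / 2)
  (Hu0L1 : L1 u0) (Hu0W : W1inf u0)
  (Hu0nn : forall x, 0 <= u0 x) (Hu0nz : exists x, u0 x <> 0)
  (Hunn : forall t x, 0 <= t -> 0 <= u t x)
  (Hucont : cont_closed u)
  (Huinit : forall x, u 0 x = u0 x)
  (Husol : visc_solution p q u) :
  ((exists C0, 0 < C0 /\
      forall x, u0 x <= C0 * Rpower (1 + normN x) (- (q / (1 - q)))) ->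
    exists Te, is_lub (nonext_set u) Te /\ 0 < Te) /\
  ((forall M, exists Rr, forall x, Rr < normN x ->
       M < Rpower (normN x) (q / (1 - q)) * u0 x) ->
   (forall x, 0 < u0 x) ->
    ~ bound (nonext_set u) /\ (forall t x, 0 < t -> 0 < u t x)).
Proof.
  destruct Husol as (_ & Hsub & Hsup).
  (* [2 N / (N + 1) >= 1] as soon as [N >= 1]. *)
  assert (Hp1 : 1 < p < 2).
  { assert (H1 : 1 <= INR N) by (apply (le_INR 1); exact HN). split; [|lra].
    apply Rle_lt_trans with (2 * INR N / (INR N + 1)); [|lra].
    apply Rmult_le_reg_r with (INR N + 1); [lra|]. unfold Rdiv. rewrite Rmult_assoc, Rinv_l; lra. }
  split.
  - intros (C0 & HC0 & Hini).
    destruct N as [|N]; [lia|].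
    assert (Hini' : forall x, u 0 x <= C0 * Rpower (1 + normN x) (- (q / (1 - q)))) by (intros x; rewrite Huinit; apply Hini).
    assert (Hk : 0 < q / (1 - q)) by (apply Rdiv_lt_0_compat; lra).
    destruct (extinction N p q C0 u Hp1 Hq Hucont Hsub) as (T & b & nu & k & HT & Hb & Hnu & Hk' & Hbd); auto.
    { now apply (decay_at_infinity _ p q C0 (q / (1 - q))). }
    pose proof (vanishing_after _ p q u T b nu k HN Hp1 Hucont Hsub HT Hb Hnu Hk' Hbd) as Hvan.
    destruct Hu0nz as (x & Hx).
    assert (Hx0 : 0 < u 0 x) by (rewrite Huinit; specialize (Hu0nn x); lra).
    (* Continuity at time 0 keeps [u] positive at [x] up to time [d / 2], a positive lower bound for
       the extinction time. *)
    destruct (Hucont 0 x ltac:(lra) (u 0 x) Hx0) as (d & Hd & H).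
    assert (Hin : nonext_set u (d / 2)).
    { split; [lra|]. exists x. specialize (H (d / 2) x ltac:(lra)).
      rewrite Rminus_0_r, Rabs_pos_eq, normN_refl in H by lra.
      specialize (H ltac:(lra) Hd). apply Rabs_def2 in H. lra. }
    destruct (completeness (nonext_set u)) as (Te & HTe).
    { exists T. intros t (Ht & y & Hy). apply Rnot_lt_le. intros Hlt. apply Hy.
      apply Rle_antisym; [apply Hvan; lra|now apply Hunn]. }
    { now exists (d / 2). }
    exists Te. split; [exact HTe|]. destruct HTe as [Hub _]. specialize (Hub _ Hin). lra.
  - intros Hgrow Hpos.
    assert (Hall : forall t x, 0 < t -> 0 < u t x).
    { apply (positivity N p q u); auto.
      - intros M. destruct (Hgrow M) as (R1 & HR). exists R1. intros x Hx. rewrite Huinit. now apply HR.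
      - intros x. rewrite Huinit. apply Hpos. }
    split; [|exact Hall]. intros (m & Hm).
    assert (Hin : nonext_set u (Rmax 0 m + 1)).
    { pose proof (Rmax_l 0 m). split; [lra|]. exists (fun _ => 0).
      specialize (Hall (Rmax 0 m + 1) (fun _ => 0) ltac:(lra)). lra. }
    specialize (Hm _ Hin). pose proof (Rmax_r 0 m). lra.
Qed.
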